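(* Let $f$ be a transcendental entire function, and let $N\in\mathbb{N}$. Then there exists a non-empty bounded open set $V\subset\mathbb{C}$ such that $V\subset f(V)$ and such that any point in $V$ has at least $N$ preimages under $f$ in $V$, counted with multiplicity.
   Context: A transcendental entire function is an entire function $\mathbb{C}\to\mathbb{C}$ that is not a polynomial. The multiplicity of a preimage $z$ of $w$ is the order of vanishing of $f-w$ at $z$. *)

(* Defs.v *)
From Stdlib Require Export Reals List.
From Coquelicot Require Export Coquelicot.
Open Scope C_scope.

(* On [C -> C], [ex_derive] elaborates to complex differentiability: the scalar
   field is [C_AbsRing], not [R_AbsRing]. *)
Definition entire (f : C -> C) : Prop := forall z : C, ex_derive f z.

Definition polynomial_function (f : C -> C) : Prop :=
  exists (n : nat) (a : nat -> C),
    forall z : C, f z = sum_n (fun k => a k * z ^ k) n.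

Definition transcendental_entire (f : C -> C) : Prop :=
  entire f /\ ~ polynomial_function f.

(* The factor [h] is holomorphic on a neighbourhood of [z].  No finite [m]
   qualifies when [g] vanishes identically near [z]. *)
Definition vanishing_order (g : C -> C) (z : C) (m : nat) : Prop :=
  exists h : C -> C,
    locally z (fun u => ex_derive h u) /\
    h z <> 0 /\
    locally z (fun u => g u = (u - z) ^ m * h u).

Definition multiplicity (f : C -> C) (w z : C) (m : nat) : Prop :=
  vanishing_order (fun u => f u - w) z m.

(* [l] lists finitely many distinct preimages, so the definition also makes sense
   when the set of all preimages is infinite. *)
Definition at_least_preimages (f : C -> C) (V : C -> Prop) (w : C) (N : nat)
  : Prop :=
  exists (l : list C) (m : C -> nat),
    NoDup l /\
    (forall z : C, In z l -> V z /\ f z = w /\ multiplicity f w z (m z)) /\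
    (N <= list_sum (map m l))%nat.

Definition image (f : C -> C) (V : C -> Prop) (w : C) : Prop :=
  exists z : C, V z /\ f z = w.

Definition bounded_set (V : C -> Prop) : Prop :=
  exists M : R, forall z : C, V z -> (Cmod z <= M)%R.

(* Main.v *)
Require Import Defs.
From Stdlib Require Import ZArith Lra Lia Psatz ClassicalEpsilon.
Local Open Scope C_scope.

(** Let [R] be large and consider [2 N] concentric circles with radii between [R]
    and [2 R], evenly spaced, and discs of radius [R / (8 N)] centred on them. On
    each such disc either [f] omits two values of size at most [4 R] at distance
    at least [R / (4 N)] from each other, or its image contains all these
    discs, except possibly some of those around a single circle.

    Suppose first that every circle carries a disc of the second kind, and pick
    one on each. Each of the [2 N] chosen discs covers all of them but at most
    one, so a subfamily can be extracted in which each disc is covered by at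
    least [N] members ([covering_indices]). The chosen discs are disjoint, hence
    the union [V] of the subfamily has the required property
    ([covering_discs_case]).

    Otherwise all discs centred on one of the circles, of radius [s] say, are of
    the first kind. By Schottky's theorem in a form that is linear in
    [ln (2 + |f| / R)], this quantity changes at most by a constant factor from
    one such disc to the next and therefore along the whole circle
    ([growth_comparable_near_circle]). As [f] is not a polynomial, [R] can be
    chosen such that [|f|] exceeds any prescribed power of [R] somewhere on the
    disc of radius [R] ([nonpolynomial_growth]); so [|f|] is at least
    [R ^ (N + 3)] on the circle of radius [s]. Then [V] can be the disc of radius
    [s]: if [f - w] had fewer than [N] zeros in it, dividing these out would
    leave a zero-free function, and Cauchy's estimate for its inverse would make
    [f - w] too large near the origin ([many_preimages_large_circle]).

    Schottky's theorem is derived from Bloch's theorem through Landau's device of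
    writing a function that omits 0 and 1 as [exp (2 pi i cosh^2 H)], where the
    range of [H] contains no disc of radius 7 ([landau_lift]).

    The underlying complex analysis starts from bare differentiability. Goursat's
    theorem on triangles gives primitives on discs ([holo_primitive]). For a
    primitive, the difference quotient at a point is again holomorphic, hence
    has a primitive itself; this is Cauchy's formula, and by differentiating it
    one sees that derivatives of holomorphic functions are holomorphic
    ([holo_derive]). No power series are used: zeros are divided out by means of
    difference quotients, and a zero of infinite order is excluded by Cauchy's
    estimate ([entire_order]). *)

(** * Complex derivatives *)

Lemma is_derive_C_iff (f : C -> C) (z l : C) :
  is_derive f z l <->
  forall eps : R, (0 < eps)%R -> exists del : R, (0 < del)%R /\
    forall u : C, (Cmod (u - z) < del)%R ->
      (Cmod (f u - f z - l * (u - z)) <= eps * Cmod (u - z))%R.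
Proof.
split.
- intros [_ H] eps He.
  destruct (H z (fun P HP => HP) (mkposreal eps He)) as [d Hd].
  exists d. split. apply cond_pos.
  intros u Hu. specialize (Hd u Hu). rewrite (Cmult_comm l). exact Hd.
- intros H. split. apply is_linear_scal_l.
  intros x Hx.
  rewrite <- (is_filter_lim_locally_unique (V := AbsRing_NormedModule C_AbsRing) z x Hx).
  intros eps. destruct (H eps (cond_pos eps)) as [d [Hd Hd']].
  exists (mkposreal d Hd). intros u Hu. specialize (Hd' u Hu).
  rewrite (Cmult_comm l) in Hd'. exact Hd'.
Qed.

Lemma continuous_C_iff (f : C -> C) (z : C) :
  continuous f z <->
  forall eps : R, (0 < eps)%R -> exists del : R, (0 < del)%R /\
    forall u : C, (Cmod (u - z) < del)%R -> (Cmod (f u - f z) < eps)%R.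
Proof.
split.
- intros H eps He.
  assert (H2 : locally (T:=C_UniformSpace) z (fun u => (Cmod (f u - f z) < eps)%R)).
  { apply (H (fun y => (Cmod (y - f z) < eps)%R)).
    apply locally_C. exists (mkposreal eps He). intros y Hy. exact Hy. }
  apply locally_C in H2. destruct H2 as [d Hd].
  exists d. split. apply cond_pos. intros u Hu; apply Hd, Hu.
- intros H P HP. apply locally_C in HP. destruct HP as [e He].
  destruct (H e (cond_pos e)) as [d [Hd Hd']]. unfold filtermap. apply locally_C.
  exists (mkposreal d Hd). intros u Hu. apply He. apply Hd'. exact Hu.
Qed.

Lemma locally_C_iff (P : C -> Prop) (z : C) :
  locally z P <->
  exists del : R, (0 < del)%R /\ forall u : C, (Cmod (u - z) < del)%R -> P u.
Proof.
split.
- intros H. apply locally_C in H. destruct H as [d Hd].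
  exists d. split. apply cond_pos. intros u Hu. apply Hd, Hu.
- intros [d [Hd H]]. apply locally_C. exists (mkposreal d Hd).
  intros u Hu. apply H, Hu.
Qed.

(** The product rule concerns functions into the ring itself, whose module
    structure is not convertible to the one that [C] carries by default. *)
Lemma is_derive_C_AbsRing (f : C -> C) (z l : C) :
  is_derive f z l <-> is_derive (V := AbsRing_NormedModule C_AbsRing) f z l.
Proof.
split; intros [_ H]; (split; [apply is_linear_scal_l|exact H]).
Qed.

Lemma is_derive_Cconst (a z : C) : is_derive (fun _ : C => a) z (RtoC 0).
Proof. exact (is_derive_const a z). Qed.

Lemma is_derive_Cid (z : C) : is_derive (fun u : C => u) z (RtoC 1).
Proof. apply is_derive_C_AbsRing. exact (is_derive_id z). Qed.

Lemma is_derive_Cplus (f g : C -> C) (z a b : C) :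
  is_derive f z a -> is_derive g z b -> is_derive (fun u => f u + g u) z (a + b).
Proof. intros Hf Hg. exact (is_derive_plus f g z a b Hf Hg). Qed.

Lemma is_derive_Cmult (f g : C -> C) (z a b : C) :
  is_derive f z a -> is_derive g z b ->
  is_derive (fun u => f u * g u) z (a * g z + f z * b).
Proof.
intros Hf Hg. apply is_derive_C_AbsRing in Hf. apply is_derive_C_AbsRing in Hg.
apply is_derive_C_AbsRing. exact (is_derive_mult f g z a b Hf Hg Cmult_comm).
Qed.

Lemma is_derive_Ccomp (f g : C -> C) (z a b : C) :
  is_derive f (g z) a -> is_derive g z b -> is_derive (fun u => f (g u)) z (a * b).
Proof.
intros Hf Hg. apply is_derive_C_AbsRing in Hg.
rewrite Cmult_comm. exact (is_derive_comp f g z a b Hf Hg).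
Qed.

Lemma is_derive_Cscal (f : C -> C) (k z a : C) :
  is_derive f z a -> is_derive (fun u => k * f u) z (k * a).
Proof.
intros H. replace (k * a) with (0 * f z + k * a) by ring.
exact (is_derive_Cmult (fun _ => k) f z 0 a (is_derive_Cconst k z) H).
Qed.

Lemma is_derive_Cminus (f g : C -> C) (z a b : C) :
  is_derive f z a -> is_derive g z b -> is_derive (fun u => f u - g u) z (a - b).
Proof.
intros Hf Hg. exact (is_derive_minus f g z a b Hf Hg).
Qed.

Lemma is_derive_C_unique (f : C -> C) (z a b : C) :
  is_derive f z a -> is_derive f z b -> a = b.
Proof.
intros Ha Hb.
apply Ceq_minus, Cmod_eq_0.
destruct (Rle_lt_or_eq_dec 0 (Cmod (a - b)) (Cmod_ge_0 _)) as [H|H]; [|easy].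
exfalso.
apply is_derive_C_iff with (eps := (Cmod (a-b) / 4)%R) in Ha; [|lra].
apply is_derive_C_iff with (eps := (Cmod (a-b) / 4)%R) in Hb; [|lra].
destruct Ha as [d1 [Hd1 H1]]. destruct Hb as [d2 [Hd2 H2]].
set (d := (Rmin d1 d2 / 2)%R).
assert (Hd : (0 < d)%R) by (unfold d; apply Rdiv_lt_0_compat; [apply Rmin_pos|]; lra).
assert (Hm : Cmod ((z + d) - z) = d).
{ replace (z + d - z) with (RtoC d) by ring. rewrite Cmod_R. apply Rabs_pos_eq. lra. }
specialize (H1 (z + d)). specialize (H2 (z + d)). rewrite Hm in H1, H2.
assert (d < d1)%R by (unfold d in *; pose proof (Rmin_l d1 d2); lra).
assert (d < d2)%R by (unfold d in *; pose proof (Rmin_r d1 d2); lra).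
specialize (H1 H0). specialize (H2 H3).
assert (Cmod ((a - b) * d) <= (Cmod (a-b) / 4) * d + (Cmod (a-b) / 4) * d)%R.
{ replace ((a - b) * d) with ((f (z + d) - f z - b * (z + d - z)) + - (f (z + d) - f z - a * (z + d - z))) by ring.
  eapply Rle_trans. apply Cmod_triangle. rewrite Cmod_opp. lra. }
rewrite Cmod_mult, Cmod_R, (Rabs_pos_eq d) in H4 by lra.
nra.
Qed.

Lemma is_derive_C_ext_near (f g : C -> C) (z l : C) (d : R) :
  (0 < d)%R -> (forall u, (Cmod (u - z) < d)%R -> f u = g u) ->
  is_derive f z l -> is_derive g z l.
Proof.
intros Hd H Hf. apply (is_derive_ext_loc f g z l); [|exact Hf].
exists (mkposreal d Hd). intros u Hu. apply H, Hu.
Qed.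

Lemma Cmod_sym (a b : C) : Cmod (a - b) = Cmod (b - a).
Proof. rewrite <- Cmod_opp. f_equal. ring. Qed.

Lemma Cmod_self (a : C) : Cmod (a - a) = 0%R.
Proof. replace (a - a) with (RtoC 0) by ring. apply Cmod_0. Qed.

Lemma Cmod_tri3 (a b c : C) : (Cmod (a - c) <= Cmod (a - b) + Cmod (b - c))%R.
Proof. replace (a - c) with ((a - b) + (b - c)) by ring. apply Cmod_triangle. Qed.

Lemma Cmod_tri_inv (a b : C) : (Cmod a - Cmod b <= Cmod (a - b))%R.
Proof.
pose proof (Cmod_triangle (a - b) b). replace (a - b + b) with a in H by ring. lra.
Qed.

Lemma is_derive_C_continuous (f : C -> C) (z l : C) :
  is_derive f z l -> continuous f z.
Proof.
intros H. apply continuous_C_iff. intros eps He.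
apply is_derive_C_iff with (eps := 1%R) in H; [|lra].
destruct H as [d [Hd H]].
assert (Hl : (0 < Cmod l + 1)%R) by (pose proof (Cmod_ge_0 l); lra).
exists (Rmin d (eps / (Cmod l + 1))%R). split.
{ apply Rmin_pos; [lra|]. apply Rdiv_lt_0_compat; lra. }
intros u Hu.
assert (Hu1 : (Cmod (u - z) < d)%R) by (eapply Rlt_le_trans; [exact Hu|apply Rmin_l]).
assert (Hu2 : (Cmod (u - z) < eps / (Cmod l + 1))%R) by (eapply Rlt_le_trans; [exact Hu|apply Rmin_r]).
specialize (H u Hu1).
replace (f u - f z) with ((f u - f z - l * (u - z)) + l * (u - z)) by ring.
eapply Rle_lt_trans. apply Cmod_triangle. rewrite Cmod_mult.
apply Rlt_div_r in Hu2; [|lra]. lra.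
Qed.

Lemma ex_derive_C_continuous (f : C -> C) (z : C) : ex_derive f z -> continuous f z.
Proof. intros [l H]. exact (is_derive_C_continuous f z l H). Qed.

Lemma is_derive_Cinv (z : C) : z <> 0 -> is_derive Cinv z (- / (z * z)).
Proof.
intros Hz. apply is_derive_C_iff. intros eps He.
assert (Hp : (0 < Cmod z)%R) by (apply Cmod_gt_0; exact Hz).
set (m := Cmod z) in *.
assert (Hq : (0 < eps * (m * m * m) / 2)%R).
{ apply Rdiv_lt_0_compat; [|lra]. repeat apply Rmult_lt_0_compat; lra. }
exists (Rmin (m / 2) (eps * (m * m * m) / 2)). split.
{ apply Rmin_pos; lra. }
intros u Hu.
assert (Hu1 : (Cmod (u - z) < m / 2)%R) by (eapply Rlt_le_trans; [exact Hu|apply Rmin_l]).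
assert (Hu2 : (Cmod (u - z) < eps * (m * m * m) / 2)%R) by (eapply Rlt_le_trans; [exact Hu|apply Rmin_r]).
assert (Hum : (m / 2 < Cmod u)%R).
{ pose proof (Cmod_tri_inv z u). rewrite Cmod_sym in H. fold m in H. lra. }
assert (Hu0 : u <> 0) by (apply Cmod_gt_0; lra).
replace (/ u - / z - - / (z * z) * (u - z)) with ((u - z) * ((u - z) * / (z * z * u))).
2:{ field. split; assumption. }
rewrite Cmod_mult, Cmod_mult, Cmod_inv by (repeat apply Cmult_neq_0; assumption).
rewrite !Cmod_mult. fold m.
rewrite Rmult_comm. apply Rmult_le_compat_r. apply Cmod_ge_0.
apply Rle_div_l. repeat apply Rmult_lt_0_compat; lra.
assert (m * m * m / 2 <= m * m * Cmod u)%R by nra. nra.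
Qed.

Lemma RtoC_neq_0 (x : R) : x <> 0%R -> RtoC x <> 0.
Proof. intros H K. apply H. exact (RtoC_inj _ _ K). Qed.

(** * Integrals of complex-valued functions of a real variable *)

Definition CInt (phi : R -> C) (a b : R) : C :=
  RInt (V := C_R_CompleteNormedModule) phi a b.

Definition is_CInt (phi : R -> C) (a b : R) (l : C) : Prop :=
  is_RInt (V := C_R_NormedModule) phi a b l.

Lemma norm_C_R (z : C) : norm (V := C_R_NormedModule) z = Cmod z.
Proof.
unfold Cmod, norm; simpl. unfold prod_norm. f_equal.
unfold norm; simpl. unfold abs; simpl. rewrite !Rmult_1_r, <- !Rabs_mult.
rewrite !Rabs_pos_eq; try reflexivity; nra.
Qed.

Lemma is_CInt_unique (phi : R -> C) (a b : R) (l : C) :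
  is_CInt phi a b l -> CInt phi a b = l.
Proof. intros H. exact (is_RInt_unique (V := C_R_CompleteNormedModule) phi a b l H). Qed.

Lemma CInt_correct (phi : R -> C) (a b : R) : (a <= b)%R ->
  (forall t, (a <= t <= b)%R -> continuous phi t) -> is_CInt phi a b (CInt phi a b).
Proof.
intros Hab H. apply (RInt_correct (V := C_R_CompleteNormedModule)).
apply (ex_RInt_continuous (V := C_R_CompleteNormedModule)).
intros t Ht. rewrite Rmin_left, Rmax_right in Ht by lra. apply H, Ht.
Qed.

Lemma is_CInt_Cmult (phi : R -> C) (a b : R) (k l : C) :
  is_CInt phi a b l -> is_CInt (fun t => k * phi t) a b (k * l).
Proof.
intros H.
pose proof (is_RInt_fct_extend_fst (U := R_NormedModule) (V := R_NormedModule) phi a b l H) as H1.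
pose proof (is_RInt_fct_extend_snd (U := R_NormedModule) (V := R_NormedModule) phi a b l H) as H2.
unfold is_CInt.
apply (is_RInt_fct_extend_pair (U := R_NormedModule) (V := R_NormedModule)); simpl.
- apply (is_RInt_minus (V := R_NormedModule)).
  + apply (is_RInt_scal (V := R_NormedModule)), H1.
  + apply (is_RInt_scal (V := R_NormedModule)), H2.
- apply (is_RInt_plus (V := R_NormedModule)).
  + apply (is_RInt_scal (V := R_NormedModule)), H2.
  + apply (is_RInt_scal (V := R_NormedModule)), H1.
Qed.

Lemma is_CInt_minus (phi psi : R -> C) (a b : R) (k l : C) :
  is_CInt phi a b k -> is_CInt psi a b l ->
  is_CInt (fun t => phi t - psi t) a b (k - l).
Proof. intros H1 H2. exact (is_RInt_minus (V := C_R_NormedModule) phi psi a b k l H1 H2). Qed.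

Lemma is_CInt_ext (phi psi : R -> C) (a b : R) (l : C) : (a <= b)%R ->
  (forall t, (a <= t <= b)%R -> phi t = psi t) ->
  is_CInt phi a b l -> is_CInt psi a b l.
Proof.
intros Hab H. apply (is_RInt_ext (V := C_R_NormedModule)).
intros t. rewrite Rmin_left, Rmax_right by lra. intros Ht. apply H. lra.
Qed.

Lemma CInt_ext (phi psi : R -> C) (a b : R) : (a <= b)%R ->
  (forall t, (a <= t <= b)%R -> phi t = psi t) -> CInt phi a b = CInt psi a b.
Proof.
intros Hab H. apply (RInt_ext (V := C_R_CompleteNormedModule)).
intros t. rewrite Rmin_left, Rmax_right by lra. intros Ht. apply H. lra.
Qed.

Lemma is_CInt_bound (phi : R -> C) (a b M : R) (l : C) : (a <= b)%R ->
  (forall t, (a <= t <= b)%R -> (Cmod (phi t) <= M)%R) ->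
  is_CInt phi a b l -> (Cmod l <= M * (b - a))%R.
Proof.
intros Hab H Hl. rewrite <- norm_C_R.
eapply (norm_RInt_le (V := C_R_NormedModule) phi (fun _ => M) a b); try eassumption.
- intros t Ht. rewrite norm_C_R. apply H, Ht.
- rewrite Rmult_comm. apply (is_RInt_const (V := R_NormedModule)).
Qed.

Lemma is_derive_RC_iff (g : R -> C) (t : R) (d : C) :
  is_derive (V := C_R_NormedModule) g t d <->
  forall eps : R, (0 < eps)%R -> exists del : R, (0 < del)%R /\
    forall s : R, (Rabs (s - t) < del)%R ->
      (Cmod (g s - g t - (s - t)%R * d) <= eps * Rabs (s - t))%R.
Proof.
assert (E : forall (s : R), norm (V := C_R_NormedModule) (minus (minus (g s) (g t)) (scal (minus s t) d))
  = Cmod (g s - g t - (s - t)%R * d)).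
{ intros s. rewrite norm_C_R. f_equal. apply injective_projections; simpl;
  unfold minus, plus, opp, scal; simpl; unfold mult; simpl; ring. }
split.
- intros [_ H] eps He.
  destruct (H t (fun P HP => HP) (mkposreal eps He)) as [d' Hd].
  exists d'. split. apply cond_pos.
  intros s Hs. specialize (Hd s Hs).
  eapply Rle_trans; [right; symmetry; exact (E s)|exact Hd].
- intros H. split. apply is_linear_scal_l.
  intros x Hx.
  rewrite <- (is_filter_lim_locally_unique (V := R_NormedModule) t x Hx).
  intros eps. destruct (H eps (cond_pos eps)) as [d' [Hd Hd']].
  exists (mkposreal d' Hd). intros u Hu. specialize (Hd' u Hu).
  eapply Rle_trans; [right; exact (E u)|exact Hd'].
Qed.

Lemma is_derive_RC_continuous (g : R -> C) (t : R) (d : C) :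
  is_derive (V := C_R_NormedModule) g t d -> continuous g t.
Proof.
intros H. apply (ex_derive_continuous (V := C_R_NormedModule)). exists d. exact H.
Qed.

Lemma is_derive_path (F : C -> C) (g : R -> C) (t : R) (l d : C) :
  is_derive F (g t) l -> is_derive (V := C_R_NormedModule) g t d ->
  is_derive (V := C_R_NormedModule) (fun s => F (g s)) t (l * d).
Proof.
intros HF Hg. apply is_derive_RC_iff. intros eps He.
pose proof (Cmod_ge_0 l) as Hl. pose proof (Cmod_ge_0 d) as Hd0.
set (e1 := (eps / (2 * (Cmod d + 1)))%R).
set (e2 := Rmin 1 (eps / (2 * (Cmod l + 1)))).
assert (He1 : (0 < e1)%R) by (apply Rdiv_lt_0_compat; lra).
assert (He2 : (0 < e2)%R) by (apply Rmin_pos; [lra|apply Rdiv_lt_0_compat; lra]).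
destruct (proj1 (is_derive_C_iff _ _ _) HF e1 He1) as [d1 [Hd1 H1]].
destruct (proj1 (is_derive_RC_iff _ _ _) Hg e2 He2) as [d2 [Hd2 H2]].
assert (Hq : (0 < d1 / (Cmod d + 1))%R) by (apply Rdiv_lt_0_compat; lra).
exists (Rmin d2 (d1 / (Cmod d + 1))). split. { apply Rmin_pos; lra. }
intros s Hs.
assert (Hs1 : (Rabs (s - t) < d2)%R) by (eapply Rlt_le_trans; [exact Hs|apply Rmin_l]).
assert (Hs2 : (Rabs (s - t) < d1 / (Cmod d + 1))%R) by (eapply Rlt_le_trans; [exact Hs|apply Rmin_r]).
specialize (H2 s Hs1). pose proof (Rabs_pos (s - t)) as Hst.
assert (E2 : (e2 <= 1)%R) by apply Rmin_l.
assert (E3 : (e2 <= eps / (2 * (Cmod l + 1)))%R) by apply Rmin_r.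
assert (Hgs : (Cmod (g s - g t) <= (Cmod d + 1) * Rabs (s - t))%R).
{ replace (g s - g t) with ((g s - g t - (s - t)%R * d) + (s - t)%R * d) by ring.
  eapply Rle_trans. apply Cmod_triangle. rewrite Cmod_mult, Cmod_R. nra. }
apply Rlt_div_r in Hs2; [|lra].
assert (Hlt : (Cmod (g s - g t) < d1)%R) by lra.
specialize (H1 (g s) Hlt).
replace (F (g s) - F (g t) - (s - t)%R * (l * d)) with
  ((F (g s) - F (g t) - l * (g s - g t)) + l * (g s - g t - (s - t)%R * d)) by ring.
eapply Rle_trans. apply Cmod_triangle. rewrite Cmod_mult.
assert (A1 : (e1 * Cmod (g s - g t) <= eps / 2 * Rabs (s - t))%R).
{ replace (eps / 2 * Rabs (s - t))%R with (e1 * ((Cmod d + 1) * Rabs (s - t)))%R.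
  apply Rmult_le_compat_l; lra. unfold e1; field; lra. }
assert (A2 : (Cmod l * e2 <= eps / 2)%R).
{ apply Rle_trans with ((Cmod l + 1) * (eps / (2 * (Cmod l + 1))))%R.
  apply Rmult_le_compat; lra. right; field; lra. }
assert (A3 : (Cmod l * Cmod (g s - g t - (s - t)%R * d) <= eps / 2 * Rabs (s - t))%R).
{ apply Rle_trans with (Cmod l * (e2 * Rabs (s - t)))%R.
  apply Rmult_le_compat_l; lra. rewrite <- Rmult_assoc. apply Rmult_le_compat_r; lra. }
lra.
Qed.

Lemma continuous_Cmult {T : UniformSpace} (f g : T -> C) (x : T) :
  continuous f x -> continuous g x -> continuous (fun u => f u * g u) x.
Proof.
assert (E : forall h : T -> C,
  continuous (U := C_UniformSpace) h x <->
  continuous (U := AbsRing_UniformSpace C_AbsRing) h x).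
{ intros h. split; intros H P HP; apply H, locally_C, HP. }
intros Hf Hg. apply E.
exact (continuous_mult (K := C_AbsRing) f g x (proj1 (E f) Hf) (proj1 (E g) Hg)).
Qed.

Lemma is_CInt_derive_path (F f : C -> C) (g g' : R -> C) (a b : R) : (a <= b)%R ->
  (forall t, (a <= t <= b)%R -> is_derive F (g t) (f (g t))) ->
  (forall t, (a <= t <= b)%R -> continuous f (g t)) ->
  (forall t, is_derive (V := C_R_NormedModule) g t (g' t)) ->
  (forall t, continuous g' t) ->
  is_CInt (fun t => f (g t) * g' t) a b (F (g b) - F (g a)).
Proof.
intros Hab HF Hf Hg Hg'.
apply (is_RInt_derive (V := C_R_CompleteNormedModule) (fun t => F (g t))).
- intros t Ht. rewrite Rmin_left, Rmax_right in Ht by lra.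
  apply is_derive_path; auto.
- intros t Ht. rewrite Rmin_left, Rmax_right in Ht by lra.
  apply continuous_Cmult.
  + apply (continuous_comp g f). eapply is_derive_RC_continuous, Hg. apply Hf, Ht.
  + apply Hg'.
Qed.

(** * Integrals along segments *)

Definition SInt (f : C -> C) (a b : C) : C :=
  CInt (fun t => f (a + t * (b - a)) * (b - a)) 0 1.

Definition in_ball (c : C) (r : R) (z : C) : Prop := (Cmod (z - c) < r)%R.

Definition holo (f : C -> C) (c : C) (r : R) : Prop :=
  forall z, in_ball c r z -> ex_derive f z.

Definition cont_on (f : C -> C) (c : C) (r : R) : Prop :=
  forall z, in_ball c r z -> continuous f z.

Lemma holo_cont_on f c r : holo f c r -> cont_on f c r.
Proof. intros H z Hz. apply ex_derive_C_continuous, H, Hz. Qed.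

Lemma segment_dist (a b c : C) (rho t : R) : (0 <= t <= 1)%R ->
  (Cmod (a - c) <= rho)%R -> (Cmod (b - c) <= rho)%R ->
  (Cmod (a + t * (b - a) - c) <= rho)%R.
Proof.
intros Ht Ha Hb.
replace (a + t * (b - a) - c) with ((1 - t)%R * (a - c) + t * (b - c)).
2:{ rewrite RtoC_minus. ring. }
eapply Rle_trans. apply Cmod_triangle.
rewrite !Cmod_mult, !Cmod_R, !Rabs_pos_eq by lra. nra.
Qed.

Lemma segment_in_ball (a b c : C) (r t : R) : (0 <= t <= 1)%R ->
  in_ball c r a -> in_ball c r b -> in_ball c r (a + t * (b - a)).
Proof.
unfold in_ball. intros Ht Ha Hb.
apply Rle_lt_trans with (Rmax (Cmod (a - c)) (Cmod (b - c))).
apply segment_dist; [exact Ht|apply Rmax_l|apply Rmax_r].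
apply Rmax_lub_lt; assumption.
Qed.

Lemma is_derive_segment (a b : C) (t : R) :
  is_derive (V := C_R_NormedModule) (fun s : R => a + s * (b - a)) t (b - a).
Proof.
apply is_derive_RC_iff. intros eps He. exists 1%R. split. lra.
intros s _.
replace (a + s * (b - a) - (a + t * (b - a)) - (s - t)%R * (b - a)) with (RtoC 0).
2:{ rewrite RtoC_minus. ring. }
rewrite Cmod_0. apply Rmult_le_pos. lra. apply Rabs_pos.
Qed.

Lemma continuous_RC_const (k : C) (t : R) : continuous (fun _ : R => k) t.
Proof. apply continuous_const. Qed.

Lemma segment_continuous (f : C -> C) (c : C) (r : R) (a b : C) (t : R) :
  cont_on f c r -> in_ball c r a -> in_ball c r b -> (0 <= t <= 1)%R ->
  continuous (fun s : R => f (a + s * (b - a)) * (b - a)) t.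
Proof.
intros Hf Ha Hb Ht. apply continuous_Cmult; [|apply continuous_RC_const].
apply (continuous_comp (fun s : R => a + s * (b - a)) f).
eapply is_derive_RC_continuous, is_derive_segment.
apply Hf, segment_in_ball; assumption.
Qed.

Lemma SInt_correct (f : C -> C) (c : C) (r : R) (a b : C) :
  cont_on f c r -> in_ball c r a -> in_ball c r b ->
  is_CInt (fun t => f (a + t * (b - a)) * (b - a)) 0 1 (SInt f a b).
Proof.
intros Hf Ha Hb. apply CInt_correct. lra. intros t Ht.
eapply segment_continuous; eassumption.
Qed.

Lemma SInt_derive (F f : C -> C) (c : C) (r : R) (a b : C) :
  (forall z, in_ball c r z -> is_derive F z (f z)) -> cont_on f c r ->
  in_ball c r a -> in_ball c r b -> SInt f a b = F b - F a.
Proof.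
intros HF Hf Ha Hb. apply is_CInt_unique.
assert (H := is_CInt_derive_path F f (fun t : R => a + t * (b - a)) (fun _ => b - a) 0 1).
cbv beta in H. replace (a + 0%R * (b - a)) with a in H by ring.
replace (a + 1%R * (b - a)) with b in H by ring.
apply H.
- lra.
- intros t Ht. apply HF, segment_in_ball; assumption.
- intros t Ht. apply Hf, segment_in_ball; assumption.
- intros t. apply is_derive_segment.
- intros t. apply continuous_RC_const.
Qed.

Lemma SInt_approx (f : C -> C) (c : C) (r : R) (a b k : C) (e : R) :
  cont_on f c r -> in_ball c r a -> in_ball c r b ->
  (forall t : R, (0 <= t <= 1)%R -> (Cmod (f (a + t * (b - a))%C - k) <= e)%R) ->
  (Cmod (SInt f a b - k * (b - a)) <= e * Cmod (b - a))%R.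
Proof.
intros Hf Ha Hb H.
assert (H1 := SInt_correct f c r a b Hf Ha Hb).
assert (Hk : is_CInt (fun _ => k * (b - a)) 0 1 (k * (b - a))).
{ unfold is_CInt.
  assert (K := is_RInt_const (V := C_R_NormedModule) 0 1 (k * (b - a))).
  rewrite scal_R_Cmult, Rminus_0_r, Cmult_1_l in K. exact K. }
pose proof (is_CInt_minus _ _ _ _ _ _ H1 Hk) as H2.
replace (e * Cmod (b - a))%R with ((e * Cmod (b - a)) * (1 - 0))%R by ring.
eapply is_CInt_bound; [lra| |exact H2].
intros t Ht. cbv beta.
replace (f (a + t * (b - a)) * (b - a) - k * (b - a)) with ((f (a + t * (b - a)) - k) * (b - a)) by ring.
rewrite Cmod_mult. apply Rmult_le_compat_r. apply Cmod_ge_0. apply H, Ht.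
Qed.

Lemma SInt_comp_lin (f : C -> C) (a b a' b' : C) (c : C) (r u v : R) :
  cont_on f c r -> in_ball c r a -> in_ball c r b ->
  (0 <= v <= 1)%R -> (0 <= u + v <= 1)%R ->
  a' = a + v * (b - a) -> b' = a + (u + v)%R * (b - a) ->
  is_RInt (V := C_R_NormedModule)
    (fun t => f (a + t * (b - a)) * (b - a)) v (u + v)%R (SInt f a' b').
Proof.
intros Hf Ha Hb Hv Huv Ea Eb.
set (phi := fun t : R => f (a + t * (b - a)) * (b - a)).
assert (Hex : ex_RInt (V := C_R_CompleteNormedModule) phi (u * 0 + v) (u * 1 + v)).
{ apply (ex_RInt_continuous (V := C_R_CompleteNormedModule)). intros t Ht.
  eapply segment_continuous; try eassumption.
  revert Ht. unfold Rmin, Rmax. destruct Rle_dec; lra. }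
pose proof (RInt_comp_lin (V := C_R_CompleteNormedModule) phi u v 0 1 Hex) as H.
pose proof (RInt_correct (V := C_R_CompleteNormedModule) _ _ _ Hex) as H1.
replace (SInt f a' b') with (RInt (V := C_R_CompleteNormedModule) phi (u * 0 + v) (u * 1 + v)).
- replace v with (u * 0 + v)%R at 1 by ring.
  replace (u + v)%R with (u * 1 + v)%R by ring. exact H1.
- rewrite <- H. symmetry. apply CInt_ext. lra. intros t Ht. unfold phi.
  assert (E : b' - a' = u * (b - a)). { rewrite Ea, Eb, RtoC_plus. ring. }
  rewrite E.
  replace (a' + t * (u * (b - a))) with (a + (u * t + v)%R * (b - a)).
  2:{ rewrite Ea, RtoC_plus, RtoC_mult. ring. }
  rewrite scal_R_Cmult. ring.
Qed.

(** * Goursat's theorem on triangles *)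

Lemma two_nz : RtoC 2 <> 0.
Proof. apply RtoC_neq_0. lra. Qed.

Lemma RtoC_half : RtoC (/ 2) = / 2.
Proof. apply RtoC_inv. lra. Qed.

Lemma mid_in_ball c r a b : in_ball c r a -> in_ball c r b -> in_ball c r ((a + b) / 2).
Proof.
intros Ha Hb. replace ((a + b) / 2) with (a + (/ 2)%R * (b - a)).
apply segment_in_ball; auto; lra.
rewrite RtoC_half. field.
Qed.

Lemma mid_dist c rho a b : (Cmod (a - c) <= rho)%R -> (Cmod (b - c) <= rho)%R ->
  (Cmod ((a + b) / 2 - c) <= rho)%R.
Proof.
intros Ha Hb. replace ((a + b) / 2) with (a + (/ 2)%R * (b - a)).
apply segment_dist; auto; lra.
rewrite RtoC_half. field.
Qed.

Lemma SInt_midpoint f c r a b : cont_on f c r -> in_ball c r a -> in_ball c r b ->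
  SInt f a b = SInt f a ((a + b) / 2) + SInt f ((a + b) / 2) b.
Proof.
intros Hf Ha Hb.
assert (Em : (a + b) / 2 = a + (/ 2)%R * (b - a)).
{ rewrite RtoC_half. field. }
assert (H1 : is_RInt (V := C_R_NormedModule) (fun t : R => f (a + t * (b - a)) * (b - a))
   0 (/ 2)%R (SInt f a ((a + b) / 2))).
{ replace (/ 2)%R with (/ 2 + 0)%R by ring. eapply SInt_comp_lin; try eassumption; try lra.
  ring. rewrite Rplus_0_r. exact Em. }
assert (H2 : is_RInt (V := C_R_NormedModule) (fun t : R => f (a + t * (b - a)) * (b - a))
   (/ 2)%R 1 (SInt f ((a + b) / 2) b)).
{ replace 1%R with (/ 2 + / 2)%R by field. eapply SInt_comp_lin; try eassumption; try lra.
  replace (/ 2 + / 2)%R with 1%R by field. ring. }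
apply is_CInt_unique.
exact (is_RInt_Chasles (V := C_R_NormedModule) _ _ _ _ _ _ H1 H2).
Qed.

Lemma SInt_swap f c r a b : cont_on f c r -> in_ball c r a -> in_ball c r b ->
  SInt f b a = - SInt f a b.
Proof.
intros Hf Ha Hb.
assert (H1 : is_RInt (V := C_R_NormedModule) (fun t : R => f (a + t * (b - a)) * (b - a))
   1 0 (SInt f b a)).
{ replace 0%R with (-1 + 1)%R by ring. eapply SInt_comp_lin; try eassumption; try lra.
  ring. replace (-1 + 1)%R with 0%R by ring. ring. }
apply (is_RInt_swap (V := C_R_NormedModule)) in H1.
apply is_CInt_unique in H1. unfold SInt at 2. rewrite H1.
symmetry. exact (opp_opp (G := C_AbelianGroup) _).
Qed.

Definition triangle := (C * C * C)%type.

Definition TInt (f : C -> C) (T : triangle) : C :=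
  let '(a, b, d) := T in SInt f a b + SInt f b d + SInt f d a.

Definition perimeter (T : triangle) : R :=
  let '(a, b, d) := T in (Cmod (b - a) + Cmod (d - b) + Cmod (a - d))%R.

Definition apex (T : triangle) : C := fst (fst T).

Definition within (c : C) (rho : R) (T : triangle) : Prop :=
  let '(a, b, d) := T in
  (Cmod (a - c) <= rho /\ Cmod (b - c) <= rho /\ Cmod (d - c) <= rho)%R.

(** The boundary integral over a triangle is the sum of those over its four
    midpoint triangles; some quarter carries at least a quarter of it. *)
Definition quarter (f : C -> C) (T : triangle) : triangle :=
  let '(a, b, d) := T in
  let ab := (a + b) / 2 in let bd := (b + d) / 2 in let da := (d + a) / 2 in
  let big T' := Rle_dec (Cmod (TInt f T)) (4 * Cmod (TInt f T')) in
  if big (a, ab, da) then (a, ab, da)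
  else if big (ab, b, bd) then (ab, b, bd)
  else if big (da, bd, d) then (da, bd, d)
  else (bd, da, ab).

Lemma within_in_ball c r rho a b d : (rho < r)%R -> within c rho (a, b, d) ->
  in_ball c r a /\ in_ball c r b /\ in_ball c r d.
Proof. unfold within, in_ball. intros Hr H. repeat split; lra. Qed.

Lemma Cmod_half_eq (x y : C) : x = y / 2 -> Cmod x = (Cmod y / 2)%R.
Proof.
intros ->. unfold Cdiv. rewrite Cmod_mult, Cmod_inv by apply two_nz.
rewrite Cmod_R, Rabs_pos_eq by lra. reflexivity.
Qed.

Lemma quarter_spec f c r rho T : cont_on f c r -> (rho < r)%R -> within c rho T ->
  within c rho (quarter f T) /\
  perimeter (quarter f T) = (perimeter T / 2)%R /\
  (Cmod (apex (quarter f T) - apex T) <= perimeter T)%R /\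
  (Cmod (TInt f T) <= 4 * Cmod (TInt f (quarter f T)))%R.
Proof.
destruct T as [[a b] d]. intros Hf Hr HT.
destruct (within_in_ball c r rho a b d Hr HT) as (Ha & Hb & Hd).
destruct HT as (Wa & Wb & Wd).
set (ab := (a + b) / 2). set (bd := (b + d) / 2). set (da := (d + a) / 2).
assert (Hab : in_ball c r ab) by (apply mid_in_ball; assumption).
assert (Hbd : in_ball c r bd) by (apply mid_in_ball; assumption).
assert (Hda : in_ball c r da) by (apply mid_in_ball; assumption).
assert (Wab : (Cmod (ab - c) <= rho)%R) by (apply mid_dist; assumption).
assert (Wbd : (Cmod (bd - c) <= rho)%R) by (apply mid_dist; assumption).
assert (Wda : (Cmod (da - c) <= rho)%R) by (apply mid_dist; assumption).
assert (Hsum : TInt f (a, b, d) = TInt f (a, ab, da) + TInt f (ab, b, bd)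
  + TInt f (da, bd, d) + TInt f (bd, da, ab)).
{ unfold TInt.
  rewrite (SInt_midpoint f c r a b), (SInt_midpoint f c r b d), (SInt_midpoint f c r d a) by assumption.
  fold ab bd da.
  rewrite (SInt_swap f c r da bd), (SInt_swap f c r ab da), (SInt_swap f c r bd ab) by assumption.
  ring. }
pose proof (Cmod_ge_0 (b - a)). pose proof (Cmod_ge_0 (d - b)). pose proof (Cmod_ge_0 (a - d)).
pose proof two_nz as N2.
assert (P1 : Cmod (ab - a) = (Cmod (b - a) / 2)%R) by (apply Cmod_half_eq; unfold ab; field).
assert (P2 : Cmod (b - ab) = (Cmod (b - a) / 2)%R) by (apply Cmod_half_eq; unfold ab; field).
assert (P3 : Cmod (bd - b) = (Cmod (d - b) / 2)%R) by (apply Cmod_half_eq; unfold bd; field).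
assert (P4 : Cmod (d - bd) = (Cmod (d - b) / 2)%R) by (apply Cmod_half_eq; unfold bd; field).
assert (P5 : Cmod (da - d) = (Cmod (a - d) / 2)%R) by (apply Cmod_half_eq; unfold da; field).
assert (P6 : Cmod (a - da) = (Cmod (a - d) / 2)%R) by (apply Cmod_half_eq; unfold da; field).
assert (Q1 : Cmod (ab - bd) = (Cmod (a - d) / 2)%R) by (apply Cmod_half_eq; unfold ab, bd; field).
assert (Q2 : Cmod (bd - da) = (Cmod (b - a) / 2)%R) by (apply Cmod_half_eq; unfold da, bd; field).
assert (Q3 : Cmod (da - ab) = (Cmod (d - b) / 2)%R) by (apply Cmod_half_eq; unfold da, ab; field).
assert (Q1' := Q1). assert (Q2' := Q2). assert (Q3' := Q3).
rewrite Cmod_sym in Q1', Q2', Q3'.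
assert (P6' := P6). rewrite Cmod_sym in P6'.
pose proof (Cmod_tri3 bd b a) as Q4. rewrite P3 in Q4.
assert (Hq : quarter f (a, b, d) =
  if Rle_dec (Cmod (TInt f (a, b, d))) (4 * Cmod (TInt f (a, ab, da))) then (a, ab, da)
  else if Rle_dec (Cmod (TInt f (a, b, d))) (4 * Cmod (TInt f (ab, b, bd))) then (ab, b, bd)
  else if Rle_dec (Cmod (TInt f (a, b, d))) (4 * Cmod (TInt f (da, bd, d))) then (da, bd, d)
  else (bd, da, ab)) by reflexivity.
rewrite Hq. clear Hq.
destruct (Rle_dec (Cmod (TInt f (a, b, d))) (4 * Cmod (TInt f (a, ab, da)))) as [L1|L1];
[|destruct (Rle_dec (Cmod (TInt f (a, b, d))) (4 * Cmod (TInt f (ab, b, bd)))) as [L2|L2];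
[|destruct (Rle_dec (Cmod (TInt f (a, b, d))) (4 * Cmod (TInt f (da, bd, d)))) as [L3|L3]]].
- unfold within, perimeter, apex; simpl. rewrite P1, Q3, P6, Cmod_self. repeat split; try assumption; lra.
- unfold within, perimeter, apex; simpl. rewrite P1, P2, P3, Q1. repeat split; try assumption; lra.
- unfold within, perimeter, apex; simpl. rewrite P4, P5, P6', Q2. repeat split; try assumption; lra.
- unfold within, perimeter, apex; simpl. rewrite Q1', Q2', Q3'. repeat split; try assumption; try lra.
  fold (TInt f (a, b, d)). fold (TInt f (bd, da, ab)).
  pose proof (Cmod_triangle (TInt f (a, ab, da) + TInt f (ab, b, bd) + TInt f (da, bd, d)) (TInt f (bd, da, ab))).
  pose proof (Cmod_triangle (TInt f (a, ab, da) + TInt f (ab, b, bd)) (TInt f (da, bd, d))).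
  pose proof (Cmod_triangle (TInt f (a, ab, da)) (TInt f (ab, b, bd))).
  rewrite <- Hsum in H2.
  change (Cmod (TInt f (a,b,d)) <= 4 * Cmod (TInt f (bd, da, ab)))%R. lra.
Qed.

Lemma geometric_limit (u : nat -> C) (K : R) :
  (forall n, (Cmod (u (S n) - u n) <= K / 2 ^ n)%R) ->
  exists p : C, forall n, (Cmod (u n - p) <= 4 * K / 2 ^ n)%R.
Proof.
intros H.
assert (HK : (0 <= K)%R).
{ specialize (H 0%nat). simpl in H. pose proof (Cmod_ge_0 (u 1%nat - u 0%nat)). lra. }
assert (H2 : forall n k, (Cmod (u (n + k)%nat - u n) <= 2 * K / 2 ^ n * (1 - / 2 ^ k))%R).
{ intros n k. induction k.
  - rewrite Nat.add_0_r, Cmod_self. simpl. lra.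
  - eapply Rle_trans. apply (Cmod_tri3 _ (u (n + k)%nat)).
    rewrite Nat.add_succ_r. specialize (H (n + k)%nat).
    assert (E : (K / 2 ^ (n + k) = K / 2 ^ n * / 2 ^ k)%R).
    { rewrite pow_add. field. split; apply pow_nonzero; lra. }
    rewrite E in H. simpl. rewrite Rinv_mult.
    assert (0 < / 2 ^ k)%R by (apply Rinv_0_lt_compat, pow_lt; lra).
    assert (0 <= K / 2 ^ n)%R by (apply Rdiv_le_0_compat; [lra|apply pow_lt; lra]). nra. }
assert (H3 : forall n m, (n <= m)%nat -> (Cmod (u m - u n) <= 2 * K / 2 ^ n)%R).
{ intros n m Hm. replace m with (n + (m - n))%nat by lia. eapply Rle_trans. apply H2.
  assert (0 <= 2 * K / 2 ^ n)%R by (apply Rdiv_le_0_compat; [lra|apply pow_lt; lra]).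
  assert (0 < / 2 ^ (m - n))%R by (apply Rinv_0_lt_compat, pow_lt; lra). nra. }
assert (HL : forall g : C -> R, (forall a b, (Rabs (g a - g b) <= Cmod (a - b))%R) ->
  exists l, forall n, (Rabs (g (u n) - l) <= 2 * K / 2 ^ n)%R).
{ intros g Hg.
  assert (Hex : ex_finite_lim_seq (fun n => g (u n))).
  { apply ex_lim_seq_cauchy_corr. intros eps.
    assert (Hlim : is_lim_seq (fun n => 4 * K * (/ 2) ^ n)%R 0%R).
    { replace (Finite 0) with (Rbar_mult (4 * K)%R 0%R).
      apply is_lim_seq_scal_l. apply is_lim_seq_geom. rewrite Rabs_pos_eq; lra.
      simpl. f_equal. ring. }
    apply is_lim_seq_spec in Hlim. destruct (Hlim eps) as [N HN].
    exists N. intros n m Hn Hm.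
    assert (A : forall k, (N <= k)%nat -> (Rabs (g (u k) - g (u N)) <= 2 * K / 2 ^ N)%R).
    { intros k Hk. eapply Rle_trans. apply Hg. apply H3, Hk. }
    pose proof (A n Hn) as A1. pose proof (A m Hm) as A2. specialize (HN N (le_n N)).
    rewrite Rminus_0_r in HN. apply Rabs_def2 in HN.
    rewrite pow_inv in HN. destruct HN as [HN _].
    replace (g (u n) - g (u m))%R with ((g (u n) - g (u N)) - (g (u m) - g (u N)))%R by ring.
    eapply Rle_lt_trans. apply Rabs_triang. rewrite Rabs_Ropp. unfold Rdiv in *. lra. }
  destruct Hex as [l Hl]. exists l. intros n.
  assert (Hl2 : is_lim_seq (fun m => Rabs (g (u n) - g (u (m + n)%nat))) (Rabs (g (u n) - l))).
  { apply (is_lim_seq_abs _ (g (u n) - l)%R). apply is_lim_seq_minus'. apply is_lim_seq_const.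
    apply -> (is_lim_seq_incr_n (fun m => g (u m)) n l). exact Hl. }
  apply (is_lim_seq_le _ (fun _ => 2 * K / 2 ^ n)%R _ _) with (2 := Hl2) (3 := is_lim_seq_const _).
  intros m. eapply Rle_trans. apply Hg. rewrite Cmod_sym. apply H3. lia. }
destruct (HL Re) as [x Hx].
{ intros a b. replace (Re a - Re b)%R with (Re (a - b)) by reflexivity. apply re_le_Cmod. }
destruct (HL Im) as [y Hy].
{ intros a b. replace (Im a - Im b)%R with (Im (a - b)) by reflexivity.
  eapply Rle_trans. 2: apply Rmax_Cmod. apply Rmax_r. }
exists (x, y). intros n.
replace (u n - (x, y)) with (RtoC (Re (u n) - x)%R + Ci * RtoC (Im (u n) - y)%R).
2:{ destruct (u n) as [p q]. apply injective_projections; simpl; ring. }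
eapply Rle_trans. apply Cmod_triangle. rewrite Cmod_mult, Cmod_Ci, !Cmod_R.
specialize (Hx n). specialize (Hy n). unfold Rdiv in *. lra.
Qed.

(** An affine function has a primitive, so its integral over the triangle
    vanishes and only the error [e] of the first-order expansion of [f] at [p]
    contributes. *)
Lemma TInt_near f c r p l e T : cont_on f c r ->
  (let '(a, b, d) := T in in_ball c r a /\ in_ball c r b /\ in_ball c r d) ->
  (0 <= e)%R -> in_ball c r p ->
  (forall u, in_ball c r u -> (Cmod (u - p) <= Cmod (apex T - p) + perimeter T)%R ->
     (Cmod (f u - f p - l * (u - p)) <= e)%R) ->
  (Cmod (TInt f T) <= e * perimeter T)%R.
Proof.
destruct T as [[a b] d]. intros Hf (Ha & Hb & Hd) He Hp H.
set (A := fun u => f p + l * (u - p)).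
set (B := fun u => f p * u + l * / 2 * ((u - p) * (u - p))).
assert (HB : forall u, is_derive B u (A u)).
{ intros u. unfold A, B.
  replace (f p + l * (u - p)) with (f p * 1 + l * / 2 * ((1 - 0) * (u - p) + (u - p) * (1 - 0))).
  2:{ field. }
  apply is_derive_Cplus; apply is_derive_Cscal.
  apply is_derive_Cid. apply (is_derive_Cmult (fun u => u - p) (fun u => u - p));
  apply (is_derive_Cminus (fun u => u) (fun _ => p));
  (apply is_derive_Cid || apply is_derive_Cconst). }
assert (HA : forall u, is_derive A u (0 + l * (1 - 0))).
{ intros u. apply (is_derive_Cplus (fun _ => f p) (fun u => l * (u - p))). apply is_derive_Cconst.
  apply is_derive_Cscal. apply (is_derive_Cminus (fun u => u) (fun _ => p)).
  apply is_derive_Cid. apply is_derive_Cconst. }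
assert (HAc : forall c' r', cont_on A c' r').
{ intros c' r' z _. eapply is_derive_C_continuous, HA. }
set (g := fun u => f u - A u).
assert (Hg : forall x y, in_ball c r x -> in_ball c r y ->
  (forall t : R, (0 <= t <= 1)%R -> (Cmod (x + t * (y - x) - p)%C <= Cmod (a - p) + perimeter (a, b, d))%R) ->
  (Cmod (SInt f x y - (B y - B x)) <= e * Cmod (y - x))%R).
{ intros x y Hx Hy Ht.
  rewrite <- (SInt_derive B A c r x y) by (auto; intros; apply HB).
  pose proof (SInt_correct f c r x y Hf Hx Hy) as I1.
  pose proof (SInt_correct A c r x y (HAc c r) Hx Hy) as I2.
  pose proof (is_CInt_minus _ _ _ _ _ _ I1 I2) as I3.
  replace (e * Cmod (y - x))%R with (e * Cmod (y - x) * (1 - 0))%R by ring.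
  eapply is_CInt_bound; [lra| |exact I3]. intros t Ht'. cbv beta.
  set (v := x + t * (y - x)).
  replace (f v * (y - x) - A v * (y - x)) with ((f v - f p - l * (v - p)) * (y - x)) by (unfold A; ring).
  rewrite Cmod_mult. apply Rmult_le_compat_r. apply Cmod_ge_0.
  apply H. apply segment_in_ball; assumption. apply Ht, Ht'. }
pose proof (Cmod_ge_0 (b - a)). pose proof (Cmod_ge_0 (d - b)). pose proof (Cmod_ge_0 (a - d)).
assert (Da : (Cmod (a - p) <= Cmod (a - p) + perimeter (a, b, d))%R) by (unfold perimeter; lra).
assert (Db : (Cmod (b - p) <= Cmod (a - p) + perimeter (a, b, d))%R).
{ pose proof (Cmod_tri3 b a p). unfold perimeter; lra. }
assert (Dd : (Cmod (d - p) <= Cmod (a - p) + perimeter (a, b, d))%R).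
{ pose proof (Cmod_tri3 d a p). rewrite (Cmod_sym d a) in H3. unfold perimeter; lra. }
pose proof (Hg a b Ha Hb (fun t Ht => segment_dist a b p _ t Ht Da Db)) as G1.
pose proof (Hg b d Hb Hd (fun t Ht => segment_dist b d p _ t Ht Db Dd)) as G2.
pose proof (Hg d a Hd Ha (fun t Ht => segment_dist d a p _ t Ht Dd Da)) as G3.
unfold TInt, perimeter.
replace (SInt f a b + SInt f b d + SInt f d a) with
 ((SInt f a b - (B b - B a)) + (SInt f b d - (B d - B b)) + (SInt f d a - (B a - B d))) by ring.
eapply Rle_trans. apply Cmod_triangle.
eapply Rle_trans. apply Rplus_le_compat_r. apply Cmod_triangle. lra.
Qed.

(** Goursat's argument: were the integral over some triangle nonzero, the
    nested quarters would shrink to a point where differentiability makes the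
    integral smaller than the factor 4 per subdivision permits. *)
Theorem goursat f c r a b d : holo f c r ->
  in_ball c r a -> in_ball c r b -> in_ball c r d -> TInt f (a, b, d) = 0.
Proof.
intros Hh Ha Hb Hd. pose proof (holo_cont_on f c r Hh) as Hf.
set (rho := Rmax (Cmod (a - c)) (Rmax (Cmod (b - c)) (Cmod (d - c)))).
assert (Hrho : (rho < r)%R) by (repeat apply Rmax_lub_lt; assumption).
set (T := fun n => Nat.iter n (quarter f) (a, b, d)).
assert (W : forall n, within c rho (T n)).
{ induction n.
  - simpl. repeat split. apply Rmax_l.
    eapply Rle_trans; [|apply Rmax_r]; apply Rmax_l.
    eapply Rle_trans; [|apply Rmax_r]; apply Rmax_r.
  - exact (proj1 (quarter_spec f c r rho (T n) Hf Hrho IHn)). }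
set (s := perimeter (a, b, d)).
assert (Hs0 : (0 <= s)%R).
{ unfold s, perimeter. pose proof (Cmod_ge_0 (b - a)). pose proof (Cmod_ge_0 (d - b)). pose proof (Cmod_ge_0 (a - d)). lra. }
assert (S : forall n, perimeter (T n) = (s / 2 ^ n)%R).
{ induction n.
  - simpl. unfold s, perimeter. field.
  - change (T (S n)) with (quarter f (T n)).
    destruct (quarter_spec f c r rho (T n) Hf Hrho (W n)) as (_ & E & _). rewrite E, IHn.
    simpl. field. apply pow_nonzero. lra. }
assert (Q : forall n, (Cmod (TInt f (a, b, d)) <= 4 ^ n * Cmod (TInt f (T n)))%R).
{ induction n.
  - simpl. lra.
  - change (T (Datatypes.S n)) with (quarter f (T n)).
    destruct (quarter_spec f c r rho (T n) Hf Hrho (W n)) as (_ & _ & _ & E).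
    assert (0 < 4 ^ n)%R by (apply pow_lt; lra).
    change (4 ^ Datatypes.S n)%R with (4 * 4 ^ n)%R. nra. }
destruct (geometric_limit (fun n => apex (T n)) s) as [p Hp].
{ intros n. change (T (Datatypes.S n)) with (quarter f (T n)). rewrite <- S.
  apply (quarter_spec f c r rho (T n) Hf Hrho (W n)). }
assert (Hpc : (Cmod (p - c) <= rho)%R).
{ apply le_epsilon. intros eps He.
  destruct (pow_lt_1_zero (/ 2) ltac:(rewrite Rabs_pos_eq; lra) (eps / (4 * s + 1))
    ltac:(apply Rdiv_lt_0_compat; lra)) as [N HN].
  specialize (HN N (le_n N)). rewrite pow_inv in HN.
  assert (0 < / 2 ^ N)%R by (apply Rinv_0_lt_compat, pow_lt; lra).
  rewrite Rabs_pos_eq in HN by lra. apply Rlt_div_r in HN; [|lra].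
  assert (E4 : (4 * s / 2 ^ N <= eps)%R) by (unfold Rdiv in *; nra).
  specialize (Hp N). cbv beta in Hp. pose proof (Cmod_tri3 p (apex (T N)) c) as H0.
  rewrite (Cmod_sym p (apex (T N))) in H0.
  assert (Cmod (apex (T N) - c) <= rho)%R.
  { specialize (W N). destruct (T N) as [[x y] z]. apply W. }
  lra. }
assert (Hpb : in_ball c r p) by (unfold in_ball; lra).
destruct (Hh p Hpb) as [l Hl].
apply Cmod_eq_0. apply Rle_antisym; [|apply Cmod_ge_0].
apply le_epsilon. intros eps He. rewrite Rplus_0_l.
set (e := (eps / (5 * s * s + 1))%R).
assert (Hs2 : (0 < 5 * s * s + 1)%R) by nra.
assert (He' : (0 < e)%R) by (apply Rdiv_lt_0_compat; lra).
destruct (proj1 (is_derive_C_iff f p l) Hl e He') as [del [Hdel Hd']].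
destruct (pow_lt_1_zero (/ 2) ltac:(rewrite Rabs_pos_eq; lra) (del / (5 * s + 1))
    ltac:(apply Rdiv_lt_0_compat; lra)) as [N HN].
specialize (HN N (le_n N)). rewrite pow_inv in HN.
assert (H2N : (0 < / 2 ^ N)%R) by (apply Rinv_0_lt_compat, pow_lt; lra).
rewrite Rabs_pos_eq in HN by lra. apply Rlt_div_r in HN; [|lra].
assert (K : (Cmod (TInt f (T N)) <= (e * (5 * s / 2 ^ N)) * perimeter (T N))%R).
{ apply (TInt_near f c r p l); try assumption.
  - specialize (W N). destruct (T N) as [[x y] z]. apply (within_in_ball c r rho); assumption.
  - apply Rmult_le_pos. lra. unfold Rdiv. nra.
  - intros u Hu Hup. rewrite S in Hup. specialize (Hp N). cbv beta in Hp.
    assert (Hup' : (Cmod (u - p) <= 5 * s / 2 ^ N)%R) by (unfold Rdiv in *; lra).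
    eapply Rle_trans. apply Hd'. unfold Rdiv in *; nra.
    apply Rmult_le_compat_l; lra. }
rewrite S in K. eapply Rle_trans. apply (Q N).
apply Rle_trans with (4 ^ N * (e * (5 * s / 2 ^ N) * (s / 2 ^ N)))%R.
apply Rmult_le_compat_l; [|exact K]. apply pow_le; lra.
replace (4 ^ N)%R with (2 ^ N * 2 ^ N)%R.
2:{ rewrite <- Rpow_mult_distr. f_equal; ring. }
replace (2 ^ N * 2 ^ N * (e * (5 * s / 2 ^ N) * (s / 2 ^ N)))%R with (e * (5 * s * s))%R.
2:{ field. apply pow_nonzero; lra. }
assert (E1 : (e * (5 * s * s + 1) = eps)%R) by (unfold e; field; lra).
lra.
Qed.

(** The primitive integrates [f] from the centre. By Goursat's theorem its
    increment from [z] to [u] is the integral over the segment between them,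
    which is close to [f z * (u - z)]. *)
Theorem holo_primitive f c r : (0 < r)%R -> holo f c r ->
  exists G : C -> C, forall z, in_ball c r z -> is_derive G z (f z).
Proof.
intros Hr Hh. pose proof (holo_cont_on f c r Hh) as Hf.
assert (Hc : in_ball c r c) by (unfold in_ball; rewrite Cmod_self; exact Hr).
exists (SInt f c). intros z Hz. apply is_derive_C_iff. intros eps He.
destruct (proj1 (continuous_C_iff f z) (Hf z Hz) eps He) as [d [Hd Hd']].
unfold in_ball in Hz.
exists (Rmin d (r - Cmod (z - c))). split. { apply Rmin_pos; lra. }
intros u Hu.
assert (Hu1 : (Cmod (u - z) < d)%R) by (eapply Rlt_le_trans; [exact Hu|apply Rmin_l]).
assert (Hu2 : (Cmod (u - z) < r - Cmod (z - c))%R) by (eapply Rlt_le_trans; [exact Hu|apply Rmin_r]).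
assert (Hub : in_ball c r u). { unfold in_ball. pose proof (Cmod_tri3 u z c). lra. }
pose proof (goursat f c r c z u Hh Hc Hz Hub) as HT. unfold TInt in HT.
rewrite (SInt_swap f c r c u) in HT by assumption.
replace (SInt f c u - SInt f c z) with (SInt f z u).
2:{ replace (SInt f c u - SInt f c z) with
     (SInt f z u - (SInt f c z + SInt f z u + - SInt f c u)) by ring. rewrite HT. ring. }
apply (SInt_approx f c r); try assumption.
intros t Ht. left. apply Hd'.
replace (z + t * (u - z) - z) with (t * (u - z)) by ring.
rewrite Cmod_mult, Cmod_R, Rabs_pos_eq by lra. pose proof (Cmod_ge_0 (u - z)). nra.
Qed.

(** * The complex exponential *)

Definition cexp (z : C) : C :=
  (exp (Re z) * cos (Im z), exp (Re z) * sin (Im z))%R.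

Lemma cexp_plus a b : cexp (a + b) = cexp a * cexp b.
Proof.
destruct a as [x y], b as [x' y']. unfold cexp; simpl.
rewrite exp_plus, cos_plus, sin_plus.
apply injective_projections; simpl; ring.
Qed.

Lemma cexp_0 : cexp 0 = 1.
Proof. unfold cexp; simpl. rewrite exp_0, cos_0, sin_0. apply injective_projections; simpl; ring. Qed.

Lemma Cmod_cexp z : Cmod (cexp z) = exp (Re z).
Proof.
destruct z as [x y]. unfold cexp, Cmod; simpl.
replace (exp x * cos y * (exp x * cos y * 1) + exp x * sin y * (exp x * sin y * 1))%R
  with (exp x * exp x * ((sin y)² + (cos y)²))%R by (unfold Rsqr; ring).
rewrite sin2_cos2, Rmult_1_r. apply sqrt_square. left; apply exp_pos.
Qed.

Lemma cexp_nz z : cexp z <> 0.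
Proof. apply Cmod_gt_0. rewrite Cmod_cexp. apply exp_pos. Qed.

Lemma cexp_opp z : cexp (- z) = / cexp z.
Proof.
pose proof (cexp_nz z) as H.
assert (E : cexp z * cexp (- z) = 1).
{ rewrite <- cexp_plus. replace (z + - z) with (RtoC 0) by ring. apply cexp_0. }
replace (cexp (- z)) with (/ cexp z * (cexp z * cexp (- z))) by (field; exact H).
rewrite E. ring.
Qed.

Lemma derivable_pt_lim_approx (g : R -> R) (x l : R) : derivable_pt_lim g x l ->
  forall eps, (0 < eps)%R -> exists d, (0 < d)%R /\
    forall h, (Rabs h < d)%R -> (Rabs (g (x + h) - g x - l * h) <= eps * Rabs h)%R.
Proof.
intros H eps He. destruct (H eps He) as [d Hd]. exists d. split. apply cond_pos.
intros h Hh. destruct (Req_dec h 0) as [->|Hn].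
- rewrite Rplus_0_r. replace (g x - g x - l * 0)%R with 0%R by ring. rewrite Rabs_R0. lra.
- specialize (Hd h Hn Hh).
  replace (g (x + h) - g x - l * h)%R with (((g (x + h) - g x) / h - l) * h)%R by (field; exact Hn).
  rewrite Rabs_mult. apply Rmult_le_compat_r. apply Rabs_pos. lra.
Qed.

Lemma is_derive_cexp_0 : is_derive cexp (RtoC 0) (RtoC 1).
Proof.
apply is_derive_C_iff. intros eps0 He0.
set (eps := Rmin 1 (eps0 / 12)).
assert (He : (0 < eps)%R) by (apply Rmin_pos; lra).
assert (E1 : (eps <= 1)%R) by apply Rmin_l.
assert (E2 : (eps <= eps0 / 12)%R) by apply Rmin_r.
destruct (derivable_pt_lim_approx _ _ _ derivable_pt_lim_exp_0 eps He) as [d1 [Hd1 H1]].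
destruct (derivable_pt_lim_approx _ _ _ (derivable_pt_lim_cos 0) eps He) as [d2 [Hd2 H2]].
destruct (derivable_pt_lim_approx _ _ _ (derivable_pt_lim_sin 0) eps He) as [d3 [Hd3 H3]].
exists (Rmin (Rmin d1 d2) (Rmin d3 eps)). split. { apply Rmin_pos; apply Rmin_pos; assumption. }
intros u Hu. replace (u - 0) with u in * by ring. rewrite cexp_0.
assert (Hx := re_le_Cmod u).
assert (Hy : (Rabs (Im u) <= Cmod u)%R) by (eapply Rle_trans; [apply Rmax_r|apply Rmax_Cmod]).
assert (A1 : (Cmod u < d1)%R) by (eapply Rlt_le_trans; [exact Hu|eapply Rle_trans; [apply Rmin_l|apply Rmin_l]]).
assert (A2 : (Cmod u < d2)%R) by (eapply Rlt_le_trans; [exact Hu|eapply Rle_trans; [apply Rmin_l|apply Rmin_r]]).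
assert (A3 : (Cmod u < d3)%R) by (eapply Rlt_le_trans; [exact Hu|eapply Rle_trans; [apply Rmin_r|apply Rmin_l]]).
assert (A4 : (Cmod u < eps)%R) by (eapply Rlt_le_trans; [exact Hu|eapply Rle_trans; [apply Rmin_r|apply Rmin_r]]).
set (m := Cmod u) in *. destruct u as [x y]. simpl in Hx, Hy.
specialize (H1 x ltac:(lra)). specialize (H2 y ltac:(lra)). specialize (H3 y ltac:(lra)).
rewrite !Rplus_0_l in *. rewrite exp_0 in H1. rewrite cos_0, sin_0 in H2. rewrite sin_0, cos_0 in H3.
replace (cexp (x, y) - 1 - 1 * (x, y)) with
  (RtoC (exp x - 1 - 1 * x)%R + (RtoC (exp x) * RtoC (cos y - 1 - - 0 * y)%R +
   Ci * (RtoC (exp x) * RtoC (sin y - 0 - 1 * y)%R + RtoC (exp x - 1)%R * RtoC y))).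
2:{ unfold cexp. apply injective_projections; simpl; ring. }
assert (B1 : (Rabs (exp x - 1) <= 2 * eps)%R).
{ replace (exp x - 1)%R with ((exp x - 1 - 1 * x) + x)%R by ring.
  eapply Rle_trans. apply Rabs_triang. nra. }
assert (B2 : (Rabs (exp x) <= 3)%R).
{ replace (exp x)%R with ((exp x - 1) + 1)%R by ring.
  eapply Rle_trans. apply Rabs_triang. rewrite Rabs_R1. lra. }
eapply Rle_trans. apply Cmod_triangle.
eapply Rle_trans. apply Rplus_le_compat_l. apply Cmod_triangle.
rewrite (Cmod_mult Ci), Cmod_Ci, (Rmult_1_l (Cmod _)).
eapply Rle_trans. apply Rplus_le_compat_l, Rplus_le_compat_l, Cmod_triangle.
rewrite !Cmod_mult, !Cmod_R.
pose proof (Rabs_pos (exp x)). pose proof (Rabs_pos y). pose proof (Rabs_pos x).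
pose proof (Rabs_pos (cos y - 1 - - 0 * y)). pose proof (Rabs_pos (sin y - 0 - 1 * y)).
assert (C1 : (Rabs (exp x - 1 - 1 * x) <= eps * m)%R) by nra.
assert (C2 : (Rabs (cos y - 1 - - 0 * y) <= eps * m)%R) by nra.
assert (C3 : (Rabs (sin y - 0 - 1 * y) <= eps * m)%R) by nra.
assert (C4 : (Rabs (exp x - 1) * Rabs y <= 2 * eps * m)%R).
{ apply Rmult_le_compat; try lra. apply Rabs_pos. }
assert (C5 : (Rabs (exp x) * Rabs (cos y - 1 - - 0 * y) <= 3 * (eps * m))%R) by (apply Rmult_le_compat; lra).
assert (C6 : (Rabs (exp x) * Rabs (sin y - 0 - 1 * y) <= 3 * (eps * m))%R) by (apply Rmult_le_compat; lra).
assert (0 <= m)%R by (unfold m; apply Cmod_ge_0). nra.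
Qed.

Lemma is_derive_cexp z : is_derive cexp z (cexp z).
Proof.
assert (H : is_derive (fun u => cexp z * cexp (u - z)) z (cexp z * (1 * (1 - 0)))).
{ apply is_derive_Cscal. apply (is_derive_Ccomp cexp (fun u => u - z)).
  - replace (z - z) with (RtoC 0) by ring. apply is_derive_cexp_0.
  - apply (is_derive_Cminus (fun u => u) (fun _ => z)).
    apply is_derive_Cid. apply is_derive_Cconst. }
replace (cexp z * (1 * (1 - 0))) with (cexp z) in H by ring.
refine (is_derive_C_ext_near _ _ _ _ 1 Rlt_0_1 _ H).
intros u _. rewrite <- cexp_plus. f_equal. ring.
Qed.

(** * Difference quotients *)

Lemma mvt_ball (F f : C -> C) c r a b M :
  (forall z, in_ball c r z -> is_derive F z (f z)) -> cont_on f c r ->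
  in_ball c r a -> in_ball c r b ->
  (forall t : R, (0 <= t <= 1)%R -> (Cmod (f (a + t * (b - a))%C) <= M)%R) ->
  (Cmod (F b - F a) <= M * Cmod (b - a))%R.
Proof.
intros HF Hf Ha Hb H.
rewrite <- (SInt_derive F f c r a b HF Hf Ha Hb).
replace (SInt f a b) with (SInt f a b - 0 * (b - a)) by ring.
apply (SInt_approx f c r); try assumption.
intros t Ht. replace (f (a + t * (b - a)) - 0) with (f (a + t * (b - a))) by ring. apply H, Ht.
Qed.

Lemma derive_0_const (F : C -> C) c r a b :
  (forall z, in_ball c r z -> is_derive F z (RtoC 0)) ->
  in_ball c r a -> in_ball c r b -> F a = F b.
Proof.
intros HF Ha Hb. symmetry. apply Ceq_minus, Cmod_eq_0, Rle_antisym; [|apply Cmod_ge_0].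
rewrite <- (Rmult_0_l (Cmod (b - a))).
apply (mvt_ball F (fun _ => RtoC 0) c r); try assumption.
- intros z _. eapply is_derive_C_continuous, is_derive_Cconst.
- intros t _. rewrite Cmod_0. lra.
Qed.

(** The value [l] at [u = z] is meant to be the derivative of [F] at [z], which
    makes the quotient holomorphic across [z]. *)
Definition dquot (F : C -> C) (z l u : C) : C :=
  if Ceq_dec u z then l else (F u - F z) / (u - z).

Lemma dquot_eq F z l : dquot F z l z = l.
Proof. unfold dquot. destruct Ceq_dec; congruence. Qed.

Lemma dquot_mult F z l u : F u - F z = (u - z) * dquot F z l u.
Proof.
unfold dquot. destruct Ceq_dec as [->|n]; [ring|].
field. apply Cminus_eq_contra, n.
Qed.

Lemma is_derive_dquot_off F z l u a : u <> z -> is_derive F u a ->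
  ex_derive (dquot F z l) u.
Proof.
intros Hn HF.
assert (Hz : u - z <> 0) by (apply Cminus_eq_contra, Hn).
assert (Hp : (0 < Cmod (u - z))%R) by (apply Cmod_gt_0, Hz).
eexists.
apply (is_derive_C_ext_near (fun v => (F v - F z) * / (v - z)) _ u _ (Cmod (u - z)) Hp).
- intros v Hv. unfold dquot. destruct Ceq_dec as [->|n]; [|reflexivity].
  exfalso. rewrite Cmod_sym in Hv. lra.
- apply (is_derive_Cmult (fun v => F v - F z) (fun v => / (v - z))).
  + apply (is_derive_Cminus F (fun _ => F z)). exact HF. apply is_derive_Cconst.
  + apply (is_derive_Ccomp Cinv (fun v => v - z)). apply is_derive_Cinv, Hz.
    apply (is_derive_Cminus (fun v => v) (fun _ => z)). apply is_derive_Cid. apply is_derive_Cconst.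
Qed.

(** The second-order Taylor estimate at [z], obtained by integrating the
    first-order estimate for the derivative [f]. *)
Lemma is_derive_dquot_at (F f : C -> C) (z l : C) (r : R) : (0 < r)%R ->
  (forall u, in_ball z r u -> is_derive F u (f u)) -> cont_on f z r ->
  is_derive f z l -> is_derive (dquot F z (f z)) z (l / 2).
Proof.
intros Hr HF Hf Hl. apply is_derive_C_iff. intros eps He.
destruct (proj1 (is_derive_C_iff _ _ _) Hl eps He) as [d [Hd Hd']].
exists (Rmin d r). split. { apply Rmin_pos; assumption. }
intros u Hu.
assert (Hu1 : (Cmod (u - z) < d)%R) by (eapply Rlt_le_trans; [exact Hu|apply Rmin_l]).
assert (Hu2 : (Cmod (u - z) < r)%R) by (eapply Rlt_le_trans; [exact Hu|apply Rmin_r]).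
rewrite dquot_eq.
destruct (Ceq_dec u z) as [->|Hn].
{ rewrite dquot_eq. replace (f z - f z - l / 2 * (z - z)) with (RtoC 0) by ring.
  rewrite Cmod_self, Cmod_0. lra. }
set (B := fun v => F v - (f z * v + l / 2 * ((v - z) * (v - z)))).
set (b := fun v => f v - f z - l * (v - z)).
assert (HB : forall v, in_ball z r v -> is_derive B v (b v)).
{ intros v Hv. unfold B, b.
  replace (f v - f z - l * (v - z)) with (f v - (f z * 1 + l / 2 * ((1 - 0) * (v - z) + (v - z) * (1 - 0)))) by field.
  apply is_derive_Cminus. apply HF, Hv.
  apply is_derive_Cplus; apply is_derive_Cscal.
  apply is_derive_Cid. apply (is_derive_Cmult (fun u => u - z) (fun u => u - z));
  apply (is_derive_Cminus (fun u => u) (fun _ => z));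
  (apply is_derive_Cid || apply is_derive_Cconst). }
assert (Hb : cont_on b z r).
{ intros v Hv. apply continuous_C_iff. intros e He'.
  pose proof (Cmod_ge_0 l) as Hl0.
  destruct (proj1 (continuous_C_iff _ _) (Hf v Hv) (e / 2)%R ltac:(lra)) as [d1 [Hd1 H1]].
  assert (Hq : (0 < e / 2 / (Cmod l + 1))%R) by (repeat apply Rdiv_lt_0_compat; lra).
  exists (Rmin d1 (e / 2 / (Cmod l + 1))). split. apply Rmin_pos; assumption.
  intros w Hw.
  assert (Hw1 : (Cmod (w - v) < d1)%R) by (eapply Rlt_le_trans; [exact Hw|apply Rmin_l]).
  assert (Hw2 : (Cmod (w - v) < e / 2 / (Cmod l + 1))%R) by (eapply Rlt_le_trans; [exact Hw|apply Rmin_r]).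
  apply Rlt_div_r in Hw2; [|lra]. specialize (H1 w Hw1). unfold b.
  replace (f w - f z - l * (w - z) - (f v - f z - l * (v - z))) with ((f w - f v) + - (l * (w - v))) by ring.
  eapply Rle_lt_trans. apply Cmod_triangle. rewrite Cmod_opp, Cmod_mult.
  pose proof (Cmod_ge_0 (w - v)). nra. }
assert (Hz : in_ball z r z) by (unfold in_ball; rewrite Cmod_self; exact Hr).
assert (K : (Cmod (B u - B z) <= eps * Cmod (u - z) * Cmod (u - z))%R).
{ apply (mvt_ball B b z r); try assumption.
  intros t Ht. unfold b.
  assert (Et : Cmod (z + t * (u - z) - z) = (t * Cmod (u - z))%R).
  { replace (z + t * (u - z) - z) with (t * (u - z)) by ring.
    rewrite Cmod_mult, Cmod_R, Rabs_pos_eq by lra. reflexivity. }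
  pose proof (Cmod_ge_0 (u - z)).
  eapply Rle_trans. apply Hd'. rewrite Et. nra. rewrite Et.
  apply Rmult_le_compat_l; nra. }
assert (Hnz : u - z <> 0) by (apply Cminus_eq_contra, Hn).
assert (Hp : (0 < Cmod (u - z))%R) by (apply Cmod_gt_0, Hnz).
apply Rmult_le_reg_r with (Cmod (u - z)). exact Hp.
rewrite <- Cmod_mult.
replace ((dquot F z (f z) u - f z - l / 2 * (u - z)) * (u - z)) with (B u - B z).
exact K. unfold B.
replace (F u) with ((F u - F z) + F z) by ring. rewrite (dquot_mult F z (f z) u). ring.
Qed.

(** Primitives are treated first because their derivative [f] is known to be
    differentiable, which gives the second-order expansion at [z]. *)
Lemma holo_dquot_primitive (F f : C -> C) c r z :
  (forall u, in_ball c r u -> is_derive F u (f u)) -> holo f c r -> in_ball c r z ->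
  holo (dquot F z (f z)) c r.
Proof.
intros HF Hh Hz u Hu. destruct (Ceq_dec u z) as [->|Hn].
- destruct (Hh z Hz) as [l Hl]. exists (l / 2).
  unfold in_ball in Hz.
  assert (Hsub : forall v, in_ball z (r - Cmod (z - c)) v -> in_ball c r v).
  { unfold in_ball. intros v Hv. pose proof (Cmod_tri3 v z c). lra. }
  apply (is_derive_dquot_at F f z l (r - Cmod (z - c))). lra.
  + intros v Hv. apply HF, Hsub, Hv.
  + intros v Hv. apply ex_derive_C_continuous, Hh, Hsub, Hv.
  + exact Hl.
- eapply is_derive_dquot_off. exact Hn. apply HF, Hu.
Qed.

(** * Cauchy integrals over circles *)

Definition circle (c : C) (rho theta : R) : C := c + rho * cexp (theta * Ci).

Definition circle' (rho theta : R) : C := rho * (cexp (theta * Ci) * Ci).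

Definition CircInt (phi : C -> C) (c : C) (rho : R) : C :=
  CInt (fun t => phi (circle c rho t) * circle' rho t) 0 (2 * PI).

Lemma is_derive_circle c rho t :
  is_derive (V := C_R_NormedModule) (circle c rho) t (circle' rho t).
Proof.
assert (H : is_derive (fun z => c + rho * cexp (z * Ci)) (RtoC t) (0 + rho * (cexp (t * Ci) * (1 * Ci + t * 0)))).
{ apply is_derive_Cplus. apply is_derive_Cconst. apply is_derive_Cscal.
  apply (is_derive_Ccomp cexp (fun z => z * Ci)). apply is_derive_cexp.
  apply (is_derive_Cmult (fun z => z) (fun _ => Ci)). apply is_derive_Cid. apply is_derive_Cconst. }
assert (Hp : is_derive (V := C_R_NormedModule) (fun s : R => 0 + s * (1 - 0)) t (1 - 0)) by apply is_derive_segment.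
replace (RtoC t) with (0 + t * (1 - 0)) in H at 1 by ring.
pose proof (is_derive_path _ (fun s : R => 0 + s * (1 - 0)) t _ _ H Hp) as H2.
cbv beta in H2.
replace ((0 + rho * (cexp (t * Ci) * (1 * Ci + t * 0))) * (1 - 0)) with (circle' rho t) in H2
  by (unfold circle'; ring).
eapply (is_derive_ext (V := C_R_NormedModule)); [|exact H2].
intros s. cbv beta. unfold circle. do 3 f_equal. ring.
Qed.

Lemma continuous_circle' rho t : continuous (circle' rho) t.
Proof.
apply (continuous_ext (fun s => circle 0 rho s * Ci)).
{ intros s. change (@eq C (circle 0 rho s * Ci) (circle' rho s)). unfold circle, circle'. ring. }
apply continuous_Cmult. eapply is_derive_RC_continuous, is_derive_circle.
apply continuous_RC_const.
Qed.

Lemma circle_dist c rho t : (0 <= rho)%R -> Cmod (circle c rho t - c) = rho.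
Proof.
intros H. unfold circle. replace (c + rho * cexp (t * Ci) - c) with (rho * cexp (t * Ci)) by ring.
rewrite Cmod_mult, Cmod_cexp, Cmod_R, Rabs_pos_eq by lra.
replace (Re (t * Ci)) with 0%R by (simpl; ring). rewrite exp_0. ring.
Qed.

Lemma circle_closed c rho : circle c rho (2 * PI) = circle c rho 0.
Proof.
unfold circle. do 2 f_equal. unfold cexp; simpl.
replace (2 * PI * 0 - 0 * 1)%R with 0%R by ring.
replace (0 * 0 - 0 * 1)%R with 0%R by ring.
replace (2 * PI * 1 + 0 * 0)%R with (2 * PI)%R by ring.
replace (0 * 1 + 0 * 0)%R with 0%R by ring.
rewrite cos_2PI, sin_2PI, cos_0, sin_0. reflexivity.
Qed.

Lemma PI2_pos : (0 < 2 * PI)%R.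
Proof. pose proof PI_RGT_0. lra. Qed.

Lemma circle'_mod rho t : (0 <= rho)%R -> Cmod (circle' rho t) = rho.
Proof.
intros H. replace (circle' rho t) with ((circle 0 rho t - 0) * Ci) by (unfold circle, circle'; ring).
rewrite Cmod_mult, circle_dist, Cmod_Ci by exact H. ring.
Qed.

Lemma CircInt_correct phi c rho :
  (forall t, continuous phi (circle c rho t)) ->
  is_CInt (fun t => phi (circle c rho t) * circle' rho t) 0 (2 * PI) (CircInt phi c rho).
Proof.
intros H. apply CInt_correct. left; apply PI2_pos. intros t _.
apply continuous_Cmult; [|apply continuous_circle'].
apply (continuous_comp (circle c rho) phi). eapply is_derive_RC_continuous, is_derive_circle. apply H.
Qed.

Lemma CircInt_derive (F f : C -> C) c rho :
  (forall t, is_derive F (circle c rho t) (f (circle c rho t))) ->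
  (forall t, continuous f (circle c rho t)) -> CircInt f c rho = 0.
Proof.
intros HF Hf. apply is_CInt_unique.
replace (RtoC 0) with (F (circle c rho (2 * PI)) - F (circle c rho 0)).
- apply is_CInt_derive_path; auto.
  left; apply PI2_pos. intros t; apply is_derive_circle. intros t. apply continuous_circle'.
- rewrite circle_closed. ring.
Qed.

Lemma CircInt_ext phi psi c rho :
  (forall t, phi (circle c rho t) = psi (circle c rho t)) -> CircInt phi c rho = CircInt psi c rho.
Proof.
intros H. apply CInt_ext. left; apply PI2_pos. intros t _. rewrite H. reflexivity.
Qed.

Lemma CircInt_minus phi psi c rho :
  (forall t, continuous phi (circle c rho t)) -> (forall t, continuous psi (circle c rho t)) ->
  CircInt (fun u => phi u - psi u) c rho = CircInt phi c rho - CircInt psi c rho.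
Proof.
intros H1 H2. apply is_CInt_unique.
eapply is_CInt_ext; [left; apply PI2_pos| |
  exact (is_CInt_minus _ _ _ _ _ _ (CircInt_correct _ _ _ H1) (CircInt_correct _ _ _ H2))].
intros t _. cbv beta. ring.
Qed.

Lemma CircInt_Cmult k phi c rho :
  (forall t, continuous phi (circle c rho t)) ->
  CircInt (fun u => k * phi u) c rho = k * CircInt phi c rho.
Proof.
intros H1. apply is_CInt_unique.
eapply is_CInt_ext; [left; apply PI2_pos| |
  exact (is_CInt_Cmult _ _ _ k _ (CircInt_correct _ _ _ H1))].
intros t _. cbv beta. ring.
Qed.

Lemma CircInt_bound phi c rho M : (0 <= rho)%R ->
  (forall t, continuous phi (circle c rho t)) ->
  (forall t, (Cmod (phi (circle c rho t)) <= M)%R) ->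
  (Cmod (CircInt phi c rho) <= M * rho * (2 * PI))%R.
Proof.
intros Hr Hc H. replace (2 * PI)%R with (2 * PI - 0)%R by ring.
eapply is_CInt_bound; [left; apply PI2_pos| |apply CircInt_correct, Hc].
intros t _. cbv beta. rewrite Cmod_mult, circle'_mod by exact Hr.
apply Rmult_le_compat_r; auto.
Qed.

(** * Cauchy's formula *)

Lemma continuous_RC_Cmod (g : R -> C) t : continuous g t -> continuous (fun s => Cmod (g s)) t.
Proof.
intros H. apply (continuous_comp g Cmod). exact H.
intros P [e He]. unfold filtermap. apply (locally_C_iff (fun u => P (Cmod u))).
exists e. split. apply cond_pos. intros u Hu. apply He.
change (Rabs (Cmod u - Cmod (g t)) < e)%R.
apply Rabs_def1. pose proof (Cmod_tri_inv u (g t)). lra.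
pose proof (Cmod_tri_inv (g t) u). rewrite Cmod_sym in H0. lra.
Qed.

Lemma continuous_circle_bounded (phi : C -> C) c rho :
  (forall t, continuous phi (circle c rho t)) ->
  exists M, (0 <= M)%R /\
    forall t, (0 <= t <= 2 * PI)%R -> (Cmod (phi (circle c rho t)) <= M)%R.
Proof.
intros H.
destruct (continuity_ab_maj (fun t => Cmod (phi (circle c rho t))) 0 (2 * PI)) as [x [Hx _]].
- left; apply PI2_pos.
- intros t _. apply continuity_pt_filterlim.
  apply (continuous_RC_Cmod (fun t => phi (circle c rho t))).
  apply (continuous_comp (circle c rho) phi). eapply is_derive_RC_continuous, is_derive_circle. apply H.
- exists (Cmod (phi (circle c rho x))). split. apply Cmod_ge_0. exact Hx.
Qed.

(** First-order Taylor expansion of [w ^ n] at [b = / (u - z)], with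
    [a = / (u - z - h)], hence the relation [a - b = h * a * b]. *)
Lemma Cpow_taylor1 (a b h : C) (A : R) n : (0 <= A)%R ->
  (Cmod a <= A)%R -> (Cmod b <= A)%R -> a - b = h * a * b ->
  (Cmod (a ^ n - b ^ n) <= INR n * Cmod h * A ^ S n)%R /\
  (Cmod (a ^ n - b ^ n - INR n * h * b ^ S n) <= INR n * INR n * (Cmod h * Cmod h) * A ^ S (S n))%R.
Proof.
intros HA Ha Hb E.
pose proof (Cmod_ge_0 h) as Hh.
assert (D : forall n, (Cmod (a ^ n - b ^ n) <= INR n * Cmod h * A ^ S n)%R).
{ induction n0.
  - simpl. rewrite Cmod_self. lra.
  - rewrite !Cpow_S. replace (a * a ^ n0 - b * b ^ n0) with (a ^ n0 * (a - b) + b * (a ^ n0 - b ^ n0)) by ring.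
    eapply Rle_trans. apply Cmod_triangle. rewrite E, !Cmod_mult, Cmod_pow.
    assert (P1 : (Cmod a ^ n0 <= A ^ n0)%R) by (apply pow_incr; split; [apply Cmod_ge_0|exact Ha]).
    pose proof (Cmod_ge_0 a). pose proof (Cmod_ge_0 b). pose proof (pow_le (Cmod a) n0 H).
    pose proof (pow_le A n0 HA).
    assert (P2 : (Cmod a ^ n0 * (Cmod h * Cmod a * Cmod b) <= A ^ n0 * (Cmod h * A * A))%R).
    { apply Rmult_le_compat; try assumption. repeat apply Rmult_le_pos; assumption.
      apply Rmult_le_compat; try assumption. apply Rmult_le_pos; assumption. apply Rmult_le_compat_l; assumption. }
    assert (P3 : (Cmod b * Cmod (a ^ n0 - b ^ n0) <= A * (INR n0 * Cmod h * A ^ S n0))%R).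
    { apply Rmult_le_compat; try assumption. apply Cmod_ge_0. }
    rewrite S_INR. simpl in *. lra. }
split. apply D. induction n.
- simpl. replace (1 - 1 - 0 * h * (b * 1)) with (RtoC 0) by ring. rewrite Cmod_0. lra.
- specialize (D (S n)).
  replace (a ^ S n - b ^ S n - INR (S n) * h * b ^ S (S n)) with
   (b * (a ^ n - b ^ n - INR n * h * b ^ S n) + h * b * (a ^ S n - b ^ S n)).
  2:{ rewrite S_INR, RtoC_plus, !Cpow_S.
      replace (a * a ^ n - b * b ^ n - (INR n + 1) * h * (b * (b * b ^ n))) with
       ((a - b) * a ^ n + b * (a ^ n - b ^ n) - (INR n + 1) * h * (b * (b * b ^ n))) by ring.
      rewrite E. ring. }
  eapply Rle_trans. apply Cmod_triangle. rewrite !(Cmod_mult b), !(Cmod_mult (h * b)), (Cmod_mult h b).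
  pose proof (Cmod_ge_0 b).
  assert (P1 : (Cmod b * Cmod (a ^ n - b ^ n - INR n * h * b ^ S n) <=
     A * (INR n * INR n * (Cmod h * Cmod h) * A ^ S (S n)))%R).
  { apply Rmult_le_compat; try assumption. apply Cmod_ge_0. }
  assert (P2 : (Cmod h * Cmod b * Cmod (a ^ S n - b ^ S n) <=
     Cmod h * A * (INR (S n) * Cmod h * A ^ S (S n)))%R).
  { apply Rmult_le_compat; try assumption. apply Rmult_le_pos; assumption. apply Cmod_ge_0.
    apply Rmult_le_compat_l; assumption. }
  eapply Rle_trans. apply Rplus_le_compat; eassumption.
  rewrite S_INR. pose proof (pos_INR n).
  replace (A ^ S (S (S n)))%R with (A * A ^ S (S n))%R by reflexivity.
  assert (Q : (0 <= INR n * (Cmod h * Cmod h * (A * A ^ S (S n))))%R).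
  { repeat apply Rmult_le_pos; try assumption. apply pow_le, HA. }
  nra.
Qed.

(** For the exponent [n] this is the derivative of order [n - 1] of Cauchy's
    integral, up to the factor [(n - 1)!]. *)
Definition CauchyInt (phi : C -> C) (c : C) (rho : R) (n : nat) (z : C) : C :=
  CircInt (fun u => phi u * (/ (u - z)) ^ n) c rho.

Lemma circle_off c rho t z : (0 <= rho)%R -> in_ball c rho z -> circle c rho t - z <> 0.
Proof.
intros Hr Hz E. unfold in_ball in Hz. pose proof (circle_dist c rho t Hr) as H.
apply Ceq_minus in E. rewrite E in H. lra.
Qed.

Lemma ex_derive_inv_pow z u n : u - z <> 0 -> ex_derive (fun v => (/ (v - z)) ^ n) u.
Proof.
intros Hu. induction n.
- exists (RtoC 0). simpl. apply is_derive_Cconst.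
- destruct IHn as [l Hl]. eexists. simpl.
  apply (is_derive_Cmult (fun v => / (v - z)) (fun v => (/ (v - z)) ^ n)); [|exact Hl].
  apply (is_derive_Ccomp Cinv (fun v => v - z)). apply is_derive_Cinv, Hu.
  apply (is_derive_Cminus (fun v => v) (fun _ => z)). apply is_derive_Cid. apply is_derive_Cconst.
Qed.

(** Differentiation under the integral sign: the expansion of the kernel is
    uniform in [u] because the circle stays at distance [d] from [z]. *)
Lemma is_derive_CauchyInt phi c rho n z : (0 < rho)%R -> in_ball c rho z ->
  (forall t, continuous phi (circle c rho t)) ->
  is_derive (CauchyInt phi c rho n) z (INR n * CauchyInt phi c rho (S n) z).
Proof.
intros Hr Hz Hphi. unfold in_ball in Hz.
destruct (continuous_circle_bounded phi c rho Hphi) as [M [HM0 HM]].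
set (d := (rho - Cmod (z - c))%R). assert (Hd : (0 < d)%R) by (unfold d; lra).
set (A := (2 / d)%R). assert (HA : (0 < A)%R) by (apply Rdiv_lt_0_compat; lra).
set (K := (M * (INR n * INR n * A ^ S (S n)) * rho * (2 * PI))%R).
assert (HK : (0 <= K)%R).
{ pose proof PI2_pos. pose proof (pos_INR n). pose proof (pow_lt A (S (S n)) HA).
  unfold K. apply Rmult_le_pos; [|lra]. apply Rmult_le_pos; [|lra].
  apply Rmult_le_pos; [lra|]. apply Rmult_le_pos; [|lra]. apply Rmult_le_pos; lra. }
apply is_derive_C_iff. intros eps He.
assert (Hq : (0 < eps / (K + 1))%R) by (apply Rdiv_lt_0_compat; lra).
exists (Rmin (d / 2) (eps / (K + 1))). split. apply Rmin_pos; lra.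
intros z' Hz'.
assert (Hz1 : (Cmod (z' - z) < d / 2)%R) by (eapply Rlt_le_trans; [exact Hz'|apply Rmin_l]).
assert (Hz2 : (Cmod (z' - z) < eps / (K + 1))%R) by (eapply Rlt_le_trans; [exact Hz'|apply Rmin_r]).
set (h := z' - z) in *.
assert (Hb' : in_ball c rho z'). { unfold in_ball. pose proof (Cmod_tri3 z' z c). fold h in H. unfold d in Hz1. lra. }
assert (HI : forall m w, in_ball c rho w ->
  is_CInt (fun t => phi (circle c rho t) * (/ (circle c rho t - w)) ^ m * circle' rho t) 0 (2 * PI)
    (CauchyInt phi c rho m w)).
{ intros m w Hw. apply (CircInt_correct (fun u => phi u * (/ (u - w)) ^ m)). intros t.
  apply continuous_Cmult. apply Hphi.
  apply ex_derive_C_continuous, ex_derive_inv_pow, circle_off; [lra|exact Hw]. }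
pose proof (HI n z' Hb') as I1. pose proof (HI n z Hz) as I2.
pose proof (is_CInt_Cmult _ _ _ (INR n * h) _ (HI (S n) z Hz)) as I3.
pose proof (is_CInt_minus _ _ _ _ _ _ (is_CInt_minus _ _ _ _ _ _ I1 I2) I3) as I4.
replace (INR n * CauchyInt phi c rho (S n) z * h) with (INR n * h * CauchyInt phi c rho (S n) z) by ring.
apply Rle_trans with (K * (Cmod h * Cmod h))%R.
- replace (K * (Cmod h * Cmod h))%R with
   (M * (INR n * INR n * (Cmod h * Cmod h) * A ^ S (S n)) * rho * (2 * PI - 0))%R by (unfold K; ring).
  eapply is_CInt_bound; [left; apply PI2_pos| |exact I4].
  intros t Ht. cbv beta. set (u := circle c rho t).
  assert (Hu1 : u - z <> 0) by (apply circle_off; [lra|exact Hz]).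
  assert (Hu2 : u - z' <> 0) by (apply circle_off; [lra|exact Hb']).
  pose proof (circle_dist c rho t ltac:(lra)) as Hu. fold u in Hu.
  assert (G1 : (d <= Cmod (u - z))%R).
  { pose proof (Cmod_tri3 u z c). unfold d. lra. }
  assert (G2 : (d / 2 <= Cmod (u - z'))%R).
  { pose proof (Cmod_tri3 u z' z). fold h in H. lra. }
  assert (B1 : (Cmod (/ (u - z)) <= A)%R).
  { rewrite Cmod_inv by exact Hu1. unfold A. replace (2 / d)%R with (/ (d / 2))%R by (field; lra).
    apply Rinv_le_contravar; lra. }
  assert (B2 : (Cmod (/ (u - z')) <= A)%R).
  { rewrite Cmod_inv by exact Hu2. unfold A. replace (2 / d)%R with (/ (d / 2))%R by (field; lra).
    apply Rinv_le_contravar; lra. }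
  assert (E : / (u - z') - / (u - z) = h * / (u - z') * / (u - z)).
  { unfold h. field. split; assumption. }
  destruct (Cpow_taylor1 _ _ h A n ltac:(lra) B2 B1 E) as [_ T].
  set (a := / (u - z')) in *. set (b := / (u - z)) in *.
  replace (phi u * a ^ n * circle' rho t - phi u * b ^ n * circle' rho t -
     INR n * h * (phi u * b ^ S n * circle' rho t)) with
   (phi u * (a ^ n - b ^ n - INR n * h * b ^ S n) * circle' rho t) by ring.
  rewrite !Cmod_mult, circle'_mod by lra.
  apply Rmult_le_compat_r. lra.
  apply Rmult_le_compat; try apply Cmod_ge_0. apply HM, Ht. exact T.
- apply Rlt_div_r in Hz2; [|lra]. pose proof (Cmod_ge_0 h).
  rewrite <- Rmult_assoc. apply Rmult_le_compat_r; nra.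
Qed.

(** The derivative in [z] integrates [/ (u - z) ^ 2], which has a primitive
    along the circle; hence the value is the one at the centre. *)
Lemma CauchyInt_1_const c rho z : (0 < rho)%R -> in_ball c rho z ->
  CauchyInt (fun _ => RtoC 1) c rho 1 z = 2 * PI * Ci.
Proof.
intros Hr Hz.
assert (Hc : in_ball c rho c) by (unfold in_ball; rewrite Cmod_self; exact Hr).
transitivity (CauchyInt (fun _ => RtoC 1) c rho 1 c).
- apply (derive_0_const _ c rho); try assumption. intros w Hw.
  replace (RtoC 0) with (INR 1 * CauchyInt (fun _ => RtoC 1) c rho 2 w).
  apply is_derive_CauchyInt; try assumption. intros t. apply continuous_const.
  replace (CauchyInt (fun _ => RtoC 1) c rho 2 w) with (RtoC 0). ring.
  symmetry. apply (CircInt_derive (fun u => (RtoC (-1)) * / (u - w))).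
  + intros t. pose proof (circle_off c rho t w ltac:(lra) Hw) as Hn.
    set (u := circle c rho t) in *.
    replace (1 * (/ (u - w)) ^ 2) with ((RtoC (-1)) * (- / ((u - w) * (u - w)) * (1 - 0))) by (simpl; field; exact Hn).
    apply is_derive_Cscal. apply (is_derive_Ccomp Cinv (fun v => v - w)). apply is_derive_Cinv, Hn.
    apply (is_derive_Cminus (fun v => v) (fun _ => w)). apply is_derive_Cid. apply is_derive_Cconst.
  + intros t. apply continuous_Cmult. apply continuous_const.
    apply ex_derive_C_continuous, ex_derive_inv_pow, circle_off; [lra|exact Hw].
- apply is_CInt_unique.
  assert (K := is_RInt_const (V := C_R_NormedModule) 0 (2 * PI)%R Ci).
  rewrite scal_R_Cmult, Rminus_0_r, RtoC_mult in K.
  eapply is_CInt_ext; [left; apply PI2_pos| |exact K].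
  intros t _. cbv beta.
  assert (Hn : rho * cexp (t * Ci) <> 0).
  { apply Cmult_neq_0. apply RtoC_neq_0; lra. apply cexp_nz. }
  unfold circle, circle'. replace (c + rho * cexp (t * Ci) - c) with (rho * cexp (t * Ci)) by ring.
  simpl. replace (rho * (cexp (t * Ci) * Ci)) with (rho * cexp (t * Ci) * Ci) by ring.
  field. split. apply cexp_nz. apply RtoC_neq_0; lra.
Qed.

Lemma PI2Ci_nz : 2 * PI * Ci <> 0.
Proof.
apply Cmult_neq_0; [|apply Ci_nz]. rewrite <- RtoC_mult. apply RtoC_neq_0.
pose proof PI2_pos. lra.
Qed.

Lemma circle_in_ball c rho r t : (0 <= rho)%R -> (rho < r)%R -> in_ball c r (circle c rho t).
Proof. intros H1 H2. unfold in_ball. rewrite circle_dist by exact H1. exact H2. Qed.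

(** Cauchy's formula follows from the difference quotient being holomorphic,
    hence having a primitive, hence integrating to zero over the circle. *)
Lemma cauchy_of_dquot (F : C -> C) l c r rho z : (0 < rho)%R -> (rho < r)%R -> in_ball c rho z ->
  cont_on F c r -> holo (dquot F z l) c r ->
  2 * PI * Ci * F z = CauchyInt F c rho 1 z.
Proof.
intros Hr Hr' Hz HF Hq.
destruct (holo_primitive (dquot F z l) c r ltac:(lra) Hq) as [P HP].
assert (Hcb : forall t, in_ball c r (circle c rho t)) by (intros t; apply circle_in_ball; lra).
assert (H0 : CircInt (dquot F z l) c rho = 0).
{ apply (CircInt_derive P).
  intros t; apply HP, Hcb. intros t. apply ex_derive_C_continuous, Hq, Hcb. }
assert (Hinv : forall t, continuous (fun u => (/ (u - z)) ^ 1) (circle c rho t)).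
{ intros t. apply ex_derive_C_continuous, ex_derive_inv_pow, circle_off; [lra|exact Hz]. }
rewrite (CircInt_ext _ (fun u => F u * (/ (u - z)) ^ 1 - F z * (1 * (/ (u - z)) ^ 1))) in H0.
- rewrite CircInt_minus, CircInt_Cmult in H0.
  + fold (CauchyInt F c rho 1 z) in H0.
    fold (CauchyInt (fun _ => RtoC 1) c rho 1 z) in H0.
    rewrite CauchyInt_1_const in H0 by assumption.
    symmetry. apply Ceq_minus. rewrite <- H0. ring.
  + intros t. apply continuous_Cmult. apply continuous_const. apply Hinv.
  + intros t. apply continuous_Cmult. apply HF, Hcb. apply Hinv.
  + intros t. apply continuous_Cmult. apply continuous_const.
    apply continuous_Cmult. apply continuous_const. apply Hinv.
- intros t. pose proof (circle_off c rho t z ltac:(lra) Hz) as Hn. unfold dquot.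
  destruct Ceq_dec as [E|_]. { exfalso. apply Hn. rewrite E. ring. }
  simpl. field. exact Hn.
Qed.

(** A primitive [G] of [f] satisfies Cauchy's formula, since its difference
    quotients are holomorphic, and Cauchy integrals can be differentiated again
    and again; [f'] is the second derivative of [G]. *)
Theorem holo_derive (f f' : C -> C) c r :
  (forall z, in_ball c r z -> is_derive f z (f' z)) -> holo f' c r.
Proof.
intros Hf' z0 Hz0.
assert (Hh : holo f c r) by (intros z Hz; exists (f' z); apply Hf', Hz).
unfold in_ball in Hz0. pose proof (Cmod_ge_0 (z0 - c)).
destruct (holo_primitive f c r ltac:(lra) Hh) as [G HG].
set (rho := ((r + Cmod (z0 - c)) / 2)%R).
assert (Hr1 : (0 < rho)%R) by (unfold rho; lra).
assert (Hr2 : (rho < r)%R) by (unfold rho; lra).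
assert (Hz0' : in_ball c rho z0) by (unfold in_ball, rho; lra).
assert (Hsub : forall w, in_ball c rho w -> in_ball c r w) by (unfold in_ball; intros; lra).
assert (HGc : cont_on G c r) by (intros w Hw; eapply is_derive_C_continuous, HG, Hw).
assert (HGt : forall t, continuous G (circle c rho t)).
{ intros t. apply HGc, circle_in_ball; lra. }
set (K := fun n w => / (2 * PI * Ci) * CauchyInt G c rho n w).
assert (HK : forall n w, in_ball c rho w -> is_derive (K n) w (INR n * K (S n) w)).
{ intros n w Hw. unfold K.
  replace (INR n * (/ (2 * PI * Ci) * CauchyInt G c rho (S n) w)) with
    (/ (2 * PI * Ci) * (INR n * CauchyInt G c rho (S n) w)) by ring.
  apply is_derive_Cscal, is_derive_CauchyInt; assumption. }
assert (E1 : forall w, in_ball c rho w -> G w = K 1%nat w).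
{ intros w Hw. unfold K. rewrite <- (cauchy_of_dquot G (f w) c r rho w); try assumption.
  field. exact PI2Ci_nz || (repeat split; try apply Ci_nz; apply RtoC_neq_0; pose proof PI_RGT_0; lra).
  apply holo_dquot_primitive; auto. }
assert (Hopen : forall (g1 g2 : C -> C) w l, in_ball c rho w -> (forall v, in_ball c rho v -> g1 v = g2 v) ->
   is_derive g1 w l -> is_derive g2 w l).
{ intros g1 g2 w l Hw Hg. unfold in_ball in Hw.
  apply (is_derive_C_ext_near g1 g2 w l (rho - Cmod (w - c))). lra.
  intros u Hu. apply Hg. unfold in_ball. pose proof (Cmod_tri3 u w c). lra. }
assert (E2 : forall w, in_ball c rho w -> f w = INR 1 * K 2%nat w).
{ intros w Hw. apply (is_derive_C_unique (K 1%nat) w).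
  apply (Hopen G); auto. apply HK, Hw. }
assert (E3 : forall w, in_ball c rho w -> f' w = INR 1 * (INR 2 * K 3%nat w)).
{ intros w Hw. apply (is_derive_C_unique (fun v => INR 1 * K 2%nat v) w).
  apply (Hopen f); auto. apply is_derive_Cscal, HK, Hw. }
exists (INR 1 * (INR 2 * (INR 3 * K 4%nat z0))).
apply (Hopen (fun w => INR 1 * (INR 2 * K 3%nat w))); auto.
- intros v Hv. symmetry. apply E3, Hv.
- apply is_derive_Cscal, is_derive_Cscal, HK, Hz0'.
Qed.

Definition Cderive (f : C -> C) (z : C) : C :=
  epsilon (inhabits (RtoC 0)) (fun l => is_derive f z l).

Lemma Cderive_correct f z : ex_derive f z -> is_derive f z (Cderive f z).
Proof. intros H. apply (epsilon_spec (inhabits (RtoC 0)) (fun l => is_derive f z l)). exact H. Qed.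

Lemma holo_Cderive f c r : holo f c r -> holo (Cderive f) c r.
Proof.
intros H. apply (holo_derive f). intros z Hz. apply Cderive_correct, H, Hz.
Qed.

(** With [f'] differentiable, the second-order expansion holds for every
    holomorphic [f], and so does Cauchy's formula. *)
Lemma holo_dquot f c r z : holo f c r -> in_ball c r z -> holo (dquot f z (Cderive f z)) c r.
Proof.
intros H Hz. apply (holo_dquot_primitive f (Cderive f)); try assumption.
- intros u Hu. apply Cderive_correct, H, Hu.
- apply holo_Cderive, H.
Qed.

(** * Cauchy's estimates *)

Lemma cauchy_estimate f c r rho z M : holo f c r -> (0 < rho)%R -> (rho < r)%R ->
  in_ball c rho z -> (forall u, Cmod (u - c) = rho -> (Cmod (f u) <= M)%R) ->
  (Cmod (f z) <= rho * M / (rho - Cmod (z - c)))%R.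
Proof.
intros Hf H0 Hr Hz HM. pose proof (PI2_pos) as HP.
assert (Hzr : in_ball c r z) by (unfold in_ball in *; lra).
pose proof (cauchy_of_dquot f (Cderive f z) c r rho z H0 Hr Hz (holo_cont_on _ _ _ Hf)
  (holo_dquot f c r z Hf Hzr)) as E.
unfold in_ball in Hz. set (d := (rho - Cmod (z - c))%R). assert (Hd : (0 < d)%R) by (unfold d; lra).
assert (B : (Cmod (CauchyInt f c rho 1 z) <= (M * / d) * rho * (2 * PI))%R).
{ apply CircInt_bound. lra.
  - intros t. apply continuous_Cmult.
    apply (holo_cont_on _ _ _ Hf). apply circle_in_ball; lra.
    apply ex_derive_C_continuous, ex_derive_inv_pow, circle_off; [lra|exact Hz].
  - intros t. pose proof (circle_dist c rho t ltac:(lra)) as Hu.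
    pose proof (circle_off c rho t z ltac:(lra) Hz) as Hn. simpl.
    rewrite Cmult_1_r, Cmod_mult, Cmod_inv by exact Hn.
    apply Rmult_le_compat. apply Cmod_ge_0.
    left. apply Rinv_0_lt_compat, Cmod_gt_0, Hn.
    apply HM, Hu. apply Rinv_le_contravar. exact Hd.
    pose proof (Cmod_tri3 (circle c rho t) z c). unfold d. lra. }
rewrite <- E, !Cmod_mult, Cmod_Ci, !Cmod_R, !Rabs_pos_eq in B by lra.
apply Rmult_le_reg_l with (2 * PI)%R. exact HP.
unfold Rdiv. lra.
Qed.

Lemma cauchy_derive_estimate f c r rho l M : holo f c r -> (0 < rho)%R -> (rho < r)%R ->
  is_derive f c l -> (forall u, Cmod (u - c) = rho -> (Cmod (f u) <= M)%R) ->
  (Cmod l <= 2 * M / rho)%R.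
Proof.
intros Hf H0 Hr Hl HM.
assert (Hc : forall s, (0 < s)%R -> in_ball c s c) by (intros s Hs; unfold in_ball; rewrite Cmod_self; exact Hs).
replace l with (dquot f c l c) by apply dquot_eq.
assert (El : l = Cderive f c).
{ apply (is_derive_C_unique f c). exact Hl. apply Cderive_correct. exists l. exact Hl. }
assert (Hfc : (Cmod (f c) <= M)%R).
{ pose proof (cauchy_estimate f c r rho c M Hf H0 Hr (Hc _ H0) HM) as H.
  rewrite Cmod_self in H. replace (rho * M / (rho - 0))%R with M in H by (field; lra). exact H. }
replace (2 * M / rho)%R with (rho * (2 * M / rho) / (rho - Cmod (c - c)))%R.
2:{ rewrite Cmod_self. field. lra. }
apply (cauchy_estimate _ c r); try assumption.
- rewrite El. apply holo_dquot; [exact Hf|apply Hc; lra].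
- apply Hc, H0.
- intros u Hu.
  apply Rmult_le_reg_l with rho. exact H0.
  rewrite <- Hu at 1. rewrite <- Cmod_mult, <- dquot_mult.
  replace (rho * (2 * M / rho))%R with (M + M)%R by (field; lra).
  unfold Cminus. eapply Rle_trans. apply Cmod_triangle. rewrite Cmod_opp. specialize (HM u Hu). lra.
Qed.

(** * Extrema on closed discs *)

Definition closed_ball (c : C) (r : R) (z : C) : Prop := (Cmod (z - c) <= r)%R.

Definition cont_closed (g : C -> R) (c : C) (r : R) : Prop :=
  forall z, closed_ball c r z -> forall eps, (0 < eps)%R -> exists d, (0 < d)%R /\
    forall u, closed_ball c r u -> (Cmod (u - z) < d)%R -> (Rabs (g u - g z) < eps)%R.

Lemma Cmod_le_sum (x y : R) : (Cmod (x, y) <= Rabs x + Rabs y)%R.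
Proof.
replace (x, y) with (RtoC x + Ci * RtoC y) by (apply injective_projections; simpl; ring).
eapply Rle_trans. apply Cmod_triangle. rewrite Cmod_mult, Cmod_Ci, !Cmod_R. lra.
Qed.

Lemma closed_ball_bounded g c r : cont_closed g c r ->
  exists M, forall z, closed_ball c r z -> (g z <= M)%R.
Proof.
intros Hg.
assert (Hd : forall z : C, exists d : posreal, forall u, closed_ball c r u ->
   (Cmod (u - z) < d)%R -> closed_ball c r z /\ (g u <= g z + 1)%R).
{ intros z. destruct (Rle_lt_dec (Cmod (z - c)) r) as [H|H].
  - destruct (Hg z H 1%R Rlt_0_1) as [d [Hd Hd']]. exists (mkposreal d Hd).
    intros u Hu Huz. split. exact H. specialize (Hd' u Hu Huz). apply Rabs_def2 in Hd'. lra.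
  - assert (Hp : (0 < Cmod (z - c) - r)%R) by lra. exists (mkposreal _ Hp). simpl.
    intros u Hu Huz. exfalso. unfold closed_ball in Hu. pose proof (Cmod_tri3 z u c).
    rewrite (Cmod_sym z u) in H0. lra. }
(* centres off the closed ball get a radius that keeps away from it *)
set (pt := fun t : Compactness.Tn 2 R => (fst t, fst (snd t)) : C).
set (delta := fun t => proj1_sig (constructive_indefinite_description _ (Hd (pt t)))).
assert (Hdelta : forall t u, closed_ball c r u ->
   (Cmod (u - pt t) < delta t)%R -> closed_ball c r (pt t) /\ (g u <= g (pt t) + 1)%R).
{ intros t. unfold delta. destruct constructive_indefinite_description as [d Hd']. exact Hd'. }
set (half := fun t => mkposreal (delta t / 2) (Rdiv_lt_0_compat _ _ (cond_pos (delta t)) Rlt_0_2)).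
assert (Hcl := NNPP _ (Compactness.compactness_list 2 (Re c - r, (Im c - r, tt))%R (Re c + r, (Im c + r, tt))%R half)). destruct Hcl as [l Hl].
exists (fold_right (fun t m => Rmax (g (pt t) + 1) m) 0%R l).
assert (Hfold : forall t, In t l -> (g (pt t) + 1 <= fold_right (fun t m => Rmax (g (pt t) + 1) m) 0 l)%R).
{ clear. induction l; simpl; intros t Ht. easy. destruct Ht as [->|Ht]. apply Rmax_l.
  eapply Rle_trans. apply IHl, Ht. apply Rmax_r. }
intros z Hz. destruct z as [x y].
assert (Hx : (Rabs (x - Re c) <= r)%R).
{ eapply Rle_trans; [|exact Hz]. apply (re_le_Cmod ((x, y) - c)). }
assert (Hy : (Rabs (y - Im c) <= r)%R).
{ eapply Rle_trans; [|exact Hz]. eapply Rle_trans; [|apply Rmax_Cmod]. apply Rmax_r. }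
apply Rabs_le_between in Hx. apply Rabs_le_between in Hy.
destruct (Hl (x, (y, tt))) as [t [Ht [_ Hc]]].
{ simpl. repeat split; lra. }
destruct t as [t1 [t2 []]]. simpl in Hc. destruct Hc as [Hc1 [Hc2 _]].
eapply Rle_trans; [|apply Hfold, Ht]. apply Hdelta. exact Hz.
change ((x, y) - pt (t1, (t2, tt))) with ((x - t1)%R, (y - t2)%R).
eapply Rle_lt_trans. apply Cmod_le_sum. change (Compactness.Tn 1 R) with (R * unit)%type in *. change (Compactness.Tn 0 R) with unit in *. lra.
Qed.

(** If the supremum [M] were not attained, [/ (M - g z)] would be continuous and
    hence bounded, and [g] would stay away from its supremum. *)
Lemma closed_ball_max g c r : (0 <= r)%R -> cont_closed g c r ->
  exists p, closed_ball c r p /\ forall z, closed_ball c r z -> (g z <= g p)%R.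
Proof.
intros Hr Hg. destruct (closed_ball_bounded g c r Hg) as [M0 HM0].
destruct (completeness (fun v => exists z, closed_ball c r z /\ v = g z)) as [M [HM HM']].
- exists M0. intros v [z [Hz ->]]. apply HM0, Hz.
- exists (g c), c. split; [|reflexivity]. unfold closed_ball. rewrite Cmod_self. exact Hr.
- assert (HM1 : forall z, closed_ball c r z -> (g z <= M)%R) by (intros z Hz; apply HM; exists z; auto).
  apply NNPP. intros Hno.
  assert (Hlt : forall z, closed_ball c r z -> (g z < M)%R).
  { intros z Hz. destruct (Rle_lt_or_eq_dec _ _ (HM1 z Hz)) as [H|H]. exact H.
    exfalso. apply Hno. exists z. split. exact Hz. rewrite H. exact HM1. }
  destruct (closed_ball_bounded (fun z => / (M - g z))%R c r) as [B HB].
  { intros z Hz eps He. pose proof (Hlt z Hz) as Hz'. set (m := (M - g z)%R). assert (Hm : (0 < m)%R) by (unfold m; lra).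
    assert (Em : m = (M - g z)%R) by reflexivity. clearbody m.
    assert (Hmm : (0 < m * m)%R) by (apply Rmult_lt_0_compat; lra).
    assert (Hemm : (0 < eps * (m * m))%R) by (apply Rmult_lt_0_compat; lra).
    destruct (Hg z Hz (Rmin (m / 2) (eps * (m * m) / 2))) as [d [Hd Hd']].
    { apply Rmin_pos. lra. apply Rdiv_lt_0_compat; lra. }
    exists d. split. exact Hd. intros u Hu Huz. specialize (Hd' u Hu Huz).
    assert (A1 : (Rabs (g u - g z) < m / 2)%R) by (eapply Rlt_le_trans; [exact Hd'|apply Rmin_l]).
    assert (A2 : (Rabs (g u - g z) < eps * (m * m) / 2)%R) by (eapply Rlt_le_trans; [exact Hd'|apply Rmin_r]).
    assert (A3 : (m / 2 < M - g u)%R) by (apply Rabs_def2 in A1; lra).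
    cbv beta. replace (/ (M - g u) - / m)%R with ((g u - g z) * / ((M - g u) * m))%R by (rewrite Em; field; lra).
    rewrite Rabs_mult, (Rabs_pos_eq (/ _)) by (left; apply Rinv_0_lt_compat; nra).
    assert (A4 : (0 < eps * m * (M - g u - m / 2))%R).
    { apply Rmult_lt_0_compat; [apply Rmult_lt_0_compat|]; lra. }
    apply Rlt_div_l; nra. }
  assert (HB0 : (0 < B)%R).
  { assert (Hcc : closed_ball c r c) by (unfold closed_ball; rewrite Cmod_self; exact Hr).
    specialize (HB c Hcc). specialize (Hlt c Hcc).
    assert (0 < / (M - g c))%R by (apply Rinv_0_lt_compat; lra). lra. }
  assert (K : (M <= M - / B)%R).
  { apply HM'. intros v [z [Hz ->]]. specialize (HB z Hz). specialize (Hlt z Hz).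
    assert (/ B <= M - g z)%R. { rewrite <- (Rinv_inv (M - g z)). apply Rinv_le_contravar. apply Rinv_0_lt_compat; lra. exact HB. }
    lra. }
  assert (0 < / B)%R by (apply Rinv_0_lt_compat, HB0). lra.
Qed.

Lemma cont_closed_Cmod f c r : (forall z, closed_ball c r z -> continuous f z) ->
  cont_closed (fun z => Cmod (f z)) c r.
Proof.
intros Hf z Hz eps He. destruct (proj1 (continuous_C_iff _ _) (Hf z Hz) eps He) as [d [Hd Hd']].
exists d. split. exact Hd. intros u _ Hu. specialize (Hd' u Hu).
apply Rabs_def1. pose proof (Cmod_tri_inv (f u) (f z)). lra.
pose proof (Cmod_tri_inv (f z) (f u)). rewrite Cmod_sym in H. lra.
Qed.

(** * Entire functions *)

Lemma entire_holo f c r : entire f -> holo f c r.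
Proof. intros H z _. apply H. Qed.

Lemma entire_dquot f z : entire f -> entire (dquot f z (Cderive f z)).
Proof.
intros H u. apply (holo_dquot f z (Cmod (u - z) + 1)%R z).
apply entire_holo, H. unfold in_ball. rewrite Cmod_self. pose proof (Cmod_ge_0 (u - z)). lra.
unfold in_ball. lra.
Qed.

Lemma entire_mult f g : entire f -> entire g -> entire (fun u => f u * g u).
Proof. intros Hf Hg z. destruct (Hf z) as [a Ha]. destruct (Hg z) as [b Hb]. eexists. apply is_derive_Cmult; eassumption. Qed.

Lemma entire_minus_const f w : entire f -> entire (fun u => f u - w).
Proof. intros Hf z. destruct (Hf z) as [a Ha]. eexists. apply (is_derive_Cminus f (fun _ => w)). exact Ha. apply is_derive_Cconst. Qed.

Lemma entire_bounded f c r : entire f -> exists M, forall z, closed_ball c r z -> (Cmod (f z) <= M)%R.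
Proof.
intros Hf. apply closed_ball_bounded. apply cont_closed_Cmod.
intros z _. apply ex_derive_C_continuous, Hf.
Qed.

Lemma entire_cauchy_estimate f c rho z M : entire f -> in_ball c rho z ->
  (forall u, Cmod (u - c) = rho -> (Cmod (f u) <= M)%R) ->
  (Cmod (f z) <= rho * M / (rho - Cmod (z - c)))%R.
Proof.
intros Hf Hz HM. pose proof (Cmod_ge_0 (z - c)). unfold in_ball in Hz.
apply (cauchy_estimate f c (rho + 1)); try assumption; try lra. apply entire_holo, Hf.
Qed.

Lemma le_geometric_0 (x K q : R) : (0 <= q < 1)%R -> (forall n, (x <= K * q ^ n)%R) -> (x <= 0)%R.
Proof.
intros Hq H. apply Rnot_lt_le. intros Hx.
destruct (Rle_lt_dec K 0) as [HK|HK].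
- specialize (H 0%nat). simpl in H. lra.
- destruct (pow_lt_1_zero q) with (y := (x / K)%R) as [N HN].
  rewrite Rabs_pos_eq; lra. apply Rdiv_lt_0_compat; lra.
  specialize (HN N (le_n N)). specialize (H N).
  rewrite Rabs_pos_eq in HN by (apply pow_le; lra). apply Rlt_div_r in HN; lra.
Qed.

(** A zero of infinite order at [z] forces the function to vanish: dividing
    by [(u - z) ^ m] and applying Cauchy's bound on a larger circle gives a
    bound for it that is geometric in [m]. *)
Lemma entire_order g z : entire g -> (exists u, g u <> 0) ->
  exists m q, entire q /\ q z <> 0 /\ forall u, g u = (u - z) ^ m * q u.
Proof.
intros Hg [u0 Hu0]. apply NNPP. intros Hno.
assert (Hdiv : forall m, exists q, entire q /\ forall u, g u = (u - z) ^ m * q u).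
{ induction m.
  - exists g. split. exact Hg. intros u. simpl. ring.
  - destruct IHm as [q [Hq E]]. destruct (Ceq_dec (q z) 0) as [Hz|Hz].
    + exists (dquot q z (Cderive q z)). split. apply entire_dquot, Hq.
      intros u. rewrite E. simpl. rewrite (Cmult_comm (u - z)), <- Cmult_assoc, <- dquot_mult, Hz. ring.
    + exfalso. apply Hno. exists m, q. auto. }
apply Hu0. apply Cmod_eq_0, Rle_antisym; [|apply Cmod_ge_0].
set (d := Cmod (u0 - z)). set (rho := (d + 1)%R).
assert (Hd : (0 <= d)%R) by apply Cmod_ge_0.
destruct (entire_bounded g z rho Hg) as [M HM].
apply (le_geometric_0 _ (rho * M) (d / rho)).
{ unfold rho. split. apply Rdiv_le_0_compat; lra. apply Rlt_div_l; lra. }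
intros m. destruct (Hdiv m) as [q [Hq E]].
assert (B : (Cmod (q u0) <= rho * (M * / rho ^ m) / (rho - Cmod (u0 - z)))%R).
{ apply entire_cauchy_estimate. exact Hq. unfold in_ball. fold d. unfold rho. lra.
  intros u Hu.
  assert (Hp : (0 < rho ^ m)%R) by (apply pow_lt; unfold rho; lra).
  apply Rle_div_r. exact Hp.
  assert (HMu : (Cmod (g u) <= M)%R) by (apply HM; unfold closed_ball; lra).
  rewrite E, Cmod_mult, Cmod_pow, Hu in HMu. lra. }
fold d in B. replace (rho - d)%R with 1%R in B by (unfold rho; ring).
rewrite E, Cmod_mult, Cmod_pow. fold d.
unfold Rdiv. rewrite Rpow_mult_distr, pow_inv.
unfold Rdiv in B. rewrite Rinv_1, Rmult_1_r in B.
replace (rho * M * (d ^ m * / rho ^ m))%R with (d ^ m * (rho * (M * / rho ^ m)))%R by ring.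
apply Rmult_le_compat_l. apply pow_le, Hd. exact B.
Qed.

Lemma entire_taylor f n : entire f -> exists (a : nat -> C) (h : C -> C),
  entire h /\ forall z, f z = sum_n (fun k => a k * z ^ k) n + z ^ S n * h z.
Proof.
intros Hf. induction n.
- exists (fun _ => f 0), (dquot f 0 (Cderive f 0)). split. apply entire_dquot, Hf.
  intros z. rewrite sum_O. simpl. pose proof (dquot_mult f 0 (Cderive f 0) z) as E.
  replace (z * 1) with (z - 0) by ring. rewrite <- E. ring.
- destruct IHn as [a [h [Hh E]]].
  exists (fun k => if Nat.leb k n then a k else h 0), (dquot h 0 (Cderive h 0)).
  split. apply entire_dquot, Hh. intros z. rewrite sum_Sn, E.
  rewrite (sum_n_ext_loc (fun k => (if Nat.leb k n then a k else h 0) * z ^ k) (fun k => a k * z ^ k)).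
  2:{ intros k Hk. apply Nat.leb_le in Hk. rewrite Hk. reflexivity. }
  replace (Nat.leb (S n) n) with false by (symmetry; apply Nat.leb_gt; lia).
  change (plus ?x ?y) with (Cplus x y).
  pose proof (dquot_mult h 0 (Cderive h 0) z) as E2.
  replace (z ^ S (S n) * dquot h 0 (Cderive h 0) z) with (z ^ S n * ((z - 0) * dquot h 0 (Cderive h 0) z)).
  2:{ rewrite (Cpow_S z (S n)). ring. }
  rewrite <- E2. ring.
Qed.

Lemma polynomial_bound (a : nat -> C) n : exists A, (0 <= A)%R /\ forall u, (1 <= Cmod u)%R ->
  (Cmod (sum_n (fun k => (a k * u ^ k)%C) n) <= A * Cmod u ^ n)%R.
Proof.
induction n.
- exists (Cmod (a 0%nat)). split. apply Cmod_ge_0. intros u _. rewrite sum_O. simpl.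
  rewrite Cmult_1_r. lra.
- destruct IHn as [A [HA H]]. exists (A + Cmod (a (S n)))%R. split.
  pose proof (Cmod_ge_0 (a (S n))). lra.
  intros u Hu. rewrite sum_Sn. change (plus ?x ?y) with (Cplus x y).
  eapply Rle_trans. apply Cmod_triangle. rewrite Cmod_mult, Cmod_pow.
  specialize (H u Hu). assert (0 < Cmod u ^ n)%R by (apply pow_lt; lra). simpl.
  assert (A * Cmod u ^ n <= A * (Cmod u * Cmod u ^ n))%R by (apply Rmult_le_compat_l; nra). lra.
Qed.

(** If [|f u| <= R ^ k] held for all [|u| <= R] and all large [R], the factor [h]
    of the Taylor remainder [z ^ S k * h z] would tend to 0 on large circles, so
    [h] would vanish by Cauchy's estimate and [f] would be a polynomial. *)
Lemma nonpolynomial_growth f : entire f -> ~ polynomial_function f ->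
  forall (k : nat) (R0 : R), exists (R : R) (p : C), (R0 <= R)%R /\ (Cmod p <= R)%R /\ (R ^ k < Cmod (f p))%R.
Proof.
intros Hf Hp k R0. apply NNPP. intros Hno. apply Hp.
destruct (entire_taylor f k Hf) as [a [h [Hh E]]].
exists k, a. intros z. rewrite E.
enough (Ez : h z = 0) by (rewrite Ez; ring).
destruct (polynomial_bound a k) as [A [HA HP]].
apply Cmod_eq_0, Rle_antisym; [|apply Cmod_ge_0].
apply le_epsilon. intros eps He. rewrite Rplus_0_l.
assert (Hq : (0 < (1 + A) / eps)%R) by (apply Rdiv_lt_0_compat; lra).
pose proof (Cmod_ge_0 z) as Hz0.
set (rho := (Rmax 1 R0 + Cmod z + (1 + A) / eps)%R).
assert (H1 : (1 <= rho)%R) by (unfold rho; pose proof (Rmax_l 1 R0); lra).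
assert (H2 : (R0 <= rho)%R) by (unfold rho; pose proof (Rmax_r 1 R0); lra).
assert (H3 : ((1 + A) / eps <= rho - Cmod z)%R) by (unfold rho; pose proof (Rmax_l 1 R0); lra).
assert (B : (Cmod (h z) <= rho * ((1 + A) / rho) / (rho - Cmod (z - 0)))%R).
{ apply entire_cauchy_estimate. exact Hh. unfold in_ball. replace (z - 0) with z by ring. lra.
  intros u Hu. replace (u - 0) with u in Hu by ring.
  assert (Hfu : (Cmod (f u) <= rho ^ k)%R).
  { apply Rnot_lt_le. intros Hlt. apply Hno. exists rho, u. repeat split; lra. }
  specialize (HP u ltac:(lra)). rewrite Hu in HP.
  assert (Hpk : (0 < rho ^ k)%R) by (apply pow_lt; lra).
  assert (Hm : (Cmod (u ^ S k * h u) <= (1 + A) * rho ^ k)%R).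
  { replace (u ^ S k * h u) with (f u + - sum_n (fun k => a k * u ^ k) k) by (rewrite E; ring).
    eapply Rle_trans. apply Cmod_triangle. rewrite Cmod_opp. lra. }
  rewrite Cmod_mult, Cmod_pow, Hu in Hm. simpl in Hm.
  apply Rle_div_r. lra. nra. }
replace (z - 0) with z in B by ring.
replace (rho * ((1 + A) / rho))%R with (1 + A)%R in B by (field; lra).
eapply Rle_trans. exact B. apply Rle_div_l. lra.
apply Rle_div_l in H3; lra.
Qed.

Fixpoint root_product (L : list C) (u : C) : C :=
  match L with
  | nil => 1
  | cons a L' => (u - a) * root_product L' u
  end.

Lemma root_product_entire L : entire (root_product L).
Proof.
induction L; simpl.
- intros z. exists (RtoC 0). apply is_derive_Cconst.
- apply (entire_mult (fun u => u - a)); [|exact IHL].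
  apply (entire_minus_const (fun u => u)). intros z. exists (RtoC 1). apply is_derive_Cid.
Qed.

(** Zeros in a disc are divided out one at a time until [N] of them are
    collected or none is left. *)
Lemma divide_out_zeros N (c : C) (r : R) g : entire g -> exists (L : list C) (h : C -> C),
  entire h /\ (forall u, g u = root_product L u * h u) /\
  (forall z, In z L -> in_ball c r z /\ g z = 0) /\
  (length L = N \/ ((length L < N)%nat /\ forall z, in_ball c r z -> h z <> 0)).
Proof.
intros Hg. induction N.
- exists nil, g. repeat split; try easy. intros u. simpl. ring. left. reflexivity.
- destruct IHN as [L [h [Hh [E [HL Hor]]]]].
  destruct Hor as [Hlen|[Hlen Hnz]].
  2:{ exists L, h. repeat split; try assumption; try (apply HL; assumption). right. split. lia. exact Hnz. }
  destruct (classic (exists z, in_ball c r z /\ h z = 0)) as [[z [Hz Hz0]]|Hno].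
  + exists (z :: L), (dquot h z (Cderive h z)). split. apply entire_dquot, Hh. split; [|split].
    * intros u. simpl. rewrite E. pose proof (dquot_mult h z (Cderive h z) u) as E2.
      rewrite Hz0 in E2. replace (h u) with (h u - 0) by ring. rewrite E2. ring.
    * intros w [<-|Hw]. split. exact Hz. rewrite E, Hz0. ring. apply HL, Hw.
    * left. simpl. lia.
  + exists L, h. repeat split; try assumption; try (apply HL; assumption). right. split. lia.
    intros z Hz H0. apply Hno. exists z. auto.
Qed.

Lemma root_product_split L z u :
  root_product L u = (u - z) ^ count_occ Ceq_dec L z * root_product (remove Ceq_dec z L) u.
Proof.
induction L as [|a L IH]; simpl. ring.
rewrite IH. destruct (Ceq_dec a z) as [->|n].
- destruct (Ceq_dec z z); [|congruence]. simpl. ring.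
- destruct (Ceq_dec z a); [congruence|]. simpl. ring.
Qed.

Lemma sum_count_occ (L l : list C) : NoDup l -> incl L l ->
  (length L <= list_sum (map (count_occ Ceq_dec L) l))%nat.
Proof.
intros Hl. induction L as [|a L IH]; intros Hi. simpl; lia.
assert (Hi' : incl L l) by (intros x Hx; apply Hi; right; exact Hx).
assert (Ha : In a l) by (apply Hi; left; reflexivity).
specialize (IH Hi'). simpl length.
apply Nat.le_trans with (S (list_sum (map (count_occ Ceq_dec L) l))). lia.
clear IH Hi Hi' Hl. induction l as [|x l IHl]. easy.
assert (Hmono : (list_sum (map (count_occ Ceq_dec L) l) <= list_sum (map (count_occ Ceq_dec (a :: L)) l))%nat).
{ clear. induction l as [|x l IH]; simpl. lia. simpl in IH. destruct (Ceq_dec a x); lia. }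
destruct Ha as [->|Ha].
- simpl in *. destruct (Ceq_dec a a); [lia|congruence].
- specialize (IHl Ha). simpl in *. destruct (Ceq_dec a x); lia.
Qed.

Lemma multiplicity_of_factor f w z m q : entire q -> q z <> 0 ->
  (forall u, f u - w = (u - z) ^ m * q u) -> multiplicity f w z m.
Proof.
intros Hq Hz E. exists q. split; [|split].
- apply locally_C_iff. exists 1%R. split. lra. intros u _. apply Hq.
- exact Hz.
- apply locally_C_iff. exists 1%R. split. lra. intros u _. apply E.
Qed.

(** The order of [f - w] at a listed zero is the number of its occurrences in [L]
    plus the order of the remaining factor, so the multiplicities add up to at
    least the length of [L]. *)
Lemma at_least_preimages_of_factor f V w L h : entire f -> entire h -> (exists u, f u - w <> 0) ->
  (forall u, f u - w = root_product L u * h u) ->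
  (forall z, In z L -> V z /\ f z = w) ->
  at_least_preimages f V w (length L).
Proof.
intros Hf Hh [u0 Hu0] E HL.
assert (Hm : forall z, exists m : nat, (count_occ Ceq_dec L z <= m)%nat /\ multiplicity f w z m).
{ intros z.
  destruct (entire_order (fun u => root_product (remove Ceq_dec z L) u * h u) z) as [m [q [Hq [Hqz Eq]]]].
  - apply entire_mult; [apply root_product_entire|exact Hh].
  - exists u0. intros H0. apply Hu0. rewrite E, (root_product_split L z).
    rewrite <- Cmult_assoc, H0. ring.
  - exists (count_occ Ceq_dec L z + m)%nat. split. lia.
    apply (multiplicity_of_factor f w z _ q Hq Hqz). intros u.
    rewrite E, (root_product_split L z), <- Cmult_assoc, Eq, Cpow_add_r. ring. }
assert (Hc : exists m : C -> nat, forall z,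
  (count_occ Ceq_dec L z <= m z)%nat /\ multiplicity f w z (m z)).
{ exists (fun z => proj1_sig (constructive_indefinite_description _ (Hm z))).
  intros z. apply proj2_sig. }
destruct Hc as [m Hm'].
exists (nodup Ceq_dec L), m.
split; [apply NoDup_nodup|split].
- intros z Hz. apply nodup_In in Hz. destruct (HL z Hz) as [HV Hw]. split; [exact HV|split; [exact Hw|]].
  apply Hm'.
- eapply Nat.le_trans. apply (sum_count_occ L (nodup Ceq_dec L)). apply NoDup_nodup.
  intros x Hx. apply nodup_In, Hx.
  generalize (nodup Ceq_dec L). induction l as [|x l IHl]; simpl. lia.
  destruct (Hm' x) as [Hx _]. lia.
Qed.

(** * Bloch's theorem *)

(** Moving from [p] by the small multiple [- s * v / a] of the Newton step, with
    [v = Phi p - w], shrinks [v] by the factor [1 - s] to first order. *)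
Lemma descend_modulus (Phi : C -> C) (p a w : C) : is_derive Phi p a -> a <> 0 -> Phi p <> w ->
  forall del, (0 < del)%R ->
  exists u, (Cmod (u - p) < del)%R /\ (Cmod (Phi u - w) < Cmod (Phi p - w))%R.
Proof.
intros HP Ha Hw del Hdel.
set (v := Phi p - w). assert (Hv : v <> 0) by (apply Cminus_eq_contra, Hw).
assert (Hv' : (0 < Cmod v)%R) by (apply Cmod_gt_0, Hv).
assert (Ha' : (0 < Cmod a)%R) by (apply Cmod_gt_0, Ha).
destruct (proj1 (is_derive_C_iff _ _ _) HP (Cmod a / 2)%R ltac:(lra)) as [d [Hd Hd']].
set (k := (Cmod v / Cmod a)%R). assert (Hk : (0 < k)%R) by (apply Rdiv_lt_0_compat; lra).
set (m := Rmin del d). assert (Hm : (0 < m)%R) by (apply Rmin_pos; assumption).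
set (s := (m / (k + m))%R).
assert (Hkm : (0 < k + m)%R) by lra.
assert (Hs : (0 < s)%R) by (apply Rdiv_lt_0_compat; lra).
assert (Hs1 : (s < 1)%R) by (apply Rlt_div_l; lra).
assert (Hsk : (s * k < m)%R).
{ unfold s. replace (m / (k + m) * k)%R with (m * (k / (k + m)))%R by (field; lra).
  assert (k / (k + m) < 1)%R by (apply Rlt_div_l; lra). nra. }
assert (Ed : Cmod (p + - (s * (v / a)) - p) = (s * k)%R).
{ replace (p + - (s * (v / a)) - p) with (- (s * (v / a))) by ring.
  rewrite Cmod_opp, Cmod_mult, Cmod_R, Rabs_pos_eq, Cmod_div by (assumption || lra). reflexivity. }
exists (p + - (s * (v / a))). split.
- rewrite Ed. apply Rlt_le_trans with m. exact Hsk. apply Rmin_l.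
- assert (Hlt : (Cmod (p + - (s * (v / a)) - p) < d)%R).
  { rewrite Ed. apply Rlt_le_trans with m. exact Hsk. apply Rmin_r. }
  specialize (Hd' _ Hlt). rewrite Ed in Hd'. set (u := p + - (s * (v / a))) in *.
  replace (Phi u - w) with ((Phi u - Phi p - a * (u - p)) + (1 - s)%R * v).
  2:{ unfold u, v. rewrite RtoC_minus. field. exact Ha. }
  eapply Rle_lt_trans. apply Cmod_triangle. rewrite Cmod_mult, Cmod_R, Rabs_pos_eq by lra.
  assert (E : (Cmod a / 2 * (s * k) = s * Cmod v / 2)%R) by (unfold k; field; lra).
  rewrite E in Hd'. nra.
Qed.

(** [Phi] differs from an affine map by a map of Lipschitz constant at most half
    of [|dPhi p|], which keeps the minimum of [|Phi - w|] off the boundary; at an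
    interior minimum the modulus could still be decreased unless it is zero. *)
Lemma covers_disc (Phi dPhi : C -> C) (p w : C) (t t' : R) : (0 < t)%R -> (t < t')%R ->
  (forall u, in_ball p t' u -> is_derive Phi u (dPhi u)) -> cont_on dPhi p t' ->
  (forall u, closed_ball p t u -> (Cmod (dPhi u - dPhi p) <= Cmod (dPhi p) / 2)%R) ->
  (Cmod (w - Phi p) < Cmod (dPhi p) * t / 4)%R ->
  exists u, closed_ball p t u /\ Phi u = w.
Proof.
intros Ht Ht' HP Hc Hd Hw. set (a := dPhi p) in *.
assert (Ha : (0 < Cmod a)%R) by (pose proof (Cmod_ge_0 (w - Phi p)); nra).
assert (Ha0 : a <> 0) by (apply Cmod_gt_0, Ha).
assert (Hsub : forall u, closed_ball p t u -> in_ball p t' u) by (unfold closed_ball, in_ball; intros; lra).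
assert (Hpp : closed_ball p t p) by (unfold closed_ball; rewrite Cmod_self; lra).
destruct (closed_ball_max (fun u => - Cmod (Phi u - w))%R p t) as [q [Hq Hmin]].
{ lra. }
{ intros u Hu eps He.
  destruct (cont_closed_Cmod (fun v => Phi v - w) p t) with (z := u) (eps := eps) as [d [Hd1 Hd2]]; auto.
  - intros v Hv. eapply is_derive_C_continuous.
    apply (is_derive_Cminus Phi (fun _ => w)). apply HP, Hsub, Hv. apply is_derive_Cconst.
  - exists d. split. exact Hd1. intros v Hv Hvu. specialize (Hd2 v Hv Hvu).
    rewrite <- Rabs_Ropp. eapply Rle_lt_trans; [right|exact Hd2]. f_equal. ring. }
exists q. split. exact Hq. apply NNPP. intros Hne.
assert (Hqi : (Cmod (q - p) < t)%R).
{ apply Rnot_le_lt. intros Hge.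
  assert (Eq : Cmod (q - p) = t) by (unfold closed_ball in Hq; lra).
  assert (K : (Cmod ((Phi q - a * q) - (Phi p - a * p)) <= Cmod a / 2 * Cmod (q - p))%R).
  { apply (mvt_ball (fun u => Phi u - a * u) (fun u => dPhi u - a) p t').
    - intros u Hu. apply is_derive_Cminus. apply HP, Hu.
      replace a with (a * 1) at 2 by ring. apply is_derive_Cscal, is_derive_Cid.
    - intros u Hu. apply continuous_C_iff. intros eps He.
      destruct (proj1 (continuous_C_iff _ _) (Hc u Hu) eps He) as [d [Hd1 Hd2]].
      exists d. split. exact Hd1. intros v Hv.
      replace (dPhi v - a - (dPhi u - a)) with (dPhi v - dPhi u) by ring. apply Hd2, Hv.
    - apply Hsub, Hpp.
    - apply Hsub, Hq.
    - intros s Hs. apply Hd. unfold closed_ball. apply segment_dist; [exact Hs|exact Hpp|exact Hq]. }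
  rewrite Eq in K.
  assert (K2 : (Cmod a * t <= Cmod (Phi q - Phi p) + Cmod a / 2 * t)%R).
  { rewrite <- Eq at 1. rewrite <- Cmod_mult.
    replace (a * (q - p)) with ((Phi q - Phi p) + - (Phi q - a * q - (Phi p - a * p))) by ring.
    eapply Rle_trans. apply Cmod_triangle. rewrite Cmod_opp. lra. }
  pose proof (Cmod_tri3 (Phi q) w (Phi p)).
  specialize (Hmin p Hpp). rewrite (Cmod_sym (Phi p)) in Hmin. lra. }
destruct (descend_modulus Phi q (dPhi q) w) with (del := (t - Cmod (q - p))%R) as [u [Hu1 Hu2]].
- apply HP, Hsub, Hq.
- intros H0. specialize (Hd q Hq). rewrite H0 in Hd.
  replace (0 - a) with (- a) in Hd by ring. rewrite Cmod_opp in Hd. lra.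
- exact Hne.
- lra.
- assert (Hu : closed_ball p t u). { unfold closed_ball. pose proof (Cmod_tri3 u q p). lra. }
  specialize (Hmin u Hu). lra.
Qed.

(** At a maximum [p] of [|H'(z)| (r1 - |z - z0|)] the derivative at most doubles
    on a disc whose radius is comparable with the distance to the boundary, so
    [H] is nearly affine near [p] and covers a disc of size comparable with the
    maximum. *)
Theorem bloch (H dH : C -> C) (z0 : C) (r rho : R) : (0 < r)%R -> (0 < rho)%R ->
  (forall z, in_ball z0 r z -> is_derive H z (dH z)) ->
  (forall w, exists v, (Cmod (v - w) < rho)%R /\ forall z, in_ball z0 r z -> H z <> v) ->
  (Cmod (dH z0) <= 256 * rho / r)%R.
Proof.
intros Hr Hrho HH Hom.
(* [H] is holomorphic on a neighbourhood of the closed disc of radius [r1] *)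
set (r1 := (r / 2)%R).
pose proof (holo_derive H dH z0 r HH) as Hd.
pose proof (holo_cont_on _ _ _ Hd) as Hdc.
destruct (closed_ball_max (fun z => Cmod (dH z) * (r1 - Cmod (z - z0)))%R z0 r1) as [p [Hp Hmax]].
{ unfold r1; lra. }
{ intros z Hz eps He.
  assert (Hzr : in_ball z0 r z) by (unfold closed_ball, in_ball, r1 in *; lra).
  set (k := (Cmod (dH z) + 1)%R). assert (Hk : (0 < k)%R) by (unfold k; pose proof (Cmod_ge_0 (dH z)); lra).
  assert (Hq1 : (0 < eps / (2 * r))%R) by (apply Rdiv_lt_0_compat; lra).
  assert (Hq2 : (0 < eps / (2 * k))%R) by (apply Rdiv_lt_0_compat; lra).
  destruct (proj1 (continuous_C_iff _ _) (Hdc z Hzr) (eps / (2 * r))%R Hq1) as [d [Hd1 Hd2]].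
  exists (Rmin d (eps / (2 * k))). split. apply Rmin_pos; assumption.
  intros u Hu Huz.
  assert (A1 : (Cmod (u - z) < d)%R) by (eapply Rlt_le_trans; [exact Huz|apply Rmin_l]).
  assert (A2 : (Cmod (u - z) < eps / (2 * k))%R) by (eapply Rlt_le_trans; [exact Huz|apply Rmin_r]).
  specialize (Hd2 u A1).
  apply Rlt_div_r in A2; [|lra]. apply Rlt_div_r in Hd2; [|lra].
  set (x := Cmod (dH u)) in *. set (y := Cmod (dH z)) in *.
  set (s := Cmod (u - z0)). set (s' := Cmod (z - z0)).
  assert (B1 : (Rabs (x - y) <= Cmod (dH u - dH z))%R).
  { apply Rabs_le. pose proof (Cmod_tri_inv (dH u) (dH z)). pose proof (Cmod_tri_inv (dH z) (dH u)) as B.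
    rewrite (Cmod_sym (dH z)) in B. unfold x, y. lra. }
  assert (B2 : (Rabs (s' - s) <= Cmod (u - z))%R).
  { apply Rabs_le. pose proof (Cmod_tri3 u z z0). pose proof (Cmod_tri3 z u z0) as B.
    rewrite (Cmod_sym z u) in B. unfold s, s'. lra. }
  replace (x * (r1 - s) - y * (r1 - s'))%R with ((x - y) * (r1 - s) + y * (s' - s))%R by ring.
  eapply Rle_lt_trans. apply Rabs_triang. rewrite !Rabs_mult.
  assert (B3 : (Rabs (r1 - s) <= r)%R).
  { apply Rabs_le. unfold closed_ball in Hu. fold s in Hu. assert (0 <= s)%R by apply Cmod_ge_0. unfold r1 in *. lra. }
  assert (B4 : (Rabs y < k)%R).
  { unfold y, k. rewrite Rabs_pos_eq. unfold y. lra. apply Cmod_ge_0. }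
  pose proof (Rabs_pos (x - y)). pose proof (Rabs_pos (s' - s)). pose proof (Rabs_pos y). pose proof (Rabs_pos (r1 - s)).
  assert (C1 : (Rabs (x - y) * Rabs (r1 - s) <= Cmod (dH u - dH z) * r)%R) by (apply Rmult_le_compat; lra).
  assert (C2 : (Rabs y * Rabs (s' - s) <= k * Cmod (u - z))%R) by (apply Rmult_le_compat; lra).
  lra. }
set (a := dH p) in *. set (t := ((r1 - Cmod (p - z0)) / 2)%R).
assert (Hz0 : closed_ball z0 r1 z0) by (unfold closed_ball; rewrite Cmod_self; unfold r1; lra).
pose proof (Hmax z0 Hz0) as Hm0. rewrite Cmod_self, Rminus_0_r in Hm0.
apply Rnot_lt_le. intros Hbig.
apply Rlt_div_l in Hbig; [|exact Hr].
assert (Hm : (128 * rho < Cmod a * (2 * t))%R).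
{ unfold t. replace (2 * ((r1 - Cmod (p - z0)) / 2))%R with (r1 - Cmod (p - z0))%R by field.
  unfold r1 in *. lra. }
unfold closed_ball in Hp.
assert (Ht : (0 < t)%R). { assert (0 <= t)%R by (unfold t; lra). pose proof (Cmod_ge_0 a). nra. }
assert (Ha : (0 < Cmod a)%R) by (pose proof (Cmod_ge_0 a); nra).
assert (Hball : forall u, (Cmod (u - p) < 2 * t)%R -> in_ball z0 r u).
{ intros u Hu. unfold in_ball. pose proof (Cmod_tri3 u p z0). unfold t, r1 in *. lra. }
assert (Hdbl : forall u, (Cmod (u - p) <= t)%R -> (Cmod (dH u) <= 2 * Cmod a)%R).
{ intros u Hu. pose proof (Cmod_tri3 u p z0).
  assert (Hu1 : closed_ball z0 r1 u) by (unfold closed_ball, t in *; lra).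
  specialize (Hmax u Hu1).
  assert (E : (r1 - Cmod (p - z0) = 2 * t)%R) by (unfold t; field). rewrite E in Hmax.
  pose proof (Cmod_ge_0 (dH u)).
  assert (t <= r1 - Cmod (u - z0))%R by lra.
  assert (Cmod (dH u) * t <= Cmod a * (2 * t))%R by nra. nra. }
assert (Hd2 : forall u, (Cmod (u - p) <= t / 2)%R -> (Cmod (Cderive dH u) <= 8 * Cmod a / t)%R).
{ intros u Hu. replace (8 * Cmod a / t)%R with (2 * (2 * Cmod a) / (t / 2))%R by (field; lra).
  apply (cauchy_derive_estimate dH u t).
  - intros v Hv. apply Hd, Hball. unfold in_ball in Hv. pose proof (Cmod_tri3 v u p). lra.
  - lra.
  - lra.
  - apply Cderive_correct, Hd, Hball. lra.
  - intros v Hv. apply Hdbl. pose proof (Cmod_tri3 v u p). lra. }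
(* on radius [t / 16] the bound on the second derivative lets [dH] vary by at
   most [|a| / 2], and the disc covered has radius [|a| * t / 64 > rho] *)
destruct (Hom (H p)) as [v [Hv Hv']].
destruct (covers_disc H dH p v (t / 16) t) as [u [Hu Hu']].
- lra.
- lra.
- intros u Hu. apply HH, Hball. unfold in_ball in Hu. lra.
- intros u Hu. apply Hdc, Hball. unfold in_ball in Hu. lra.
- intros u Hu. unfold closed_ball in Hu. fold a.
  apply Rle_trans with (8 * Cmod a / t * Cmod (u - p))%R.
  + apply (mvt_ball dH (Cderive dH) p t).
    * intros w Hw. apply Cderive_correct, Hd, Hball. unfold in_ball in Hw. lra.
    * apply holo_cont_on, holo_Cderive. intros w Hw. apply Hd, Hball. unfold in_ball in Hw. lra.
    * unfold in_ball. rewrite Cmod_self. exact Ht.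
    * unfold in_ball. lra.
    * intros s Hs. apply Hd2. apply segment_dist; [exact Hs| |lra]. rewrite Cmod_self. lra.
  + replace (Cmod a / 2)%R with (8 * Cmod a / t * (t / 16))%R by (field; lra).
    apply Rmult_le_compat_l; [|exact Hu]. apply Rdiv_le_0_compat; lra.
- fold a. lra.
- apply (Hv' u); [|exact Hu']. apply Hball. unfold closed_ball in Hu. lra.
Qed.

(** * Logarithms *)

Lemma exists_log (w : C) : w <> 0 ->
  exists l, cexp l = w /\ Re l = ln (Cmod w) /\ (Rabs (Im l) <= PI)%R.
Proof.
intros Hw. assert (Hm : (0 < Cmod w)%R) by (apply Cmod_gt_0, Hw).
set (m := Cmod w) in *. destruct w as [a b].
set (x := (a / m)%R). set (y := (b / m)%R).
assert (Exy : (x * x + y * y = 1)%R).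
{ pose proof (Cmod2_alt (a, b)) as E. simpl Re in E. simpl Im in E. fold m in E.
  unfold x, y. replace (a / m * (a / m) + b / m * (b / m))%R with ((a ^ 2 + b ^ 2) / m ^ 2)%R by (field; lra).
  assert (E' : (m ^ 2 = a ^ 2 + b ^ 2)%R).
  { exact E. }
  rewrite <- E'. field. lra. }
assert (Hx : (-1 <= x <= 1)%R) by nra.
pose proof (acos_bound x) as Hb.
assert (Hs : sin (acos x) = Rabs y).
{ rewrite sin_acos by exact Hx. rewrite <- sqrt_Rsqr_abs. f_equal. unfold Rsqr. lra. }
assert (Ea : (m * x = a)%R) by (unfold x; field; lra).
assert (Eb : (m * y = b)%R) by (unfold y; field; lra).
destruct (Rle_lt_dec 0 y) as [Hy|Hy].
- exists (ln m, acos x). split; [|split].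
  + unfold cexp; simpl. rewrite exp_ln by exact Hm. rewrite cos_acos by exact Hx.
    rewrite Hs, Rabs_pos_eq by exact Hy. rewrite Ea, Eb. reflexivity.
  + reflexivity.
  + simpl. rewrite Rabs_pos_eq; lra.
- exists (ln m, - acos x)%R. split; [|split].
  + unfold cexp; simpl. rewrite exp_ln by exact Hm. rewrite cos_neg, sin_neg, cos_acos by exact Hx.
    rewrite Hs, Rabs_left by exact Hy. rewrite Ropp_involutive, Ea, Eb. reflexivity.
  + reflexivity.
  + simpl. rewrite Rabs_Ropp, Rabs_pos_eq; lra.
Qed.

(** A primitive of [g' / g], normalised at the centre: the product of [g] and the
    exponential of its negative has derivative zero. *)
Lemma holo_log g c r l : (0 < r)%R -> holo g c r -> (forall z, in_ball c r z -> g z <> 0) ->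
  cexp l = g c ->
  exists L, holo L c r /\ L c = l /\ forall z, in_ball c r z -> cexp (L z) = g z.
Proof.
intros Hr Hg Hnz Hl.
assert (Hc : in_ball c r c) by (unfold in_ball; rewrite Cmod_self; exact Hr).
assert (Hq : holo (fun z => Cderive g z * / g z) c r).
{ intros z Hz. destruct (holo_Cderive g c r Hg z Hz) as [a Ha]. destruct (Hg z Hz) as [b Hb].
  eexists. apply is_derive_Cmult. exact Ha. apply (is_derive_Ccomp Cinv g).
  apply is_derive_Cinv, Hnz, Hz. exact Hb. }
destruct (holo_primitive _ c r Hr Hq) as [P HP].
set (L := fun z => P z + (l - P c)).
assert (HL : forall z, in_ball c r z -> is_derive L z (Cderive g z * / g z)).
{ intros z Hz. unfold L. replace (Cderive g z * / g z) with (Cderive g z * / g z + 0) by ring.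
  apply is_derive_Cplus. apply HP, Hz. apply is_derive_Cconst. }
assert (ELc : L c = l) by (unfold L; ring).
exists L. split; [|split].
- intros z Hz. eexists. apply HL, Hz.
- exact ELc.
- intros z Hz.
  assert (E : g z * cexp (0 - L z) = g c * cexp (0 - L c)).
  { apply (derive_0_const (fun u => g u * cexp (0 - L u)) c r); try assumption.
    intros u Hu. pose proof (Hnz u Hu) as Hn.
    assert (Hd : is_derive (fun u => g u * cexp (0 - L u)) u
      (Cderive g u * cexp (0 - L u) + g u * (cexp (0 - L u) * (0 - Cderive g u * / g u)))).
    { apply (is_derive_Cmult g (fun u => cexp (0 - L u))). apply Cderive_correct, Hg, Hu.
      apply (is_derive_Ccomp cexp (fun u => 0 - L u)). apply is_derive_cexp.
      apply (is_derive_Cminus (fun _ => RtoC 0) L). apply is_derive_Cconst. apply HL, Hu. }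
    replace (Cderive g u * cexp (0 - L u) + g u * (cexp (0 - L u) * (0 - Cderive g u * / g u)))
      with (RtoC 0) in Hd by (field; exact Hn).
    exact Hd. }
  replace (0 - L z) with (- L z) in E by ring. replace (0 - L c) with (- L c) in E by ring.
  rewrite !cexp_opp, ELc, Hl in E. pose proof (cexp_nz (L z)) as N1. pose proof (Hnz c Hc) as N2.
  replace (g z) with (cexp (L z) * (g z * / cexp (L z))) by (field; exact N1).
  rewrite E. field. exact N2.
Qed.

Lemma holo_sqrt g c r : (0 < r)%R -> holo g c r -> (forall z, in_ball c r z -> g z <> 0) ->
  exists P, holo P c r /\ forall z, in_ball c r z -> P z * P z = g z.
Proof.
intros Hr Hg Hnz.
assert (Hc : in_ball c r c) by (unfold in_ball; rewrite Cmod_self; exact Hr).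
destruct (exists_log (g c) (Hnz c Hc)) as [l [Hl _]].
destruct (holo_log g c r l Hr Hg Hnz Hl) as [L [HL [_ EL]]].
exists (fun z => cexp (/ 2 * L z)). split.
- intros z Hz. destruct (HL z Hz) as [a Ha]. eexists.
  apply (is_derive_Ccomp cexp (fun z => / 2 * L z)). apply is_derive_cexp.
  apply is_derive_Cscal, Ha.
- intros z Hz. rewrite <- cexp_plus, <- EL by exact Hz. f_equal. field.
Qed.

(** * Schottky's theorem *)

Lemma cexp_2PIi_Z (k : Z) : cexp (2 * PI * Ci * IZR k) = 1.
Proof.
assert (Hn : forall n : nat, cexp (2 * PI * Ci * INR n) = 1).
{ intros n. unfold cexp.
  replace (Re (2 * PI * Ci * INR n)) with 0%R by (simpl; ring).
  replace (Im (2 * PI * Ci * INR n)) with (0 + 2 * INR n * PI)%R by (simpl; ring).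
  rewrite exp_0, cos_period, sin_period, cos_0, sin_0.
  apply injective_projections; simpl; ring. }
destruct (Z_le_gt_dec 0 k) as [Hk|Hk].
- rewrite <- (Z2Nat.id k Hk), <- INR_IZR_INZ. apply Hn.
- replace (2 * PI * Ci * IZR k) with (- (2 * PI * Ci * INR (Z.to_nat (- k)))).
  + rewrite cexp_opp, Hn. field.
  + rewrite INR_IZR_INZ, Z2Nat.id by lia. rewrite opp_IZR, RtoC_opp. ring.
Qed.

Lemma exp_mono x y : (x <= y)%R -> (exp x <= exp y)%R.
Proof.
intros [H|H]. left; apply exp_increasing, H. rewrite H. right; reflexivity.
Qed.

Definition Ccosh (z : C) : C := (cexp z + cexp (- z)) / 2.

Lemma Ccosh_plus_PIi (t : R) (k : Z) :
  Ccosh (t + PI * Ci * IZR k) * Ccosh (t + PI * Ci * IZR k) = Ccosh t * Ccosh t.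
Proof.
unfold Ccosh. set (e := cexp (PI * Ci * IZR k)).
assert (He : e * e = 1).
{ unfold e. rewrite <- cexp_plus, <- (cexp_2PIi_Z k). f_equal. ring. }
assert (Hen : e <> 0) by apply cexp_nz.
rewrite !cexp_opp, !cexp_plus. fold e. pose proof (cexp_nz t) as Ht.
assert (E : / e = e).
{ replace (/ e) with (/ e * (e * e)) by (rewrite He; ring). field. exact Hen. }
replace (/ (cexp t * e)) with (/ cexp t * / e) by (field; split; assumption).
rewrite E.
replace ((cexp t * e + / cexp t * e) / 2 * ((cexp t * e + / cexp t * e) / 2)) with
  ((e * e) * ((cexp t + / cexp t) / 2 * ((cexp t + / cexp t) / 2))) by (field; exact Ht).
rewrite He. ring.
Qed.

Lemma cexp_R (x : R) : cexp x = RtoC (exp x).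
Proof.
unfold cexp; simpl. rewrite cos_0, sin_0. apply injective_projections; simpl; ring.
Qed.

Lemma Ccosh_R (t : R) : Ccosh t = RtoC (cosh t).
Proof.
unfold Ccosh, cosh. rewrite <- RtoC_opp, !cexp_R, RtoC_div, RtoC_plus by lra. reflexivity.
Qed.

Lemma cosh_sqr_step x : (0 <= x)%R ->
  (cosh x * cosh x + 1 <= cosh (x + 2) * cosh (x + 2))%R.
Proof.
intros Hx. unfold cosh.
assert (E1 : (exp x * exp (- x) = 1)%R) by (rewrite <- exp_plus, Rplus_opp_r, exp_0; reflexivity).
assert (E2 : (exp 2 * exp (- 2) = 1)%R) by (rewrite <- exp_plus, Rplus_opp_r, exp_0; reflexivity).
replace (- (x + 2))%R with (- x + - 2)%R by ring. rewrite !exp_plus.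
assert (Ha : (1 <= exp x)%R). { pose proof (exp_ineq1_le x). lra. }
assert (Hb : (3 < exp 2)%R). { pose proof (exp_ineq1 2 ltac:(lra)). lra. }
pose proof (exp_pos (- x)). pose proof (exp_pos (- 2)).
set (a := exp x) in *. set (b := exp 2) in *. set (a' := exp (- x)) in *. set (b' := exp (- 2)) in *.
assert (Ha' : (a' <= 1)%R) by nra.
assert (K : (a * a + a' * a' + 4 <= (a * b) * (a * b) + (a' * b') * (a' * b'))%R).
{ assert (8 * (a * a) <= (a * b) * (a * b) - a * a)%R.
  { replace ((a * b) * (a * b) - a * a)%R with ((b * b - 1) * (a * a))%R by ring.
    apply Rmult_le_compat_r; nra. }
  assert (1 <= a * a)%R by nra. assert (a' * a' <= 1)%R by nra.
  assert (0 <= (a' * b') * (a' * b'))%R by nra. lra. }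
replace ((a + a') / 2 * ((a + a') / 2) + 1)%R with ((a * a + a' * a' + 2 * (a * a') + 4) / 4)%R by field.
replace ((a * b + a' * b') / 2 * ((a * b + a' * b') / 2))%R with
 (((a * b) * (a * b) + (a' * b') * (a' * b') + 2 * ((a * a') * (b * b'))) / 4)%R by field.
rewrite E1, E2. lra.
Qed.

(** [cosh ^ 2] gains at least 1 over an interval of length 2 of the positive
    half-line, and so takes an integer value there. *)
Lemma cosh_sqr_integer x : exists (t : R) (n : Z),
  (Rabs (t - x) <= 2)%R /\ (cosh t * cosh t = IZR n)%R.
Proof.
assert (Hpos : forall x, (0 <= x)%R -> exists (t : R) (n : Z),
  (Rabs (t - x) <= 2)%R /\ (cosh t * cosh t = IZR n)%R).
{ clear x. intros x Hx. pose proof (cosh_sqr_step x Hx) as Hs.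
  destruct (archimed (cosh x * cosh x)) as [A1 A2].
  set (n := up (cosh x * cosh x)) in *.
  destruct (IVT_gen (fun t => cosh t * cosh t)%R x (x + 2) (IZR n)) as [t [Ht Et]].
  - apply derivable_continuous. apply derivable_mult; apply derivable_cosh.
  - rewrite Rmin_left, Rmax_right by lra. lra.
  - rewrite Rmin_left, Rmax_right in Ht by lra.
    exists t, n. split; [|exact Et]. apply Rabs_le. lra. }
destruct (Rle_lt_dec 0 x) as [H|H].
- apply Hpos, H.
- destruct (Hpos (- x)%R ltac:(lra)) as [t [n [H1 H2]]].
  exists (- t)%R, n. split.
  + replace (- t - x)%R with (- (t - - x))%R by ring. rewrite Rabs_Ropp. exact H1.
  + unfold cosh in *. rewrite Ropp_involutive, (Rplus_comm (exp (- t))). exact H2.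
Qed.

(** The points [t + PI * k * i] with [k] an integer and [cosh t ^ 2] an integer
    have this property; the nearest one is at horizontal distance at most 2 and
    vertical distance at most [PI <= 4]. *)
Lemma Ccosh_sqr_integer_near (w : C) : exists (v : C) (n : Z),
  (Cmod (v - w) < 7)%R /\ Ccosh v * Ccosh v = IZR n.
Proof.
destruct w as [x y].
destruct (cosh_sqr_integer x) as [t [n [Ht Hn]]].
pose proof PI_RGT_0 as HPI. pose proof PI_4 as HP4.
destruct (archimed (y / PI)) as [A1 A2]. set (k := up (y / PI)) in *.
exists (t + PI * Ci * IZR k), n. split.
- replace (t + PI * Ci * IZR k - (x, y)) with ((t - x)%R, (PI * IZR k - y)%R)
    by (apply injective_projections; simpl; ring).
  eapply Rle_lt_trans. apply Cmod_le_sum.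
  assert (E : (y = y / PI * PI)%R) by (field; lra).
  assert (Rabs (PI * IZR k - y) <= 4)%R.
  { apply Rabs_le. split.
    - rewrite E. nra.
    - rewrite E. nra. }
  lra.
- rewrite Ccosh_plus_PIi, Ccosh_R, <- RtoC_mult, Hn. reflexivity.
Qed.

(** Landau's lift: a function omitting 0 and 1 factors as [exp (2 pi i cosh^2 H)],
    because its normalised logarithm [L] omits the integers, so that [L] and
    [L - 1] have square roots [P] and [Q], and [P - Q] is invertible. *)
Lemma landau_lift g c r l : (0 < r)%R -> holo g c r ->
  (forall z, in_ball c r z -> g z <> 0) -> (forall z, in_ball c r z -> g z <> 1) ->
  cexp l = g c ->
  exists H, holo H c r /\
    (forall z, in_ball c r z -> cexp (2 * PI * Ci * (Ccosh (H z) * Ccosh (H z))) = g z) /\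
    2 * PI * Ci * (Ccosh (H c) * Ccosh (H c)) = l.
Proof.
intros Hr Hg H0 H1 Hl. pose proof PI2Ci_nz as Hn.
destruct (holo_log g c r l Hr Hg H0 Hl) as [L0 [HL0 [EL0 EL]]].
assert (Hc : in_ball c r c) by (unfold in_ball; rewrite Cmod_self; exact Hr).
set (L := fun z => / (2 * PI * Ci) * L0 z).
assert (HL : holo L c r).
{ intros z Hz. destruct (HL0 z Hz) as [a Ha]. eexists. apply is_derive_Cscal, Ha. }
assert (EL' : forall z, 2 * PI * Ci * L z = L0 z).
{ intros z. unfold L. rewrite Cmult_assoc, Cinv_r by exact Hn. ring. }
assert (Hint : forall z (k : Z), in_ball c r z -> L z <> IZR k).
{ intros z k Hz E. apply (H1 z Hz). rewrite <- EL by exact Hz.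
  rewrite <- EL', E. apply cexp_2PIi_Z. }
destruct (holo_sqrt L c r Hr HL) as [P [HP EP]].
{ intros z Hz. apply (Hint z 0%Z Hz). }
destruct (holo_sqrt (fun z => L z - 1) c r Hr) as [Q [HQ EQ]].
{ intros z Hz. destruct (HL z Hz) as [a Ha]. eexists.
  apply (is_derive_Cminus L (fun _ => RtoC 1)). exact Ha. apply is_derive_Cconst. }
{ intros z Hz E. apply (Hint z 1%Z Hz). apply Ceq_minus. exact E. }
assert (EPQ : forall z, in_ball c r z -> (P z - Q z) * (P z + Q z) = 1).
{ intros z Hz. replace ((P z - Q z) * (P z + Q z)) with (P z * P z - Q z * Q z) by ring.
  rewrite EP, EQ by exact Hz. ring. }
assert (HPQ : forall z, in_ball c r z -> P z - Q z <> 0).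
{ intros z Hz E. specialize (EPQ z Hz). rewrite E in EPQ.
  apply C1_nz. rewrite <- EPQ. ring. }
destruct (exists_log (P c - Q c) (HPQ c Hc)) as [h [Hh _]].
destruct (holo_log (fun z => P z - Q z) c r h Hr) as [H [HH [_ EH]]]; auto.
{ intros z Hz. destruct (HP z Hz) as [a Ha]. destruct (HQ z Hz) as [b Hb]. eexists.
  apply is_derive_Cminus; eassumption. }
assert (Ecosh : forall z, in_ball c r z -> Ccosh (H z) * Ccosh (H z) = L z).
{ intros z Hz. unfold Ccosh. rewrite cexp_opp, (EH z Hz).
  assert (Ei : / (P z - Q z) = P z + Q z).
  { replace (P z + Q z) with (/ (P z - Q z) * ((P z - Q z) * (P z + Q z))) by (field; apply HPQ, Hz).
    rewrite EPQ by exact Hz. ring. }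
  rewrite Ei, <- EP by exact Hz. field. }
exists H. split; [exact HH|split].
- intros z Hz. rewrite Ecosh, EL' by exact Hz. apply EL, Hz.
- rewrite Ecosh, EL' by exact Hc. exact EL0.
Qed.

Lemma Cmod_Ccosh_sqr_le z X : (Rabs (Re z) <= X)%R ->
  (Cmod (Ccosh z * Ccosh z) <= exp X * exp X)%R.
Proof.
intros HX.
assert (B : (Cmod (Ccosh z) <= exp X)%R).
{ unfold Ccosh, Cdiv. rewrite Cmod_mult, Cmod_inv by apply two_nz.
  rewrite Cmod_R, (Rabs_pos_eq 2) by lra.
  pose proof (Cmod_triangle (cexp z) (cexp (- z))) as T. rewrite !Cmod_cexp in T.
  apply Rabs_le_between in HX.
  assert (A1 : (exp (Re z) <= exp X)%R) by (apply exp_mono; lra).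
  assert (A2 : (exp (Re (- z)) <= exp X)%R) by (apply exp_mono; simpl; unfold Re in *; lra).
  lra. }
rewrite Cmod_mult. apply Rmult_le_compat; auto using Cmod_ge_0.
Qed.

Lemma Cmod_Ccosh_sqr_ge z :
  (exp (Rabs (Re z)) * exp (Rabs (Re z)) <= 4 * Cmod (Ccosh z * Ccosh z) + 2)%R.
Proof.
set (X := Rabs (Re z)).
assert (B : (exp X - exp (- X) <= 2 * Cmod (Ccosh z))%R).
{ replace (2 * Cmod (Ccosh z))%R with (Cmod (cexp z + cexp (- z))).
  2:{ unfold Ccosh, Cdiv. rewrite Cmod_mult, Cmod_inv by apply two_nz.
      rewrite Cmod_R, (Rabs_pos_eq 2) by lra. field. }
  pose proof (Cmod_tri_inv (cexp z) (- cexp (- z))) as T1.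
  pose proof (Cmod_tri_inv (cexp (- z)) (- cexp z)) as T2.
  rewrite Cmod_opp, !Cmod_cexp in T1, T2.
  replace (cexp z - - cexp (- z)) with (cexp z + cexp (- z)) in T1 by ring.
  replace (cexp (- z) - - cexp z) with (cexp z + cexp (- z)) in T2 by ring.
  replace (Re (- z)) with (- Re z)%R in * by reflexivity.
  unfold X, Rabs. destruct (Rcase_abs (Re z)); [rewrite Ropp_involutive|]; lra. }
rewrite Cmod_mult.
assert (E1 : (exp X * exp (- X) = 1)%R) by (rewrite <- exp_plus, Rplus_opp_r, exp_0; reflexivity).
assert (HX : (0 <= X)%R) by apply Rabs_pos.
assert (H1 : (1 <= exp X)%R) by (pose proof (exp_ineq1_le X); lra).
pose proof (exp_pos (- X)).
set (a := exp X) in *. set (b := exp (- X)) in *. set (m := Cmod (Ccosh z)) in *.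
assert (b <= a)%R by nra.
assert ((a - b) * (a - b) <= (2 * m) * (2 * m))%R by (apply Rmult_le_compat; lra).
nra.
Qed.

(** The range of [H] contains no disc of radius 7, so Bloch's theorem on the disc
    of radius [r / 2] about any [u] near the centre gives
    [|H'(u)| <= 256 * 7 / (r / 2) = 3584 / r]; this is integrated over a length
    of at most [r / 2]. *)
Lemma landau_lift_lipschitz H c r : (0 < r)%R -> holo H c r ->
  (forall z (n : Z), in_ball c r z -> Ccosh (H z) * Ccosh (H z) <> IZR n) ->
  forall z, (Cmod (z - c) <= r / 2)%R -> (Cmod (H z - H c) <= 1792)%R.
Proof.
intros Hr HH Hom z Hz.
assert (Hb : forall u, (Cmod (u - c) <= r / 2)%R -> (Cmod (Cderive H u) <= 3584 / r)%R).
{ intros u Hu.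
  assert (Hsub : forall v, in_ball u (r / 2) v -> in_ball c r v).
  { unfold in_ball. intros v Hv. pose proof (Cmod_tri3 v u c). lra. }
  replace (3584 / r)%R with (256 * 7 / (r / 2))%R by (field; lra).
  apply (bloch H (Cderive H)). lra. lra.
  - intros v Hv. apply Cderive_correct, HH, Hsub, Hv.
  - intros w. destruct (Ccosh_sqr_integer_near w) as [v [n [Hv En]]].
    exists v. split. exact Hv. intros x Hx Ex. apply (Hom x n (Hsub x Hx)). rewrite Ex. exact En. }
apply Rle_trans with (3584 / r * Cmod (z - c))%R.
- apply (mvt_ball H (Cderive H) c r).
  + intros v Hv. apply Cderive_correct, HH, Hv.
  + apply holo_cont_on, holo_Cderive, HH.
  + unfold in_ball. rewrite Cmod_self. exact Hr.
  + unfold in_ball. lra.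
  + intros t Ht. apply Hb. apply segment_dist; [exact Ht| |exact Hz]. rewrite Cmod_self. lra.
- replace 1792%R with (3584 / r * (r / 2))%R by (field; lra).
  apply Rmult_le_compat_l; [|exact Hz]. apply Rdiv_le_0_compat; lra.
Qed.

(** [exp 1792] is the factor by which [exp |Re H|] can grow when the Landau lift
    [H] moves by at most 1792; the factor 32 absorbs additive constants. *)
Definition schottky_const : R := (32 * (exp 1792 * exp 1792))%R.

Lemma schottky_const_ge : (32 <= schottky_const)%R.
Proof.
unfold schottky_const. assert (1 <= exp 1792)%R by (pose proof (exp_ineq1_le 1792); lra). nra.
Qed.

(** In the representation [g = exp (2 pi i cosh^2 H)] a bounded displacement of
    [H] multiplies [|cosh^2 H| + 1] by a bounded factor, and the modulus of
    [2 pi cosh^2 H] controls [|ln |g||]. The lift starts from the logarithm of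
    [g c] with imaginary part at most [PI], so it is controlled by [|ln |g c||]
    in turn. *)
Lemma schottky_abs_ln g c r : (0 < r)%R -> holo g c r ->
  (forall z, in_ball c r z -> g z <> 0) -> (forall z, in_ball c r z -> g z <> 1) ->
  forall z, (Cmod (z - c) <= r / 2)%R ->
  (Rabs (ln (Cmod (g z))) <= schottky_const * (Rabs (ln (Cmod (g c))) + 1))%R.
Proof.
intros Hr Hg H0 H1 z Hz.
assert (Hc : in_ball c r c) by (unfold in_ball; rewrite Cmod_self; exact Hr).
assert (Hzb : in_ball c r z) by (unfold in_ball; lra).
pose proof PI_RGT_0 as HPI. pose proof PI_4 as HP4.
destruct (exists_log (g c) (H0 c Hc)) as [l [Hl [Rel Iml]]].
destruct (landau_lift g c r l Hr Hg H0 H1 Hl) as [H [HH [EH EHc]]].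
set (L := fun z => Ccosh (H z) * Ccosh (H z)).
assert (Hlip : (Cmod (H z - H c) <= 1792)%R).
{ apply (landau_lift_lipschitz H c r Hr HH); [|exact Hz].
  intros u n Hu E. apply (H1 u Hu). rewrite <- EH by exact Hu. rewrite E. apply cexp_2PIi_Z. }
assert (Hre : (Rabs (Re (H z)) <= Rabs (Re (H c)) + 1792)%R).
{ pose proof (re_le_Cmod (H z - H c)) as K.
  replace (Re (H z - H c)) with (Re (H z) - Re (H c))%R in K by reflexivity.
  pose proof (Rabs_triang_inv (Re (H z)) (Re (H c))). lra. }
pose proof (Cmod_Ccosh_sqr_le (H z) _ Hre) as B1.
pose proof (Cmod_Ccosh_sqr_ge (H c)) as B2.
rewrite exp_plus in B1.
set (E := exp 1792) in *. set (a := exp (Rabs (Re (H c)))) in *.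
fold (L z) in B1. fold (L c) in B2.
assert (HE : (0 < E)%R) by apply exp_pos.
assert (BL : (Cmod (L z) <= E * E * (4 * Cmod (L c) + 2))%R).
{ eapply Rle_trans. exact B1. replace (a * E * (a * E))%R with (E * E * (a * a))%R by ring.
  apply Rmult_le_compat_l; nra. }
assert (Mod2PI : forall w, Cmod (2 * PI * Ci * w) = (2 * PI * Cmod w)%R).
{ intros w. rewrite !Cmod_mult, Cmod_Ci, !Cmod_R, !Rabs_pos_eq by lra. ring. }
assert (HLc : (2 * PI * Cmod (L c) <= Rabs (ln (Cmod (g c))) + 4)%R).
{ rewrite <- Mod2PI. unfold L. rewrite EHc.
  replace l with (Re l, Im l) by (destruct l; reflexivity).
  eapply Rle_trans. apply Cmod_le_sum. rewrite Rel. lra. }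
assert (HLz : (Rabs (ln (Cmod (g z))) <= 2 * PI * Cmod (L z))%R).
{ rewrite <- EH by exact Hzb. rewrite Cmod_cexp, ln_exp. fold (L z).
  rewrite <- Mod2PI. apply re_le_Cmod. }
pose proof (Cmod_ge_0 (L c)). pose proof (Rabs_pos (ln (Cmod (g c)))).
eapply Rle_trans. exact HLz.
apply Rle_trans with (E * E * (4 * (2 * PI * Cmod (L c)) + 16))%R.
- apply Rle_trans with (2 * PI * (E * E * (4 * Cmod (L c) + 2)))%R.
  apply Rmult_le_compat_l; lra.
  replace (2 * PI * (E * E * (4 * Cmod (L c) + 2)))%R with (E * E * (4 * (2 * PI * Cmod (L c)) + 4 * PI))%R by ring.
  apply Rmult_le_compat_l; nra.
- unfold schottky_const. fold E.
  replace (32 * (E * E) * (Rabs (ln (Cmod (g c))) + 1))%R with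
   (E * E * (32 * Rabs (ln (Cmod (g c))) + 32))%R by ring.
  apply Rmult_le_compat_l; nra.
Qed.

Lemma ln_le_sub1 x : (0 < x)%R -> (ln x <= x - 1)%R.
Proof.
intros Hx. pose proof (exp_ineq1_le (ln x)). rewrite exp_ln in H by exact Hx. lra.
Qed.

Lemma ln_2_ge : (/ 2 <= ln 2)%R.
Proof. left. exact ln_lt_2. Qed.

Lemma ln_2plus_ge x : (0 <= x)%R -> (/ 2 <= ln (2 + x))%R.
Proof.
intros Hx. apply Rle_trans with (ln 2). apply ln_2_ge. apply ln_le; lra.
Qed.

Definition schottky_const2 : R := (8 + 4 * schottky_const)%R.

(** When [g c] is not small, [|ln |g c||] is bounded by [ln (2 + |g c|)]. When it
    is small, [1 - g] also omits 0 and 1 and has [ln |1 - g c|] bounded. *)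
Theorem schottky g c r : (0 < r)%R -> holo g c r ->
  (forall z, in_ball c r z -> g z <> 0) -> (forall z, in_ball c r z -> g z <> 1) ->
  forall z, (Cmod (z - c) <= r / 2)%R ->
  (ln (2 + Cmod (g z)) <= schottky_const2 * ln (2 + Cmod (g c)))%R.
Proof.
intros Hr Hg H0 H1 z Hz. pose proof schottky_const_ge as HC.
assert (Hc : in_ball c r c) by (unfold in_ball; rewrite Cmod_self; exact Hr).
assert (Hzb : in_ball c r z) by (unfold in_ball; lra).
set (x := Cmod (g c)). assert (Hx : (0 < x)%R) by (apply Cmod_gt_0, H0, Hc).
set (y := Cmod (g z)). assert (Hy : (0 < y)%R) by (apply Cmod_gt_0, H0, Hzb).
pose proof (ln_2plus_ge x ltac:(lra)) as HL.
unfold schottky_const2.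
destruct (Rle_lt_dec (/ 2) x) as [Hx2|Hx2].
- pose proof (schottky_abs_ln g c r Hr Hg H0 H1 z Hz) as S. fold x y in S.
  assert (Hlx : (Rabs (ln x) <= ln (2 + x))%R).
  { apply Rabs_le. split.
    - assert (ln (/ 2) <= ln x)%R by (apply ln_le; lra). rewrite ln_Rinv in H by lra.
      assert (ln 2 <= ln (2 + x))%R by (apply ln_le; lra). lra.
    - apply ln_le; lra. }
  assert (S' : (Rabs (ln y) <= 3 * schottky_const * ln (2 + x))%R) by nra.
  assert (Hly : (ln (2 + y) <= 2 + Rabs (ln y))%R).
  { destruct (Rle_lt_dec y 1) as [Hy1|Hy1].
    - assert (ln (2 + y) <= ln 3)%R by (apply ln_le; lra).
      pose proof (ln_le_sub1 3 ltac:(lra)). pose proof (Rabs_pos (ln y)). lra.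
    - assert (ln (2 + y) <= ln (3 * y))%R by (apply ln_le; lra).
      rewrite ln_mult in H by lra. pose proof (ln_le_sub1 3 ltac:(lra)).
      pose proof (Rle_abs (ln y)). lra. }
  nra.
- assert (Hg' : holo (fun u => 1 - g u) c r).
  { intros u Hu. destruct (Hg u Hu) as [a Ha]. eexists.
    apply (is_derive_Cminus (fun _ => RtoC 1) g). apply is_derive_Cconst. exact Ha. }
  assert (N0 : forall u, in_ball c r u -> 1 - g u <> 0).
  { intros u Hu E. apply (H1 u Hu). symmetry. apply Ceq_minus, E. }
  assert (N1 : forall u, in_ball c r u -> 1 - g u <> 1).
  { intros u Hu E. apply (H0 u Hu). replace (g u) with (1 - (1 - g u)) by ring. rewrite E. ring. }
  pose proof (schottky_abs_ln _ c r Hr Hg' N0 N1 z Hz) as S. cbv beta in S.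
  assert (D1 : (/ 2 <= Cmod (1 - g c))%R).
  { pose proof (Cmod_tri_inv 1 (g c)) as T. rewrite Cmod_1 in T. fold x in T. lra. }
  assert (D2 : (Cmod (1 - g c) <= 2)%R).
  { unfold Cminus. eapply Rle_trans. apply Cmod_triangle. rewrite Cmod_opp, Cmod_1. fold x. lra. }
  assert (D3 : (Rabs (ln (Cmod (1 - g c))) <= 1)%R).
  { apply Rabs_le. pose proof (ln_le_sub1 2 ltac:(lra)). split.
    - assert (ln (/ 2) <= ln (Cmod (1 - g c)))%R by (apply ln_le; lra). rewrite ln_Rinv in H2 by lra. lra.
    - assert (ln (Cmod (1 - g c)) <= ln 2)%R by (apply ln_le; lra). lra. }
  set (m := Cmod (1 - g z)) in *.
  assert (Hm : (0 < m)%R) by (apply Cmod_gt_0, N0, Hzb).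
  assert (S2 : (ln m <= 2 * schottky_const)%R) by (pose proof (Rle_abs (ln m)); nra).
  assert (S3 : (m <= exp (2 * schottky_const))%R).
  { rewrite <- (exp_ln m) by exact Hm. apply exp_mono, S2. }
  assert (Hym : (y <= 1 + m)%R).
  { pose proof (Cmod_tri_inv (g z) 1) as T. rewrite Cmod_1, Cmod_sym in T. fold y m in T. lra. }
  assert (He : (1 <= exp (2 * schottky_const))%R).
  { pose proof (exp_ineq1_le (2 * schottky_const)). lra. }
  assert (K : (ln (2 + y) <= ln (4 * exp (2 * schottky_const)))%R) by (apply ln_le; lra).
  rewrite ln_mult, ln_exp in K by lra. pose proof (ln_le_sub1 4 ltac:(lra)). nra.
Qed.

(** [schottky] is applied to [(f - a) / (b - a)]. As [|b - a|] lies between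
    [delta * R] and [8 * R], passing between this quotient and [f / R] costs
    factors that depend on [delta] only. *)
Lemma schottky_scaled (delta : R) : (0 < delta)%R -> exists K : R, (1 <= K)%R /\
  forall (f : C -> C) (c : C) (r R : R) (a b : C), (0 < r)%R -> (0 < R)%R -> holo f c r ->
  (Cmod a <= 4 * R)%R -> (Cmod b <= 4 * R)%R -> (delta * R <= Cmod (b - a))%R ->
  (forall z, in_ball c r z -> f z <> a) -> (forall z, in_ball c r z -> f z <> b) ->
  forall z, (Cmod (z - c) <= r / 2)%R ->
  (ln (2 + Cmod (f z) / R) <= K * ln (2 + Cmod (f c) / R))%R.
Proof.
intros Hdelta. pose proof schottky_const_ge as HC.
set (A := (2 + 4 / delta)%R).
assert (Hi : (0 < / delta)%R) by (apply Rinv_0_lt_compat, Hdelta).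
assert (HA : (2 < A)%R) by (unfold A, Rdiv; lra).
assert (HlA : (0 < ln A)%R) by (rewrite <- ln_1; apply ln_increasing; lra).
assert (HC2 : (1 <= schottky_const2)%R) by (unfold schottky_const2; lra).
exists (15 * schottky_const2 * (2 * ln A + 1))%R. split. { nra. }
intros f c r R a b Hr HR Hf Ha Hb Hab Fa Fb z Hz.
set (D := Cmod (b - a)) in *. assert (HD : (0 < D)%R) by nra.
assert (Hba : b - a <> 0) by (apply Cmod_gt_0, HD).
set (g := fun u => (f u - a) * / (b - a)).
assert (Eg : forall u, f u = a + (b - a) * g u) by (intros u; unfold g; field; exact Hba).
assert (Hg : holo g c r).
{ intros u Hu. destruct (Hf u Hu) as [l Hl]. eexists.
  apply (is_derive_Cmult (fun u => f u - a) (fun _ => / (b - a))).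
  apply (is_derive_Cminus f (fun _ => a)). exact Hl. apply is_derive_Cconst. apply is_derive_Cconst. }
assert (G0 : forall u, in_ball c r u -> g u <> 0).
{ intros u Hu E. apply (Fa u Hu). rewrite Eg, E. ring. }
assert (G1 : forall u, in_ball c r u -> g u <> 1).
{ intros u Hu E. apply (Fb u Hu). rewrite Eg, E. ring. }
pose proof (schottky g c r Hr Hg G0 G1 z Hz) as S.
assert (HD8 : (D <= 8 * R)%R).
{ unfold D, Cminus. eapply Rle_trans. apply Cmod_triangle. rewrite Cmod_opp. lra. }
set (x := Cmod (g c)) in *. set (y := Cmod (g z)) in *.
assert (Hx : (0 <= x)%R) by apply Cmod_ge_0. assert (Hy : (0 <= y)%R) by apply Cmod_ge_0.
assert (B1 : (2 + Cmod (f z) / R <= 8 * (2 + y))%R).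
{ assert (Cmod (f z) <= 4 * R + 8 * R * y)%R.
  { rewrite Eg. eapply Rle_trans. apply Cmod_triangle. rewrite Cmod_mult. fold D y. nra. }
  assert (Cmod (f z) / R <= 4 + 8 * y)%R by (apply Rle_div_l; [exact HR|lra]). lra. }
set (X := (Cmod (f c) / R)%R).
assert (HX : (0 <= X)%R) by (apply Rdiv_le_0_compat; [apply Cmod_ge_0|exact HR]).
assert (B2 : (2 + x <= A * (2 + X))%R).
{ assert (D * x <= R * X + 4 * R)%R.
  { unfold D, x. rewrite <- Cmod_mult. replace ((b - a) * g c) with (f c + - a) by (rewrite (Eg c); ring).
    eapply Rle_trans. apply Cmod_triangle. rewrite Cmod_opp.
    replace (R * X)%R with (Cmod (f c)) by (unfold X; field; lra). lra. }
  assert (delta * x <= X + 4)%R.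
  { apply Rmult_le_reg_l with R. exact HR. nra. }
  assert (x <= (X + 4) / delta)%R by (apply Rle_div_r; [exact Hdelta|lra]).
  unfold A, Rdiv in *. nra. }
pose proof (ln_2plus_ge y Hy) as Ly. pose proof (ln_2plus_ge X HX) as LX. pose proof (ln_2plus_ge x Hx) as Lx.
assert (P0 : (0 <= Cmod (f z) / R)%R) by (apply Rdiv_le_0_compat; [apply Cmod_ge_0|exact HR]).
assert (C1 : (ln (2 + Cmod (f z) / R) <= 15 * ln (2 + y))%R).
{ apply Rle_trans with (ln (8 * (2 + y))). apply ln_le; lra.
  rewrite ln_mult by lra. pose proof (ln_le_sub1 8 ltac:(lra)). lra. }
assert (C2 : (ln (2 + x) <= (2 * ln A + 1) * ln (2 + X))%R).
{ apply Rle_trans with (ln (A * (2 + X))). apply ln_le; lra.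
  rewrite ln_mult by lra. nra. }
eapply Rle_trans. exact C1.
apply Rle_trans with (15 * (schottky_const2 * ln (2 + x)))%R. lra.
rewrite !Rmult_assoc. apply Rmult_le_compat_l. lra. apply Rmult_le_compat_l. lra. exact C2.
Qed.

(** * Propagation of growth along a circle *)

Lemma circle_lipschitz s a b : (0 <= s)%R ->
  (Cmod (circle 0 s b - circle 0 s a) <= s * Rabs (b - a))%R.
Proof.
intros Hs.
assert (H : forall a b, (a <= b)%R -> (Cmod (circle 0 s b - circle 0 s a) <= s * (b - a))%R).
{ clear a b. intros a b Hab.
  eapply is_CInt_bound; [exact Hab| |
    apply (is_CInt_derive_path (fun u => u) (fun _ => RtoC 1) (circle 0 s) (circle' s) a b Hab)].
  - intros t _. cbv beta. rewrite Cmod_mult, Cmod_1, circle'_mod by exact Hs. lra.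
  - intros t _. apply is_derive_Cid.
  - intros t _. apply continuous_const.
  - intros t. apply is_derive_circle.
  - intros t. apply continuous_circle'. }
destruct (Rle_lt_dec a b) as [Hab|Hab].
- rewrite Rabs_pos_eq by lra. apply H, Hab.
- rewrite Rabs_minus_sym, Rabs_pos_eq, Cmod_sym by lra. apply H. lra.
Qed.

Lemma circle_param s u : (0 < s)%R -> Cmod u = s ->
  exists t, (Rabs t <= PI)%R /\ u = circle 0 s t.
Proof.
intros Hs Hu.
assert (Hu0 : u <> 0) by (apply Cmod_gt_0; lra).
destruct (exists_log u Hu0) as [l [El [Rel Iml]]].
exists (Im l). split. exact Iml. rewrite Hu in Rel.
unfold circle. rewrite <- El.
replace l with (RtoC (Re l) + Im l * Ci) at 1 by (destruct l; apply injective_projections; simpl; ring).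
rewrite cexp_plus, cexp_R, Rel, exp_ln by exact Hs. ring.
Qed.

(** The distance from [u] to [v] along the circle is covered by [n] steps of
    length at most [rho], each of which costs a factor [K]. *)
Lemma circle_chain (Lam : C -> R) (s rho K : R) (n : nat) : (0 < s)%R -> (1 <= K)%R -> (0 < n)%nat ->
  (2 * PI * s <= INR n * rho)%R ->
  (forall u v, Cmod u = s -> Cmod v = s -> (Cmod (v - u) <= rho)%R -> (Lam v <= K * Lam u)%R) ->
  forall u v, Cmod u = s -> Cmod v = s -> (Lam v <= K ^ n * Lam u)%R.
Proof.
intros Hs HK Hn Hrho Hstep u v Hu Hv.
destruct (circle_param s u Hs Hu) as [a [Ha ->]].
destruct (circle_param s v Hs Hv) as [b [Hb ->]].
assert (Hn' : (0 < INR n)%R) by (apply lt_0_INR, Hn).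
set (th := fun k : nat => (a + INR k * ((b - a) / INR n))%R).
assert (Hmod : forall t, Cmod (circle 0 s t) = s).
{ intros t. rewrite <- (circle_dist 0 s t) at 2 by lra. f_equal. ring. }
assert (Hab : (Rabs (b - a) <= 2 * PI)%R).
{ apply Rabs_le_between in Ha. apply Rabs_le_between in Hb. apply Rabs_le. lra. }
assert (Hk : forall k, (Lam (circle 0 s (th k)) <= K ^ k * Lam (circle 0 s a))%R).
{ induction k.
  - unfold th. simpl. rewrite Rmult_0_l, Rplus_0_r. lra.
  - apply Rle_trans with (K * Lam (circle 0 s (th k)))%R.
    + apply Hstep; try apply Hmod.
      eapply Rle_trans. apply circle_lipschitz; lra.
      replace (th (S k) - th k)%R with ((b - a) / INR n)%R by (unfold th; rewrite S_INR; ring).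
      unfold Rdiv. rewrite Rabs_mult, (Rabs_pos_eq (/ INR n)) by (left; apply Rinv_0_lt_compat, Hn').
      apply Rmult_le_reg_l with (INR n). exact Hn'.
      replace (INR n * (s * (Rabs (b - a) * / INR n)))%R with (s * Rabs (b - a))%R by (field; lra).
      nra.
    + simpl. rewrite Rmult_assoc. apply Rmult_le_compat_l. lra. exact IHk. }
specialize (Hk n). replace (th n) with b in Hk. exact Hk.
unfold th. field. lra.
Qed.

(** * The case of a circle on which the function is large *)

Lemma far_point (L : list C) : forall a : R, exists x : R,
  (a <= x <= a + (2 * 2 ^ length L - 2))%R /\
  forall z, In z L -> (1 <= Cmod (x - z))%R.
Proof.
induction L as [|z L H]; intros a; simpl length.
- exists a. split. simpl; lra. easy.
- set (X := (2 * 2 ^ length L - 2)%R) in *.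
  replace (2 * 2 ^ S (length L) - 2)%R with (2 * X + 2)%R by (unfold X; simpl; ring).
  assert (HX : (0 <= X)%R).
  { unfold X. pose proof (pow_R1_Rle 2 (length L) ltac:(lra)). lra. }
  assert (Hre : forall x : R, (1 <= Rabs (x - Re z))%R -> (1 <= Cmod (x - z))%R).
  { intros x Hx. eapply Rle_trans. exact Hx.
    replace (x - Re z)%R with (Re (x - z)) by reflexivity. apply re_le_Cmod. }
  destruct (Rle_lt_dec (Re z) (a + X + 1)) as [Hz|Hz].
  + destruct (H (a + X + 2)%R) as [x [Hx HxL]]. exists x. split. lra.
    intros y [<-|Hy]; [|apply HxL, Hy]. apply Hre. rewrite Rabs_pos_eq; lra.
  + destruct (H a) as [x [Hx HxL]]. exists x. split. lra.
    intros y [<-|Hy]; [|apply HxL, Hy]. apply Hre. rewrite Rabs_left; lra.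
Qed.

Lemma root_product_ge L u : (forall z, In z L -> (1 <= Cmod (u - z))%R) ->
  (1 <= Cmod (root_product L u))%R.
Proof.
induction L as [|a L IH]; simpl; intros H.
- rewrite Cmod_1. lra.
- rewrite Cmod_mult. pose proof (H a (or_introl eq_refl)).
  assert (1 <= Cmod (root_product L u))%R by (apply IH; intros z Hz; apply H; right; exact Hz).
  nra.
Qed.

Lemma root_product_le L u d : (0 <= d)%R -> (forall z, In z L -> (Cmod (u - z) <= d)%R) ->
  (Cmod (root_product L u) <= d ^ length L)%R.
Proof.
intros Hd. induction L as [|a L IH]; simpl; intros H.
- rewrite Cmod_1. lra.
- rewrite Cmod_mult. apply Rmult_le_compat; try apply Cmod_ge_0.
  apply H. left; reflexivity. apply IH. intros z Hz. apply H. right; exact Hz.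
Qed.

Lemma Cmod_sub0 (z : C) : Cmod (z - 0) = Cmod z.
Proof. f_equal. ring. Qed.

(** If fewer than [N] zeros of [f - w] lay in the disc, dividing them out would
    leave a zero-free function whose inverse is tiny on the circle, hence inside
    by Cauchy's estimate; but [f - w] is not that large at a point of bounded
    modulus away from the zeros. *)
Lemma many_preimages_large_circle f N (s s' A B : R) (w : C) : entire f ->
  (1 <= s)%R -> (s < s')%R -> (4 * 2 ^ N <= s)%R ->
  (forall u, (Cmod u <= 2 * 2 ^ N)%R -> (Cmod (f u) <= A)%R) ->
  (forall u, (s <= Cmod u < s')%R -> (B <= Cmod (f u))%R) ->
  (s + 2 * (2 * s) ^ N * (A + s) < B)%R -> (Cmod w < s)%R ->
  at_least_preimages f (in_ball 0 s) w N.
Proof.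
intros Hf Hs1 Hss HsN HA HB HAB Hw.
assert (HA0 : (0 <= A)%R).
{ eapply Rle_trans. apply Cmod_ge_0. apply (HA 0). rewrite Cmod_0. pose proof (pow_lt 2 N ltac:(lra)). lra. }
assert (Hpw : (0 < (2 * s) ^ N)%R) by (apply pow_lt; lra).
assert (HBs : (s < B)%R) by nra.
assert (Hlow : forall u, (s <= Cmod u < s')%R -> (B - s <= Cmod (f u - w))%R).
{ intros u Hu. specialize (HB u Hu). pose proof (Cmod_tri_inv (f u) w). lra. }
destruct (divide_out_zeros N 0 s (fun u => f u - w)) as [L [h [Hh [E [HL Hor]]]]].
{ apply entire_minus_const, Hf. }
destruct Hor as [HN|[HN Hnz]].
- rewrite <- HN. apply (at_least_preimages_of_factor f _ w L h); try assumption.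
  + exists (RtoC s). intros H0.
    assert (Hms : Cmod s = s) by (rewrite Cmod_R, Rabs_pos_eq; lra).
    pose proof (Hlow (RtoC s)) as K. rewrite Hms, H0, Cmod_0 in K. lra.
  + intros z Hz. destruct (HL z Hz) as [H1 H2]. split. exact H1. apply Ceq_minus, H2.
- exfalso.
  assert (Hhnz : forall u, in_ball 0 s' u -> h u <> 0).
  { intros u Hu H0. unfold in_ball in Hu. rewrite Cmod_sub0 in Hu.
    destruct (Rlt_le_dec (Cmod u) s) as [Hus|Hus].
    - apply (Hnz u); [|exact H0]. unfold in_ball. rewrite Cmod_sub0. exact Hus.
    - specialize (Hlow u (conj Hus Hu)). rewrite E, H0 in Hlow.
      replace (root_product L u * 0) with (RtoC 0) in Hlow by ring. rewrite Cmod_0 in Hlow. lra. }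
  assert (Hinv : holo (fun u => / h u) 0 s').
  { intros u Hu. destruct (Hh u) as [a Ha]. eexists. apply (is_derive_Ccomp Cinv h).
    apply is_derive_Cinv, Hhnz, Hu. exact Ha. }
  destruct (far_point L 0) as [x [Hx HxL]].
  assert (HxN : (x <= 2 * 2 ^ N)%R).
  { assert (2 ^ length L <= 2 ^ N)%R by (apply Rle_pow; [lra|lia]). lra. }
  assert (Hmx : Cmod x = x) by (rewrite Cmod_R, Rabs_pos_eq; lra).
  assert (Hxs : (x <= s / 2)%R) by lra.
  assert (K : (Cmod (/ h x) <= s * ((2 * s) ^ N * / (B - s)) / (s - Cmod (x - 0)))%R).
  { apply (cauchy_estimate (fun u => / h u) 0 s'); try assumption; try lra.
    - unfold in_ball. rewrite Cmod_sub0, Hmx. lra.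
    - intros u Hu. rewrite Cmod_sub0 in Hu.
      assert (Hub : in_ball 0 s' u) by (unfold in_ball; rewrite Cmod_sub0; lra).
      assert (Hp : (Cmod (root_product L u) <= (2 * s) ^ N)%R).
      { eapply Rle_trans. apply (root_product_le L u (2 * s)). lra.
        - intros z Hz. destruct (HL z Hz) as [Hzb _]. unfold in_ball in Hzb. rewrite Cmod_sub0 in Hzb.
          unfold Cminus. eapply Rle_trans. apply Cmod_triangle. rewrite Cmod_opp. lra.
        - apply Rle_pow. lra. lia. }
      specialize (Hlow u ltac:(lra)). rewrite E, Cmod_mult in Hlow.
      rewrite Cmod_inv by (apply Hhnz, Hub).
      pose proof (proj1 (Cmod_gt_0 _) (Hhnz u Hub)) as Hhp.
      apply Rmult_le_reg_l with (Cmod (h u)). exact Hhp.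
      rewrite Rinv_r by lra.
      apply Rmult_le_reg_r with (B - s)%R. lra.
      replace (Cmod (h u) * ((2 * s) ^ N * / (B - s)) * (B - s))%R with (Cmod (h u) * (2 * s) ^ N)%R by (field; lra).
      nra. }
  rewrite Cmod_sub0, Hmx in K.
  assert (Hxb : in_ball 0 s' x) by (unfold in_ball; rewrite Cmod_sub0, Hmx; lra).
  rewrite Cmod_inv in K by (apply Hhnz, Hxb).
  pose proof (proj1 (Cmod_gt_0 _) (Hhnz x Hxb)) as Hhp.
  assert (Hup : (Cmod (h x) <= A + s)%R).
  { pose proof (root_product_ge L x HxL) as Hp.
    assert (Hfx : (Cmod (f x - w) <= A + s)%R).
    { unfold Cminus. eapply Rle_trans. apply Cmod_triangle. rewrite Cmod_opp.
      specialize (HA x ltac:(lra)). lra. }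
    rewrite E, Cmod_mult in Hfx. nra. }
  assert (K2 : (s * ((2 * s) ^ N * / (B - s)) / (s - x) <= 2 * (2 * s) ^ N / (B - s))%R).
  { apply Rle_div_l. lra.
    replace (s * ((2 * s) ^ N * / (B - s)))%R with ((2 * s) ^ N * / (B - s) * s)%R by ring.
    replace (2 * (2 * s) ^ N / (B - s) * (s - x))%R with ((2 * s) ^ N * / (B - s) * (2 * (s - x)))%R by (unfold Rdiv; ring).
    apply Rmult_le_compat_l; [|lra].
    apply Rmult_le_pos. lra. left. apply Rinv_0_lt_compat. lra. }
  assert (K3 : (/ (A + s) <= 2 * (2 * s) ^ N / (B - s))%R).
  { eapply Rle_trans; [|exact K2]. eapply Rle_trans; [|exact K].
    apply Rinv_le_contravar; lra. }
  apply Rle_div_r in K3; [|lra].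
  assert (K4 : (/ (A + s) * (B - s) * (A + s) <= 2 * (2 * s) ^ N * (A + s))%R) by (apply Rmult_le_compat_r; lra).
  replace (/ (A + s) * (B - s) * (A + s))%R with (B - s)%R in K4 by (field; lra). lra.
Qed.

(** * The case of discs that cover one another *)

Lemma NoDup_remove_all (x : nat) (l : list nat) : NoDup l -> NoDup (remove Nat.eq_dec x l).
Proof.
induction 1 as [|y l Hy Hl IH]; simpl. constructor.
destruct (Nat.eq_dec x y); [exact IH|]. constructor; [|exact IH].
intros H. apply in_remove in H. apply Hy, H.
Qed.

Lemma length_le_remove (x : nat) (l : list nat) : NoDup l ->
  (length l <= S (length (remove Nat.eq_dec x l)))%nat.
Proof.
induction 1 as [|y l Hy Hl IH]; simpl. lia.
destruct (Nat.eq_dec x y) as [->|n]; simpl; [|lia].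
rewrite notin_remove by exact Hy. lia.
Qed.

(** A relation in which each of [2 N] indices is related to at most one index:
    either every index has at most [N] predecessors, and all indices are kept,
    or one index has more, and its predecessors other than itself are kept. *)
Lemma covering_indices (N : nat) (rel : nat -> nat -> Prop) : (0 < N)%nat ->
  (forall j k l, (j < 2 * N)%nat -> (k < 2 * N)%nat -> (l < 2 * N)%nat -> rel j k -> rel j l -> k = l) ->
  exists J : list nat, J <> nil /\ (forall j, In j J -> (j < 2 * N)%nat) /\
    forall k, In k J -> exists J' : list nat, NoDup J' /\ incl J' J /\ (N <= length J')%nat /\
      forall j, In j J' -> ~ rel j k.
Proof.
intros HN HR.
set (b := fun k j => if excluded_middle_informative (rel j k) then true else false).
assert (Hb : forall k j, b k j = true <-> rel j k).
{ intros k j. unfold b. destruct excluded_middle_informative; split; easy. }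
set (idx := seq 0 (2 * N)).
assert (Hidx : forall j, In j idx <-> (j < 2 * N)%nat).
{ intros j. unfold idx. rewrite in_seq. lia. }
assert (Hnd : NoDup idx) by apply seq_NoDup.
destruct (classic (exists k0, (k0 < 2 * N)%nat /\ (N < length (filter (b k0) idx))%nat)) as [[k0 [Hk0 Hlen]]|Hno].
- set (J := remove Nat.eq_dec k0 (filter (b k0) idx)).
  assert (HJ : forall j, In j J -> (j < 2 * N)%nat /\ rel j k0 /\ j <> k0).
  { intros j Hj. apply in_remove in Hj. destruct Hj as [Hj Hne]. apply filter_In in Hj.
    destruct Hj as [H1 H2]. rewrite Hidx in H1. rewrite Hb in H2. auto. }
  assert (HJl : (N <= length J)%nat).
  { pose proof (length_le_remove k0 (filter (b k0) idx) (NoDup_filter _ Hnd)). fold J in H. lia. }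
  assert (HJnd : NoDup J).
  { apply NoDup_remove_all, NoDup_filter, Hnd. }
  exists J. split; [|split].
  + intros E. rewrite E in HJl. simpl in HJl. lia.
  + intros j Hj. apply HJ, Hj.
  + intros k Hk. exists J. repeat split; auto using incl_refl.
    intros j Hj Rjk. destruct (HJ j Hj) as [H1 [H2 _]]. destruct (HJ k Hk) as [H3 [_ H4]].
    apply H4. apply (HR j k k0); auto.
- exists idx. split; [|split].
  + intros E. assert (In 0%nat idx) by (apply Hidx; lia). rewrite E in H. easy.
  + apply Hidx.
  + intros k Hk. apply Hidx in Hk. exists (filter (fun j => negb (b k j)) idx).
    split; [|split; [|split]].
    * apply NoDup_filter, Hnd.
    * intros j Hj. apply filter_In in Hj. apply Hj.
    * pose proof (filter_length (b k) idx) as Hfl.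
      assert (length idx = 2 * N)%nat by apply length_seq.
      assert (~ (N < length (filter (b k) idx))%nat) by (intros H1; apply Hno; exists k; auto). lia.
    * intros j Hj. apply filter_In in Hj. destruct Hj as [_ Hj]. apply Bool.negb_true_iff in Hj.
      intros HRjk. apply Hb in HRjk. congruence.
Qed.

(** Disjoint discs contribute distinct preimages, each of multiplicity at least
    one. *)
Lemma many_preimages_discs f (D : nat -> C -> Prop) (V : C -> Prop) (w : C) (J : list nat) (N : nat) :
  entire f -> (exists u, f u <> w) -> NoDup J -> (N <= length J)%nat ->
  (forall j, In j J -> exists u, D j u /\ f u = w) ->
  (forall j u, In j J -> D j u -> V u) ->
  (forall j k u, In j J -> In k J -> D j u -> D k u -> j = k) ->
  at_least_preimages f V w N.
Proof.
intros Hf [u0 Hu0] HJ HN HD HV Hdis.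
assert (Hm : forall z, exists m : nat, f z = w -> (1 <= m)%nat /\ multiplicity f w z m).
{ intros z. destruct (entire_order (fun u => f u - w) z) as [m [q [Hq [Hqz Eq]]]].
  - apply entire_minus_const, Hf.
  - exists u0. apply Cminus_eq_contra, Hu0.
  - exists m. intros Hz. split.
    + destruct m; [|lia]. exfalso. apply Hqz. specialize (Eq z). simpl in Eq.
      rewrite Hz in Eq. replace (q z) with (1 * q z) by ring. rewrite <- Eq. ring.
    + apply (multiplicity_of_factor f w z m q Hq Hqz Eq). }
assert (Hc : exists m : C -> nat, forall z, f z = w -> (1 <= m z)%nat /\ multiplicity f w z (m z)).
{ exists (fun z => proj1_sig (constructive_indefinite_description _ (Hm z))).
  intros z. apply (proj2_sig (constructive_indefinite_description _ (Hm z))). }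
assert (Hu : exists u : nat -> C, forall j, In j J -> D j (u j) /\ f (u j) = w).
{ assert (HD' : forall j, exists u, In j J -> D j u /\ f u = w).
  { intros j. destruct (classic (In j J)) as [H|H].
    - destruct (HD j H) as [u Hu]. exists u. auto.
    - exists (RtoC 0). easy. }
  exists (fun j => proj1_sig (constructive_indefinite_description _ (HD' j))).
  intros j. apply (proj2_sig (constructive_indefinite_description _ (HD' j))). }
destruct Hc as [m Hm']. destruct Hu as [u Hu].
exists (map u J), m. split; [|split].
- apply NoDup_map_NoDup_ForallPairs; [|exact HJ].
  intros j k Hj Hk E. apply (Hdis j k (u j) Hj Hk). apply Hu, Hj. rewrite E. apply Hu, Hk.
- intros z Hz. apply in_map_iff in Hz. destruct Hz as [j [<- Hj]].
  destruct (Hu j Hj) as [H1 H2]. split; [apply (HV j); assumption|split; [exact H2|]].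
  apply Hm', H2.
- eapply Nat.le_trans. exact HN. clear HN HD HV Hdis HJ.
  induction J as [|j J IH]; simpl. lia.
  assert (H1 : (1 <= m (u j))%nat) by (apply Hm', Hu; left; reflexivity).
  assert (H2 : (length J <= list_sum (map m (map u J)))%nat) by (apply IH; intros k Hk; apply Hu; right; exact Hk).
  lia.
Qed.

(** * Circles lined with discs on which two distant values are omitted *)

Definition omits_far_pair (f : C -> C) (T delta : R) (c : C) (r : R) : Prop :=
  exists a b, (Cmod a <= 4 * T)%R /\ (Cmod b <= 4 * T)%R /\ (delta * T <= Cmod (b - a))%R /\
    (forall z, in_ball c r z -> f z <> a) /\ (forall z, in_ball c r z -> f z <> b).

Lemma omits_far_pair_sub f R delta c r c' r' :
  (forall z, in_ball c' r' z -> in_ball c r z) ->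
  omits_far_pair f R delta c r -> omits_far_pair f R delta c' r'.
Proof.
intros Hs (a & b & Ha & Hb & Hab & Fa & Fb). exists a, b. repeat split; auto.
Qed.

(** Schottky's theorem on overlapping discs around the circle. The lower bound is
    wanted on a whole annulus, so that [f - w] has no zeros on a neighbourhood of
    the circle; the last step leaves the circle and uses the smaller disc
    centred at [v], which omits the same pair. *)
Lemma growth_comparable_near_circle (delta : R) : (0 < delta)%R -> exists K : R, (1 <= K)%R /\
  forall (f : C -> C) (R r s : R) (n : nat), entire f -> (0 < R)%R -> (0 < r)%R -> (0 < s)%R ->
  (0 < n)%nat -> (2 * PI * s <= INR n * (r / 2))%R ->
  (forall u, Cmod u = s -> omits_far_pair f R delta u r) ->
  forall u v, Cmod u = s -> (s <= Cmod v <= s + r / 4)%R ->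
  (ln (2 + Cmod (f u) / R) <= K ^ S n * ln (2 + Cmod (f v) / R))%R.
Proof.
intros Hdelta. destruct (schottky_scaled delta Hdelta) as [K [HK S]].
exists K. split. exact HK.
intros f R r s n Hf HR Hr Hs Hn Hns Hom u v Hu Hv.
assert (Hstep : forall c rho z, (0 < rho)%R -> omits_far_pair f R delta c rho -> (Cmod (z - c) <= rho / 2)%R ->
  (ln (2 + Cmod (f z) / R) <= K * ln (2 + Cmod (f c) / R))%R).
{ intros c rho z Hrho (a & b & Ha & Hb & Hab & Fa & Fb) Hz.
  apply (S f c rho R a b); try assumption. apply entire_holo, Hf. }
set (k := (s / Cmod v)%R). set (v' := k * v).
assert (Hk : (0 < k)%R) by (apply Rdiv_lt_0_compat; lra).
assert (Hv' : Cmod v' = s).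
{ unfold v'. rewrite Cmod_mult, Cmod_R, Rabs_pos_eq by lra. unfold k. field. lra. }
assert (Hvv : (Cmod (v' - v) <= r / 4)%R).
{ replace (v' - v) with (RtoC (k - 1)%R * v) by (unfold v'; rewrite RtoC_minus; ring).
  rewrite Cmod_mult, Cmod_R.
  assert (Ek : (k * Cmod v = s)%R) by (unfold k; field; lra).
  rewrite Rabs_left1; nra. }
apply Rle_trans with (K ^ n * ln (2 + Cmod (f v') / R))%R.
- apply (circle_chain (fun z => ln (2 + Cmod (f z) / R)) s (r / 2) K n); try assumption.
  intros x y Hx Hy Hxy. apply (Hstep x r); auto.
- change (K ^ Datatypes.S n)%R with (K * K ^ n)%R. rewrite (Rmult_comm K), Rmult_assoc.
  apply Rmult_le_compat_l. apply pow_le; lra.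
  apply (Hstep v (r / 2)%R). lra.
  + apply (omits_far_pair_sub f R delta v' r); [|apply Hom, Hv'].
    unfold in_ball. intros z Hz. pose proof (Cmod_tri3 z v v'). rewrite (Cmod_sym v) in H. lra.
  + lra.
Qed.

(** * Choice of the open set *)

Lemma open_in_ball_union (P : nat -> Prop) (z : nat -> C) (r : R) :
  open (fun u => exists k, P k /\ in_ball (z k) r u).
Proof.
intros u [k [Hk Hu]]. apply locally_C_iff. exists (r - Cmod (u - z k))%R. split.
- unfold in_ball in Hu. lra.
- intros v Hv. exists k. split. exact Hk. unfold in_ball. pose proof (Cmod_tri3 v u (z k)). lra.
Qed.

Lemma at_least_preimages_weaken f V w N N' : (N' <= N)%nat ->
  at_least_preimages f V w N -> at_least_preimages f V w N'.
Proof.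
intros H (l & m & H1 & H2 & H3). exists l, m. repeat split; auto; try (apply H2; assumption). lia.
Qed.

Lemma at_least_preimages_image f V w N : at_least_preimages f V w (S N) -> image f V w.
Proof.
intros (l & m & _ & H2 & H3). destruct l as [|z l]. simpl in H3. lia.
destruct (H2 z (or_introl eq_refl)) as (HV & Hz & _). exists z. auto.
Qed.

Lemma nonpolynomial_nonconstant f w : ~ polynomial_function f -> exists u, f u <> w.
Proof.
intros Hp. apply NNPP. intros Hno. apply Hp. exists 0%nat, (fun _ => w). intros z.
rewrite sum_O. simpl. rewrite Cmult_1_r. apply NNPP. intros H. apply Hno. exists z. exact H.
Qed.

(** The radii of [2 * N] circles between [T] and [2 * T]. Consecutive ones are
    [T / (2 * N)] apart, so discs of radius [T / (8 * N)] centred on different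
    circles are at distance at least [T / (4 * N)]. *)
Definition concentric_radius (N : nat) (T : R) (j : nat) : R :=
  (T * (1 + (INR j + 1) / (2 * INR N)))%R.

Lemma concentric_radius_bounds N R j : (0 < R)%R -> (j < 2 * N)%nat ->
  (R * (1 + 1 / (2 * INR N)) <= concentric_radius N R j <= 2 * R)%R.
Proof.
intros HR Hj. unfold concentric_radius.
assert (HN : (0 < INR N)%R) by (apply lt_0_INR; lia).
assert (Hj' : (INR j + 1 <= 2 * INR N)%R).
{ rewrite <- S_INR. change 2%R with (INR 2). rewrite <- mult_INR. apply le_INR. lia. }
pose proof (pos_INR j).
assert (A1 : (1 / (2 * INR N) <= (INR j + 1) / (2 * INR N))%R).
{ apply Rmult_le_compat_r. left; apply Rinv_0_lt_compat; lra. lra. }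
assert (A2 : ((INR j + 1) / (2 * INR N) <= 1)%R) by (apply Rle_div_l; lra).
split; nra.
Qed.

Lemma concentric_radius_gap N R j k : (0 < R)%R -> (0 < N)%nat -> (j < k)%nat ->
  (R / (2 * INR N) <= concentric_radius N R k - concentric_radius N R j)%R.
Proof.
intros HR HN Hjk. unfold concentric_radius.
assert (HN' : (0 < INR N)%R) by (apply lt_0_INR; lia).
assert (H : (1 <= INR k - INR j)%R).
{ apply le_INR in Hjk. rewrite S_INR in Hjk. lra. }
replace (R * (1 + (INR k + 1) / (2 * INR N)) - R * (1 + (INR j + 1) / (2 * INR N)))%R
  with (R / (2 * INR N) * (INR k - INR j))%R by (field; lra).
assert (0 < R / (2 * INR N))%R by (apply Rdiv_lt_0_compat; lra). nra.
Qed.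

Lemma discs_separated N R (z : nat -> C) j k u v : (0 < R)%R -> (0 < N)%nat -> j <> k ->
  Cmod (z j) = concentric_radius N R j -> Cmod (z k) = concentric_radius N R k ->
  in_ball (z j) (R / (8 * INR N)) u -> in_ball (z k) (R / (8 * INR N)) v ->
  (/ (4 * INR N) * R <= Cmod (v - u))%R.
Proof.
intros HR HN Hjk Ej Ek Hu Hv.
assert (HN' : (0 < INR N)%R) by (apply lt_0_INR; lia).
assert (G : (R / (2 * INR N) <= Cmod (z k - z j))%R).
{ destruct (Nat.lt_total j k) as [H|[H|H]].
  - pose proof (concentric_radius_gap N R j k HR HN H). pose proof (Cmod_tri_inv (z k) (z j)). lra.
  - congruence.
  - pose proof (concentric_radius_gap N R k j HR HN H). pose proof (Cmod_tri_inv (z j) (z k)) as T.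
    rewrite Cmod_sym in T. lra. }
unfold in_ball in *.
pose proof (Cmod_tri3 (z k) v (z j)) as T1. pose proof (Cmod_tri3 v u (z j)) as T2.
rewrite (Cmod_sym (z k) v) in T1.
assert (E : (/ (4 * INR N) * R = R / (2 * INR N) - R / (8 * INR N) - R / (8 * INR N))%R) by (field; lra).
lra.
Qed.

(** If the image of a disc missed points of two different discs of the family,
    these would be two distant omitted values; hence each image contains all the
    discs but at most one, and [covering_indices] selects discs that are covered
    often enough by each other. *)
Lemma covering_discs_case f N R (z : nat -> C) : entire f -> ~ polynomial_function f ->
  (0 < N)%nat -> (0 < R)%R ->
  (forall j, (j < 2 * N)%nat -> Cmod (z j) = concentric_radius N R j) ->
  (forall j, (j < 2 * N)%nat -> ~ omits_far_pair f R (/ (4 * INR N)) (z j) (R / (8 * INR N))) ->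
  exists V : C -> Prop, (exists u, V u) /\ bounded_set V /\ open V /\
    forall w, V w -> at_least_preimages f V w N.
Proof.
intros Hf Hp HN HR Hz Hcov.
assert (HN' : (1 <= INR N)%R) by (replace 1%R with (INR 1) by reflexivity; apply le_INR; lia).
set (r := (R / (8 * INR N))%R) in *.
assert (Hr : (0 < r)%R) by (apply Rdiv_lt_0_compat; lra).
assert (Hr1 : (r <= R)%R) by (apply Rle_div_l; nra).
assert (Hsize : forall j u, (j < 2 * N)%nat -> in_ball (z j) r u -> (Cmod u <= 4 * R)%R).
{ intros j u Hj Hu. unfold in_ball in Hu.
  pose proof (concentric_radius_bounds N R j HR Hj) as [_ B]. rewrite <- (Hz j Hj) in B.
  pose proof (Cmod_tri_inv u (z j)). lra. }
set (misses := fun j k => exists a, in_ball (z k) r a /\ forall u, in_ball (z j) r u -> f u <> a).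
destruct (covering_indices N misses HN) as [J [HJ0 [HJ HJ']]].
{ intros j k l Hj Hk Hl [a [Ha Fa]] [b [Hb Fb]]. apply NNPP. intros Hkl.
  apply (Hcov j Hj). exists a, b. repeat split; eauto.
  apply (discs_separated N R z k l a b); auto. }
exists (fun u => exists k, In k J /\ in_ball (z k) r u). split; [|split; [|split]].
- destruct J as [|k J]; [easy|]. exists (z k), k. split. left; reflexivity.
  unfold in_ball. rewrite Cmod_self. exact Hr.
- exists (4 * R)%R. intros u [k [Hk Hu]]. apply (Hsize k); auto.
- apply open_in_ball_union.
- intros w [k [Hk Hw]]. destruct (HJ' k Hk) as [J' [H1 [H2 [H3 H4]]]].
  apply (many_preimages_discs f (fun j => in_ball (z j) r) _ w J'); auto.
  + apply nonpolynomial_nonconstant, Hp.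
  + intros j Hj. apply NNPP. intros Hno. apply (H4 j Hj). exists w. split. exact Hw.
    intros u Hu E. apply Hno. exists u. auto.
  + intros j u Hj Hu. exists j. auto.
  + intros j l u Hj Hl Hu Hu'. apply NNPP. intros Hjl.
    pose proof (discs_separated N R z j l u u HR HN Hjl (Hz j (HJ j (H2 j Hj))) (Hz l (HJ l (H2 l Hl))) Hu Hu') as K.
    rewrite Cmod_self in K.
    assert (0 < / (4 * INR N))%R by (apply Rinv_0_lt_compat; lra). nra.
Qed.

Lemma exists_INR_ge (x : R) : exists n : nat, (0 < n)%nat /\ (x <= INR n)%R.
Proof.
destruct (INR_unbounded x) as [n Hn]. exists (S n). split. lia. rewrite S_INR. lra.
Qed.

(** The exponent [m] and the threshold [R0] depend on the function only through
    its bound [A] on a fixed disc, so that a point [p] with [|f p| > R ^ m] and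
    [R >= R0] is available. Schottky's theorem turns this one large value into a
    lower bound [R ^ (N + 3)] along the circle. *)
Lemma large_circle_case (N : nat) (A : R) : (0 < N)%nat -> exists (m : nat) (R0 : R),
  forall (f : C -> C) (R s : R) (p : C), entire f -> (R0 <= R)%R ->
  (R * (1 + 1 / (2 * INR N)) <= s <= 2 * R)%R ->
  (Cmod p <= R)%R -> (R ^ m < Cmod (f p))%R ->
  (forall u, (Cmod u <= 2 * 2 ^ N)%R -> (Cmod (f u) <= A)%R) ->
  (forall u, Cmod u = s -> omits_far_pair f R (/ (4 * INR N)) u (R / (8 * INR N))) ->
  forall w, in_ball 0 s w -> at_least_preimages f (in_ball 0 s) w N.
Proof.
intros HN.
assert (HN' : (1 <= INR N)%R) by (replace 1%R with (INR 1) by reflexivity; apply le_INR; lia).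
destruct (growth_comparable_near_circle (/ (4 * INR N))) as [K [HK HG]].
{ apply Rinv_0_lt_compat; lra. }
(* the circumference is at most [16 * R], a step is [R / (16 * N)] *)
destruct (exists_INR_ge (256 * INR N)) as [n [Hn0 Hn]].
set (Q := (K ^ S n)%R).
assert (HQ : (1 <= Q)%R) by (apply pow_R1_Rle, HK).
destruct (exists_INR_ge (Q * INR (N + 3))) as [k [_ Hk]].
(* one of the two extra powers of [R] pays for the division by [R], the other
   for the factor [M] lost in Cauchy's estimate *)
exists (S (S k)). set (M := (2 * INR N + 1)%R).
assert (HpN : (1 <= 4 ^ N)%R) by (apply pow_R1_Rle; lra).
exists (Rmax (3 + M + 6 * 4 ^ N) (Rmax A (4 * 2 ^ N))).
intros f R s p Hf HR0 [Hs1 Hs2] Hp Hfp HA Hom w Hw.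
pose proof (Rmax_l (3 + M + 6 * 4 ^ N) (Rmax A (4 * 2 ^ N))) as R1.
pose proof (Rmax_r (3 + M + 6 * 4 ^ N) (Rmax A (4 * 2 ^ N))) as R2.
pose proof (Rmax_l A (4 * 2 ^ N)) as R3. pose proof (Rmax_r A (4 * 2 ^ N)) as R4.
assert (HM : (3 <= M)%R) by (unfold M; lra).
assert (HR : (3 <= R)%R) by lra.
assert (HRM : (M <= R)%R) by lra.
assert (Hi : (0 < 1 / (2 * INR N))%R) by (apply Rdiv_lt_0_compat; lra).
assert (HsR : (R / (2 * INR N) <= s - R)%R).
{ replace (R / (2 * INR N))%R with (R * (1 / (2 * INR N)))%R by (field; lra). lra. }
assert (HsR' : (0 < R / (2 * INR N))%R) by (apply Rdiv_lt_0_compat; lra).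
(* by Cauchy's estimate the circle carries a value almost as large as [f p] *)
assert (Hu : exists u, Cmod u = s /\ (R ^ S (S k) / M < Cmod (f u))%R).
{ apply NNPP. intros Hno. apply (Rlt_not_le _ _ Hfp).
  assert (E : (Cmod (f p) <= s * (R ^ S (S k) / M) / (s - Cmod (p - 0)))%R).
  { apply entire_cauchy_estimate. exact Hf. unfold in_ball. rewrite Cmod_sub0. lra.
    intros u Hu. rewrite Cmod_sub0 in Hu. apply Rnot_lt_le. intros H. apply Hno. exists u. auto. }
  rewrite Cmod_sub0 in E. eapply Rle_trans. exact E.
  assert (HP : (0 < R ^ S (S k))%R) by (apply pow_lt; lra).
  apply Rle_div_l. lra.
  replace (s * (R ^ S (S k) / M))%R with (R ^ S (S k) * (s / M))%R by (field; lra).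
  apply Rmult_le_compat_l. lra.
  apply Rle_div_l. lra. unfold M.
  apply Rle_div_l in HsR; [|lra]. nra. }
destruct Hu as [u [Hus Hfu]].
assert (HlR : (0 < ln R)%R) by (rewrite <- ln_1; apply ln_increasing; lra).
assert (HLu : (INR k * ln R <= ln (2 + Cmod (f u) / R))%R).
{ rewrite <- ln_pow by lra. apply ln_le. apply pow_lt; lra.
  assert (HP : (0 < R ^ k)%R) by (apply pow_lt; lra).
  apply Rle_trans with (Cmod (f u) / R)%R; [|lra].
  apply Rle_div_r. lra. left. eapply Rle_lt_trans; [|exact Hfu].
  apply -> Rle_div_r; [|lra]. simpl.
  assert (HP' : (0 <= R * R ^ k)%R) by (apply Rmult_le_pos; lra).
  pose proof (Rmult_le_compat_l _ _ _ HP' HRM). lra. }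
set (r := (R / (8 * INR N))%R) in *.
assert (Hr : (0 < r)%R) by (apply Rdiv_lt_0_compat; lra).
assert (Hlow : forall v, (s <= Cmod v < s + r / 4)%R -> (R ^ (N + 3) <= Cmod (f v))%R).
{ intros v Hv.
  assert (HLv : (ln (2 + Cmod (f u) / R) <= Q * ln (2 + Cmod (f v) / R))%R).
  { unfold Q. apply (HG f R r s n); try assumption; try lra.
    pose proof PI_4. pose proof PI_RGT_0.
    apply Rle_trans with (256 * INR N * (r / 2))%R.
    - unfold r. replace (256 * INR N * (R / (8 * INR N) / 2))%R with (16 * R)%R by (field; lra). nra.
    - apply Rmult_le_compat_r; lra. }
  assert (L1 : (INR (N + 3) * ln R <= ln (2 + Cmod (f v) / R))%R).
  { apply Rmult_le_reg_l with Q. lra.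
    apply Rle_trans with (INR k * ln R)%R; [|lra].
    rewrite <- Rmult_assoc. apply Rmult_le_compat_r; lra. }
  rewrite <- ln_pow in L1 by lra.
  assert (P0 : (0 <= Cmod (f v) / R)%R) by (apply Rdiv_le_0_compat; [apply Cmod_ge_0|lra]).
  assert (L2 : (R ^ (N + 3) <= 2 + Cmod (f v) / R)%R).
  { apply Rnot_lt_le. intros H. apply ln_increasing in H; lra. }
  assert (L3 : (R * (R ^ (N + 3) - 2) <= Cmod (f v))%R).
  { apply Rle_trans with (R * (Cmod (f v) / R))%R. apply Rmult_le_compat_l; lra. right; field; lra. }
  assert (27 <= R ^ (N + 3))%R.
  { rewrite pow_add. pose proof (pow_R1_Rle R N ltac:(lra)) as P1.
    pose proof (pow_incr 3 R 3 ltac:(lra)) as P3.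
    replace 27%R with (1 * 3 ^ 3)%R by (simpl; ring).
    apply Rmult_le_compat; try lra. }
  assert (3 * (R ^ (N + 3) - 2) <= R * (R ^ (N + 3) - 2))%R by (apply Rmult_le_compat_r; lra).
  lra. }
unfold in_ball in Hw. rewrite Cmod_sub0 in Hw.
apply (many_preimages_large_circle f N s (s + r / 4) A (R ^ (N + 3))); try assumption; try lra.
assert (PN : (0 < R ^ N)%R) by (apply pow_lt; lra).
assert (PN1 : (1 <= R ^ N)%R) by (apply pow_R1_Rle; lra).
assert (E4 : ((2 * s) ^ N <= 4 ^ N * R ^ N)%R).
{ rewrite <- Rpow_mult_distr. apply pow_incr. lra. }
assert (E5 : ((2 * s) ^ N * (A + s) <= 4 ^ N * R ^ N * (3 * R))%R).
{ apply Rmult_le_compat; try lra. apply pow_le; lra.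
  assert (0 <= A)%R.
  { eapply Rle_trans. apply Cmod_ge_0. apply (HA 0). rewrite Cmod_0. pose proof (pow_lt 2 N ltac:(lra)). lra. }
  lra. }
set (P := (R ^ N * R)%R).
assert (HP : (0 < P)%R) by (apply Rmult_lt_0_compat; lra).
assert (E6 : (R ^ (N + 3) = R * P * R)%R) by (unfold P; rewrite pow_add; simpl; ring).
assert (E7 : ((3 + 6 * 4 ^ N) * P <= R * P)%R) by (apply Rmult_le_compat_r; lra).
assert (E8 : (R <= P)%R).
{ unfold P. rewrite <- (Rmult_1_l R) at 1. apply Rmult_le_compat_r; lra. }
assert (E9 : (R * P * 1 <= R * P * R)%R).
{ apply Rmult_le_compat_l; [|lra]. apply Rmult_le_pos; lra. }
replace (4 ^ N * R ^ N * (3 * R))%R with (3 * (4 ^ N * P))%R in E5 by (unfold P; ring).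
rewrite E6. lra.
Qed.

Theorem theorem1p1 (f : C -> C) (hf : transcendental_entire f) (N : nat) :
  exists V : C -> Prop,
    (exists z : C, V z) /\
    bounded_set V /\
    open V /\
    (forall w : C, V w -> image f V w) /\
    (forall w : C, V w -> at_least_preimages f V w N).
Proof.
destruct hf as [Hf Hp].
(* with one preimage more than required, [V] is covered by its image even when
   [N = 0] *)
enough (H : exists V : C -> Prop, (exists u, V u) /\ bounded_set V /\ open V /\
    forall w, V w -> at_least_preimages f V w (S N)).
{ destruct H as [V (H1 & H2 & H3 & H4)]. exists V. repeat split; try assumption.
  - intros w Hw. apply (at_least_preimages_image f V w N), H4, Hw.
  - intros w Hw. apply (at_least_preimages_weaken f V w (S N)); [lia|]. apply H4, Hw. }
assert (HN : (0 < S N)%nat) by lia.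
destruct (entire_bounded f 0 (2 * 2 ^ S N) Hf) as [A HA].
destruct (large_circle_case (S N) A HN) as [m [R0 Hbig]].
destruct (nonpolynomial_growth f Hf Hp m (Rmax 1 R0)) as [R [p [HR [Hpr Hfp]]]].
assert (HR1 : (1 <= R)%R) by (eapply Rle_trans; [apply Rmax_l|exact HR]).
assert (HR2 : (R0 <= R)%R) by (eapply Rle_trans; [apply Rmax_r|exact HR]).
destruct (classic (exists j, (j < 2 * S N)%nat /\ forall u, Cmod u = concentric_radius (S N) R j ->
   omits_far_pair f R (/ (4 * INR (S N))) u (R / (8 * INR (S N))))) as [[j [Hj Hom]]|Hno].
- pose proof (concentric_radius_bounds (S N) R j ltac:(lra) Hj) as Hs.
  set (s := concentric_radius (S N) R j) in *.
  assert (Hs0 : (R <= s)%R).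
  { assert (0 < 1 / (2 * INR (S N)))%R.
    { apply Rdiv_lt_0_compat. lra. pose proof (lt_0_INR (S N) HN). lra. }
    nra. }
  exists (in_ball 0 s). split; [|split; [|split]].
  + exists (RtoC 0). unfold in_ball. rewrite Cmod_self. lra.
  + exists s. intros z Hz. unfold in_ball in Hz. rewrite Cmod_sub0 in Hz. lra.
  + intros u Hu. apply locally_C_iff. unfold in_ball in *. exists (s - Cmod (u - 0))%R. split. lra.
    intros v Hv. pose proof (Cmod_tri3 v u 0). lra.
  + apply (Hbig f R s p); try assumption.
    intros u Hu. apply HA. unfold closed_ball. rewrite Cmod_sub0. exact Hu.
- assert (Hz : forall j, exists z, (j < 2 * S N)%nat -> Cmod z = concentric_radius (S N) R j /\
     ~ omits_far_pair f R (/ (4 * INR (S N))) z (R / (8 * INR (S N)))).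
  { intros j. destruct (classic (j < 2 * S N)%nat) as [Hj|Hj].
    - apply NNPP. intros H. apply Hno. exists j. split. exact Hj. intros u Hu.
      apply NNPP. intros Hn. apply H. exists u. auto.
    - exists (RtoC 0). easy. }
  set (z := fun j => proj1_sig (constructive_indefinite_description _ (Hz j))).
  assert (Hz' : forall j, (j < 2 * S N)%nat -> Cmod (z j) = concentric_radius (S N) R j /\
     ~ omits_far_pair f R (/ (4 * INR (S N))) (z j) (R / (8 * INR (S N)))).
  { intros j. apply (proj2_sig (constructive_indefinite_description _ (Hz j))). }
  apply (covering_discs_case f (S N) R z); try assumption.
  lra. intros j Hj. apply Hz', Hj. intros j Hj. apply Hz', Hj.
Qed.
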